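(* Let $1\le r\le n$ and let $X\colon\Sigma^n\to\mathbb{R}^{n+1}$ be an $n$-dimensional complete hypersurface of $\mathbb{R}^{n+1}$ such that $\sup_{\Sigma^n}\|A\|^2<\infty$. If $P_{r-1}\colon T\Sigma^n\to T\Sigma^n$ is positive semidefinite, then for every function $u\in C^2(\Sigma^n)$ bounded from above there exists a sequence of points $x_k\in\Sigma^n$ such that $$\lim_{k\to\infty}u(x_k)=\sup_{\Sigma^n}u,\qquad \|\nabla u(x_k)\|<\frac1k\qquad\text{and}\qquad \mathcal{L}_{r-1}u(x_k)<\frac1k.$$
   Context: $X\colon\Sigma^n\to\mathbb{R}^{n+1}$ is a smooth isometric immersion of a connected $n$-dimensional Riemannian manifold without boundary, with a continuous globally defined unit normal field $N$; $X$ also denotes the position vector. The shape operator is $A(Y)=-\overline{\nabla}_Y N$, with $\overline\nabla$ the Levi-Civita connection of $\mathbb{R}^{n+1}$; its eigenvalues $k_1,\dots,k_n$ are the principal curvatures, and $\|A\|^2=\operatorname{trace}(A^2)$. The $r$-mean curvatures are $\sigma_0=1$, $\sigma_r=\sum_{i_1<\cdots<i_r}k_{i_1}\cdots k_{i_r}$ for $1\le r\le n$. The Newton transformations are $P_r=\sum_{j=0}^r(-1)^j\sigma_{r-j}A^j\colon T\Sigma^n\to T\Sigma^n$, $P_0=I$; positive semidefiniteness is meant at every point. For $0\le r\le n-1$ and a $C^2$ function $f$ on $\Sigma^n$, $L_rf=\operatorname{trace}(P_r\operatorname{hess}f)$, where $\operatorname{hess}f(v)=\nabla_v\nabla f$,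 and $\mathcal{L}_rf=L_rf-\langle X,\nabla f\rangle$. *)

(* Defs.v *)
From HB Require Import structures.
From mathcomp Require Import all_boot all_order all_algebra.
From mathcomp Require Import all_classical all_reals all_analysis.

Set Implicit Arguments.
Unset Strict Implicit.
Unset Printing Implicit Defensive.

Import Order.TTheory GRing.Theory Num.Theory.
Import numFieldNormedType.Exports.

Local Open Scope classical_set_scope.
Local Open Scope ring_scope.

(* Vectors of R^n are row vectors.  Their library norm is the sup norm, which  *)
(* only serves for the topology and for derivatives; Euclidean lengths are     *)
(* always taken with [dot].                                                    *)

Definition dot (R : realType) (m : nat) (v w : 'rV[R]_m) : R :=
  \sum_(i < m) v 0 i * w 0 i.

(* k-fold continuous differentiability on an open subset U of R^n *)
Fixpoint C_on (R : realType) (n : nat) (W : normedModType R) (k : nat)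
    (U : set 'rV[R]_n) (F : 'rV[R]_n -> W) : Prop :=
  (forall x, U x -> {for x, continuous F}) /\
  (if k is k'.+1 then
     forall i : 'I_n,
       (forall x, U x -> derivable F x (delta_mx 0 i)) /\
       C_on k' U (fun x => 'D_(delta_mx 0 i) F x)
   else True).

(* [coord] and [param] are total functions, relevant only on [cdom] and on     *)
(* its image [cimg] respectively.                                              *)
Record chart (R : realType) (n : nat) (T : topologicalType) := Chart {
  cdom : set T;
  coord : T -> 'rV[R]_n;
  param : 'rV[R]_n -> T;
  cimg := coord @` cdom;
  cdom_open : open cdom;
  cimg_open : open cimg;
  coordK : forall p, cdom p -> param (coord p) = p;
  coord_continuous : forall p, cdom p -> {for p, continuous coord};
  param_continuous : forall x, cimg x -> {for x, continuous param} }.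

Record smooth_manifold (R : realType) (n : nat) := SmoothManifold {
  carrier :> topologicalType;
  atlas : set (chart R n carrier);
  chart_at : carrier -> chart R n carrier;
  manifold_hausdorff : hausdorff_space carrier;
  manifold_second_countable : @second_countable carrier;
  chart_at_atlas : forall p, atlas (chart_at p);
  chart_at_dom : forall p, cdom (chart_at p) p;
  atlas_smooth : forall (c d : chart R n carrier) (k : nat),
    atlas c -> atlas d ->
    C_on k (coord c @` (cdom c `&` cdom d)) (coord d \o param c) }.

Definition C_manifold (R : realType) (n : nat) (M : smooth_manifold R n)
    (W : normedModType R) (k : nat) (F : M -> W) : Prop :=
  forall c : chart R n M, atlas c -> C_on k (cimg c) (F \o param c).

(* Local geometry of a parametrized patch [phi : R^n -> R^m] with the induced  *)
(* metric.  A tangent vector is the row [v] of its components in the frame     *)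
(* (d_0 phi, ..., d_(n-1) phi), i.e. it stands for ['D_v phi x = v *m 'J phi x].*)
(* An endomorphism of the tangent space is a matrix acting on such rows from   *)
(* the right.                                                                  *)
Section Patch.
Context {R : realType} {n m : nat} (phi : 'rV[R]_n -> 'rV[R]_m).

Definition metric (x : 'rV[R]_n) : 'M[R]_n :=
  \matrix_(i, j) dot ('D_(delta_mx 0 i) phi x) ('D_(delta_mx 0 j) phi x).

Definition ip (x v w : 'rV[R]_n) : R := (v *m metric x *m w^T) 0 0.

(* Christoffel symbol Gamma^k_ij of the Levi-Civita connection *)
Definition christoffel (x : 'rV[R]_n) (k i j : 'I_n) : R :=
  2^-1 * \sum_(l < n) invmx (metric x) k l *
    ('D_(delta_mx 0 i) (fun y => metric y j l) x
     + 'D_(delta_mx 0 j) (fun y => metric y i l) x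
     - 'D_(delta_mx 0 l) (fun y => metric y i j) x).

Definition cov (v : 'rV[R]_n) (V : 'rV[R]_n -> 'rV[R]_n) (x : 'rV[R]_n) :
    'rV[R]_n :=
  \row_k \sum_(i < n) v 0 i *
    ('D_(delta_mx 0 i) (fun y => V y 0 k) x
     + \sum_(j < n) christoffel x k i j * V x 0 j).

Definition patch_grad (f : 'rV[R]_n -> R) (x : 'rV[R]_n) : 'rV[R]_n :=
  (\row_j 'D_(delta_mx 0 j) f x) *m invmx (metric x).

Definition patch_hess (f : 'rV[R]_n -> R) (x : 'rV[R]_n) : 'M[R]_n :=
  lin1_mx (fun v => cov v (patch_grad f) x).

(* Components of the orthogonal projection of [w] on the tangent space; if [w] *)
(* is tangent, this is the row [v] such that [v *m 'J phi x = w].              *)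
Definition tangent_components (x : 'rV[R]_n) (w : 'rV[R]_m) : 'rV[R]_n :=
  (\row_j dot w ('D_(delta_mx 0 j) phi x)) *m invmx (metric x).

Definition patch_shape (nu : 'rV[R]_n -> 'rV[R]_m) (x : 'rV[R]_n) : 'M[R]_n :=
  lin1_mx (fun v => tangent_components x (- 'D_v nu x)).

End Patch.

(* The eigenvalues of a matrix, repeated according to their multiplicity, when *)
(* they all lie in R.                                                          *)
Definition eigenvalues (R : realType) (n : nat) (B : 'M[R]_n) : 'rV[R]_n :=
  xget 0 [set k : 'rV[R]_n | char_poly B = \prod_(i < n) ('X - (k 0 i)%:P)].

Definition elementary_symmetric (R : realType) (n r : nat) (k : 'rV[R]_n) : R :=
  \sum_(I : {set 'I_n} | #|I| == r) \prod_(i in I) k 0 i.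

Section Hypersurface.
Context {R : realType} {n : nat} {M : smooth_manifold R n}.
Context (X N : M -> 'rV[R]_n.+1).

Definition smooth_immersion : Prop :=
  (forall k, C_manifold k X) /\
  (forall (c : chart R n M) (x : 'rV[R]_n), atlas c -> cimg c x ->
     row_free ('J (X \o param c) x)).

Definition unit_normal_field : Prop :=
  [/\ continuous N,
      forall p, dot (N p) (N p) = 1 &
      forall (c : chart R n M) (p : M) (v : 'rV[R]_n), atlas c -> cdom c p ->
        dot (N p) ('D_v (X \o param c) (coord c p)) = 0].

(* From here on the components at [p] are those in the chart [chart_at p].     *)

Definition patch_at (p : M) : 'rV[R]_n -> 'rV[R]_n.+1 :=
  X \o param (chart_at p).

Definition coord_at (p : M) : 'rV[R]_n := coord (chart_at p) p.

Definition inner (p : M) (v w : 'rV[R]_n) : R :=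
  ip (patch_at p) (coord_at p) v w.

Definition tnorm (p : M) (v : 'rV[R]_n) : R := Num.sqrt (inner p v v).

Definition shape (p : M) : 'M[R]_n :=
  patch_shape (patch_at p) (N \o param (chart_at p)) (coord_at p).

Definition principal_curvatures (p : M) : 'rV[R]_n := eigenvalues (shape p).

Definition mean_curvature (r : nat) (p : M) : R :=
  elementary_symmetric r (principal_curvatures p).

Definition shape_sqnorm (p : M) : R := \tr (shape p ^+ 2).

Definition newton (r : nat) (p : M) : 'M[R]_n :=
  \sum_(j < r.+1) ((-1) ^+ j * mean_curvature (r - j)%N p) *: shape p ^+ j.

Definition positive_semidefinite (P : M -> 'M[R]_n) : Prop :=
  forall (p : M) (v : 'rV[R]_n), 0 <= inner p (v *m P p) v.

Definition grad (f : M -> R) (p : M) : 'rV[R]_n :=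
  patch_grad (patch_at p) (f \o param (chart_at p)) (coord_at p).

Definition hess (f : M -> R) (p : M) : 'M[R]_n :=
  patch_hess (patch_at p) (f \o param (chart_at p)) (coord_at p).

(* In [hess f p *m newton r p] the Hessian acts first. *)
Definition L (r : nat) (f : M -> R) (p : M) : R :=
  \tr (hess f p *m newton r p).

Definition drift_L (r : nat) (f : M -> R) (p : M) : R :=
  L r f p - dot (X p) ('D_(grad f p) (patch_at p) (coord_at p)).

(* C^1 curves are taken on all of R and restricted to [0, 1]: a curve that is  *)
(* C^1 on the closed interval extends, up to reparametrization outside of it.  *)
Definition C1_curve (g : R -> M) : Prop :=
  continuous g /\
  forall (c : chart R n M) (t : R), atlas c -> cdom c (g t) ->
    derivable (coord c \o g) t 1 /\ {for t, continuous (derive1 (coord c \o g))}.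

Definition speed (g : R -> M) (t : R) : R :=
  tnorm (g t) (derive1 (coord (chart_at (g t)) \o g) t).

Definition curve_length (g : R -> M) : R :=
  Rintegral (@lebesgue_measure R) `[0, 1] (speed g).

(* [piecewise_C1 p q l]: a piecewise C^1 curve of length l goes from p to q *)
Inductive piecewise_C1 (p : M) : M -> R -> Prop :=
| piecewise_C1_nil : piecewise_C1 p p 0
| piecewise_C1_rcons (g : R -> M) (l : R) :
    C1_curve g -> piecewise_C1 p (g 0) l ->
    piecewise_C1 p (g 1) (l + curve_length g).

Definition dist (p q : M) : R := inf [set l | piecewise_C1 p q l].

(* completeness of the metric space (M, dist) *)
Definition complete_hypersurface : Prop :=
  forall x : nat -> M,
    (forall e : R, 0 < e -> exists k0 : nat, forall i j : nat,
       (k0 <= i)%N -> (k0 <= j)%N -> dist (x i) (x j) < e) ->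
    exists p : M, dist (x k) p @[k --> \oo] --> (0 : R).

End Hypersurface.

(* Main.v *)
Require Import Defs.
From HB Require Import structures.
From mathcomp Require Import all_boot all_order all_algebra.
From mathcomp Require Import all_classical all_reals all_analysis.
From mathcomp Require Import ring lra.
(* repeated so that [coord] denotes the coordinates of a chart *)
Require Import Defs.

Set Implicit Arguments.
Unset Strict Implicit.
Unset Printing Implicit Defensive.

Import Order.TTheory GRing.Theory Num.Theory.
Import numFieldNormedType.Exports.

Local Open Scope classical_set_scope.
Local Open Scope ring_scope.

(** The difficulty is that u need not attain its supremum. Compactness comes
    from the ambient space, in two steps.

    Penalize u by a small multiple of a function of X: put
    v = u - ep ln (1 + |X|^2). As u is bounded above, the points where v
    exceeds its value at a fixed point o lie in a ball |X| <= B of the ambient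
    space. This is not yet compactness, because X need not be proper.

    The second step is the uniform graph property [uniform_graph]: by
    completeness and boundedness of the second fundamental form, around each
    point p the hypersurface contains a graph over a ball, in a coordinate
    hyperplane, of radius rho independent of p. Indeed the normal turns at a
    bounded rate ([normal_deriv_bound]), so that a coordinate of the normal
    which is large at p remains so as long as the projection to the hyperplane
    moves by less than rho; meanwhile the projection is a local homeomorphism,
    with sections that are Lipschitz for the intrinsic distance
    ([section_lipschitz]), and completeness lets such a section be continued
    ([section_exists]). Over a closed ball the function
    v - eta |X - X p|^2 attains its maximum; when v p is close enough to the
    supremum of v, the maximum is interior, and is a local maximum on the
    hypersurface at a point q with |X q - X p| <= 1 ([perturbed_max]).

    It remains to differentiate at q. By concavity of the logarithm, with
    al = ep / (1 + |X q|^2) and a = X p, the function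
    u - al |X|^2 - eta |X - a|^2 has a local maximum at q too. Let
    Z = 2 (al X + eta (X - a)). The gradient of u at q is the tangential part of
    Z ([grad_bound]), and the Gauss formula gives
    hess u <= 2 (al + eta) I + <Z, N> A ([hess_at_max]). Tracing against the
    positive semidefinite P = P_(r-1),
      L u - <X, grad u> <= 2 (al + eta) tr P + |Z| |tr (A P)| + |X| |Z|
    ([drift_L_bound]), where both traces are bounded in terms of the bound on
    |A| ([newton_trace_bound]). Since al (1 + |X q|^2) = ep, the terms in al are
    of the order of ep, including al |X|^2; the remaining term eta |X| is small
    because |X q| <= B and eta is chosen after B. *)

(** * Strict differentiability of C^1 maps *)

Lemma normrV_le (R : realType) (n : nat) (v : 'rV[R]_n) (e : R) :
  0 <= e -> (forall i, `|v 0 i| <= e) -> `|v| <= e.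
Proof.
move=> e0 ve; rewrite [leLHS]/Num.Def.normr/= mx_normrE.
by apply: bigmax_le => // -[i j] _; rewrite (ord1 i)/=.
Qed.

Lemma coord_le_norm (R : realType) (n : nat) (v : 'rV[R]_n) i :
  `|v 0 i| <= `|v|.
Proof.
rewrite [leRHS]/Num.Def.normr/= mx_normrE.
by apply: (le_trans _ (le_bigmax _ _ (ord0, i))) => /=; rewrite (_ : ord0 = 0).
Qed.

Lemma is_derive_line (R : realType) (V W : normedModType R) (f : V -> W) (x v : V)
    (t : R) (l : W) :
  is_derive (x + t *: v) v f l -> is_derive t 1 (fun s : R => f (x + s *: v)) l.
Proof.
have E : (fun h : R => h^-1 *: (((fun s : R => f (x + s *: v)) \o shift t) (h *: 1)
      - f (x + t *: v))) =
    (fun h : R => h^-1 *: ((f \o shift (x + t *: v)) (h *: v) - f (x + t *: v))).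
  apply/funext => h /=; congr (_ *: (f _ - _)).
  by rewrite addrCA scalerDl [h%:A]mulr1.
by case=> D1 D2; split; rewrite /derivable /derive E.
Qed.

Lemma segment_mvt (R : realType) (V : normedModType R) (f : V -> R) (x v : V) :
  (forall t : R, 0 <= t <= 1 -> derivable f (x + t *: v) v) ->
  exists2 c : R, 0 <= c <= 1 & f (x + v) - f x = 'D_v f (x + c *: v).
Proof.
move=> df.
have line (t : R) : 0 <= t <= 1 ->
    is_derive t 1 (fun s : R => f (x + s *: v)) ('D_v f (x + t *: v)).
  by move=> /df dft; apply: is_derive_line; exact: derivableP.
have [||c cI] := @MVT_segment R (fun s : R => f (x + s *: v))
  (fun t => 'D_v f (x + t *: v)) 0 1 ler01.
- move=> t; rewrite in_itv/= => /andP[t0 t1].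
  by apply: line; rewrite !ltW.
- apply: derivable_within_continuous => t; rewrite in_itv/= => tI.
  by case: (line _ tI).
- rewrite scale1r scale0r addr0 subr0 mulr1 => E.
  by exists c => //; move: cI; rewrite in_itv.
Qed.

Lemma is_derive_scale (R : realType) (V : normedModType R) (f : V -> R)
    (x v : V) (h : R) :
  derivable f x v -> derivable f x (h *: v) /\ 'D_(h *: v) f x = h * 'D_v f x.
Proof.
move=> df.
have line (k : R) : derivable f x (k *: v) = derivable (fun s : R => f (x + s *: (k *: v))) 0 1
    /\ 'D_(k *: v) f x = 'D_1 (fun s : R => f (x + s *: (k *: v))) 0.
  rewrite /derivable /derive.
  suff -> : (fun s : R => s^-1 *: ((f \o shift x) (s *: (k *: v)) - f x)) =
     (fun s : R => s^-1 *: (((fun s : R => f (x + s *: (k *: v))) \o shift 0) (s *: 1)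
        - f (x + 0 *: (k *: v)))) by [].
  by apply/funext => s /=; rewrite scale0r addr0 addr0 [s%:A]mulr1 [_ + x]addrC.
have := line 1; rewrite scale1r => -[E1 E2].
have [-> ->] := line h.
suff H : is_derive (0 : R) 1 (fun s : R => f (x + s *: (h *: v))) (h * 'D_v f x).
  by case: H.
rewrite (_ : (fun s : R => _) = (fun s : R => f (x + s *: v)) \o (fun s : R => s * h)); last first.
  by apply/funext => s /=; rewrite scalerA.
rewrite mulrC.
apply: is_derive1_comp; last first.
  rewrite (_ : (fun s : R => s * h) = h \*: id); last first.
    by apply/funext => s /=; rewrite [RHS]mulrC.
  by apply: is_derive_eq; rewrite [h%:A]mulr1.
rewrite mul0r E2; apply: derivableP; rewrite E1 in df; exact: df.
Qed.

(** Continuous partial derivatives give strict differentiability: moving one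
    coordinate at a time, each increment is controlled by a mean value. *)
Lemma C1_strict_scalar (R : realType) (n : nat) (f : 'rV[R]_n -> R)
    (U : set 'rV[R]_n) (x0 : 'rV[R]_n) :
  open U -> U x0 ->
  (forall x i, U x -> derivable f x (delta_mx 0 i)) ->
  (forall i, {for x0, continuous (fun x => 'D_(delta_mx 0 i) f x)}) ->
  forall e : R, 0 < e -> exists2 d : R, 0 < d & forall x x' : 'rV[R]_n,
    `|x - x0| < d -> `|x' - x0| < d ->
    `|f x' - f x - \sum_i (x' - x) 0 i * 'D_(delta_mx 0 i) f x0| <= e * `|x' - x|.
Proof.
move=> oU Ux0 df cf e e0.
have en0 : 0 < e / n.+1%:R by rewrite divr_gt0.
have : \forall x \near x0, U x /\ forall i,
    `|'D_(delta_mx 0 i) f x0 - 'D_(delta_mx 0 i) f x| < e / n.+1%:R.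
  near=> x; split; first by near: x; exact: open_nbhs_nbhs.
  near: x; apply: filter_forall => i.
  by have /cvgrPdist_lt/(_ _ en0) := cf i.
move=> /nbhs_ballP[d /= d0 dP]; exists d => // x x' xd x'd.
(* the corners of the path from x to x' that moves one coordinate at a time *)
pose z (k : nat) : 'rV[R]_n := \row_j (if (j < k)%N then x' 0 j else x 0 j).
have zx0 : z 0%N = x by apply/rowP => j; rewrite mxE ltn0.
have zxn : z n = x' by apply/rowP => j; rewrite mxE ltn_ord.
have step (i : 'I_n) : exists2 c, `|c - x0| < d &
    f (z i.+1) - f (z i) = (x' - x) 0 i * 'D_(delta_mx 0 i) f c.
  set h := (x' - x) 0 i.
  have zS : z i.+1 = z i + h *: delta_mx 0 i.
    apply/rowP => j; rewrite !mxE eqxx/= ltnS.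
    have [->|ji] := eqVneq j i; first by rewrite leqnn ltnn ?eqxx /h !mxE mulr1 addrC subrK.
    rewrite mulr0 addr0 leq_eqVlt; case: eqP => [/ord_inj ij|//].
    by rewrite ij eqxx in ji.
  (* in the sup norm the whole path stays in the ball *)
  have inball (t : R) : 0 <= t <= 1 -> `|z i + t *: (h *: delta_mx 0 i) - x0| < d.
    move=> /andP[t0 t1].
    have xx : Num.max `|x - x0| `|x' - x0| < d by rewrite gt_max xd.
    apply: le_lt_trans xx; apply: normrV_le => [|j].
      by rewrite le_max normr_ge0.
    have Hx : `|x 0 j - x0 0 j| <= Num.max `|x - x0| `|x' - x0|.
      rewrite le_max; apply/orP; left.
      by have := coord_le_norm (x - x0) j; rewrite !mxE.
    have Hx' : `|x' 0 j - x0 0 j| <= Num.max `|x - x0| `|x' - x0|.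
      rewrite le_max; apply/orP; right.
      by have := coord_le_norm (x' - x0) j; rewrite !mxE.
    rewrite !mxE eqxx/=.
    move: Hx Hx'; set m := Num.max _ _.
    have [->|ji] := eqVneq j i; move=> Hx Hx'; last first.
      by rewrite !mulr0 addr0; case: ifP.
    rewrite ltnn mulr1 /h !mxE.
    have -> : x 0 i + t * (x' 0 i - x 0 i) - x0 0 i =
       (1 - t) * (x 0 i - x0 0 i) + t * (x' 0 i - x0 0 i) by ring.
    apply: (le_trans (ler_normD _ _)).
    rewrite !normrM (ger0_norm t0) ger0_norm ?subr_ge0//.
    have -> : m = (1 - t) * m + t * m by ring.
    by rewrite lerD// ler_wpM2l// subr_ge0.
  have [|c cI E] := @segment_mvt R _ f (z i) (h *: delta_mx 0 i).
    move=> t tI; apply: (proj1 (is_derive_scale h _)).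
    apply: df; apply: (proj1 (dP _ _)).
    by rewrite -ball_normE/= distrC; exact: inball.
  exists (z i + c *: (h *: delta_mx 0 i)); first exact: inball.
  rewrite zS E; apply: (proj2 (is_derive_scale h _)).
  apply: df; apply: (proj1 (dP _ _)).
  by rewrite -ball_normE/= distrC; exact: inball.
have -> : f x' - f x = \sum_(i < n) (f (z i.+1) - f (z i)).
  rewrite -(big_mkord xpredT (fun i => f (z i.+1) - f (z i))).
  by rewrite telescope_sumr// zx0 zxn.
rewrite -sumrB; apply: (le_trans (ler_norm_sum _ _ _)).
apply: (@le_trans _ _ (\sum_(i < n) (e / n.+1%:R) * `|x' - x|)).
  apply: ler_sum => i _; have [c cd ->] := step i.
  rewrite -mulrBr normrM mulrC ler_pM// ?coord_le_norm//.
  apply: ltW; rewrite distrC; apply: (proj2 (dP _ _)).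
  by rewrite -ball_normE/= distrC.
rewrite sumr_const card_ord -[leLHS]mulr_natr mulrAC; apply: ler_wpM2r => //.
rewrite -mulrA; apply: ler_piMr; first exact: ltW.
by rewrite mulrC ler_pdivrMr ?ltr0Sn// mul1r ler_nat.
Unshelve. all: by end_near. Qed.

Lemma closed_ball_rV_compact (R : realType) (n : nat) (c : 'rV[R]_n) (r : R) :
  compact (closed_ball_ Num.Def.normr c r).
Proof.
apply: bounded_closed_compact; last exact: closed_closed_ball_.
exists (`|c| + r); split; first exact: num_real.
move=> b b1 x; rewrite /closed_ball_/= => xr.
apply: le_trans (ltW b1); rewrite -[x](subKr c).
by apply: (le_trans (ler_normB _ _)); rewrite lerD2l.
Qed.

Lemma continuous_normP (R : realType) (V W : normedModType R) (F : V -> W)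
    (x0 : V) :
  {for x0, continuous F} <->
  forall e : R, 0 < e -> exists2 d : R, 0 < d &
    forall x, `|x - x0| < d -> `|F x - F x0| < e.
Proof.
split=> [/cvgrPdist_lt cF e e0|cF].
  have /nbhs_normP[d /= d0 dP] := cF e e0; exists d => // x xd.
  by rewrite distrC; apply: dP; rewrite /ball_/= distrC.
apply/cvgrPdist_lt => e e0; have [d d0 dP] := cF e e0.
apply/nbhs_normP; exists d => // x /=; rewrite distrC => /dP.
by rewrite distrC.
Qed.

(** The general case reduces to a vanishing derivative by subtracting the
    candidate linear map. *)
Lemma differentiable_flat (R : realType) (V W : normedModType R) (F : V -> W)
    (x0 : V) :
  (forall e : R, 0 < e -> exists2 d : R, 0 < d &
     forall v, `|v| < d -> `|F (x0 + v) - F x0| <= e * `|v|) ->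
  differentiable F x0 /\ forall v, 'D_v F x0 = 0.
Proof.
move=> HF.
have E : F \o shift x0 = cst (F x0) + (\0 : V -> W) +o_ 0 id.
  apply/eqaddoP => _/posnumP[e].
  have [d d0 dP] := HF e%:num [gt0 of e%:num].
  apply/nbhs_ballP; exists d => // v; rewrite -ball_normE/= sub0r normrN => vd.
  have := dP v vd.
  rewrite /shift/= !fctE/= addr0 [v + x0]addrC; exact.
have [c0 _] := @dcst R V W (F x0) x0.
have D0 : 'd F x0 = (\0 : V -> W) :> (V -> W).
  exact: (@diff_unique R V W F (\0 : {linear V -> W}) x0 c0 E).
have dF : differentiable F x0 by apply/diff_locallyP; rewrite D0.
by split => // v; rewrite deriveE// D0.
Qed.

Lemma differentiable_approx (R : realType) (n : nat) (W : normedModType R)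
    (F : 'rV[R]_n -> W) (x0 : 'rV[R]_n) (w : 'I_n -> W) :
  (forall e : R, 0 < e -> exists2 d : R, 0 < d &
     forall v, `|v| < d ->
       `|F (x0 + v) - F x0 - \sum_i v 0 i *: w i| <= e * `|v|) ->
  differentiable F x0 /\ forall v, 'D_v F x0 = \sum_i v 0 i *: w i.
Proof.
move=> HF.
pose l (v : 'rV[R]_n) : W := \sum_i v 0 i *: w i.
have dl x : differentiable l x.
  rewrite (_ : l = \sum_(i < n) (fun v : 'rV[R]_n => v 0 i *: w i)); last first.
    by apply/funext => v; rewrite /l fct_sumE.
  apply: differentiable_sum => i; apply: differentiableZl.
  exact: differentiable_coord.
have lD x y : l (x + y) = l x + l y.
  by rewrite /l -big_split; apply: eq_bigr => i _; rewrite mxE scalerDl.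
have lZ (a : R) x : l (a *: x) = a *: l x.
  by rewrite /l scaler_sumr; apply: eq_bigr => i _; rewrite mxE scalerA.
have Dl v x : 'D_v l x = l v.
  apply: cvg_lim => //; apply: cvg_near_cst.
  near=> h; rewrite /= lD lZ addrK scalerA mulVf ?scale1r//.
  by near: h; exact: nbhs_dnbhs_neq.
have [|dG DG] := @differentiable_flat R _ W (F - l) x0.
  move=> e e0; have [d d0 dP] := HF e e0; exists d => // v /dP.
  have zz (a b c d' : W) : a - (c + d') - (b - c) = a - b - d'.
    by rewrite opprD opprB !addrA [a - c - d' + c]addrAC subrK addrAC.
  by rewrite !fctE lD zz.
have EF : F = (F - l) + l by rewrite subrK.
rewrite EF; split; first exact: differentiableD.
move=> v; rewrite deriveD; [|exact: diff_derivable..].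
by rewrite DG add0r Dl.
Unshelve. all: by end_near. Qed.

Lemma differentiable_bound (R : realType) (V W : normedModType R)
    (F : V -> W) (x0 : V) :
  differentiable F x0 ->
  forall e : R, 0 < e -> exists2 d : R, 0 < d &
    forall v, `|v| < d -> `|F (x0 + v) - F x0 - 'D_v F x0| <= e * `|v|.
Proof.
move=> dF e e0; have /diff_locallyP[_ /eqaddoP/(_ e e0)] := dF.
move=> /nbhs_ballP[d d0 dP]; exists d => // v vd.
have /= := dP v; rewrite -ball_normE/= sub0r normrN => /(_ vd).
by rewrite !fctE/= opprD addrA [v + x0]addrC deriveE.
Qed.

(** The Jacobian matrix, defined from partial derivatives alone so that it
    makes sense before differentiability is known. *)
Definition partial_mx (R : realType) (n m : nat) (F : 'rV[R]_n -> 'rV[R]_m)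
    (x : 'rV[R]_n) : 'M[R]_(n, m) :=
  \matrix_(i, j) ('D_(delta_mx 0 i) F x) 0 j.

Lemma mul_partial_mx (R : realType) (n m : nat) (F : 'rV[R]_n -> 'rV[R]_m)
    (x v : 'rV[R]_n) :
  v *m partial_mx F x = \sum_i v 0 i *: 'D_(delta_mx 0 i) F x.
Proof.
apply/rowP => j; rewrite !mxE summxE; apply: eq_bigr => i _.
by rewrite !mxE.
Qed.

Lemma C1_strict (R : realType) (n m : nat) (F : 'rV[R]_n -> 'rV[R]_m)
    (U : set 'rV[R]_n) (x0 : 'rV[R]_n) :
  open U -> U x0 -> C_on 1 U F ->
  forall e : R, 0 < e -> exists2 d : R, 0 < d & forall x x' : 'rV[R]_n,
    `|x - x0| < d -> `|x' - x0| < d ->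
    `|F x' - F x - (x' - x) *m partial_mx F x0| <= e * `|x' - x|.
Proof.
move=> oU Ux0 [cF dF] e e0.
have derF x i : U x -> derivable F x (delta_mx 0 i) by have [d _] := dF i; exact: d.
have : \forall d \near (0:R)^'+, forall j, forall x x' : 'rV[R]_n,
    `|x - x0| < d -> `|x' - x0| < d ->
    `|F x' 0 j - F x 0 j - \sum_i (x' - x) 0 i * ('D_(delta_mx 0 i) F x0) 0 j|
       <= e * `|x' - x|.
  apply: filter_forall => j.
  have DE i x : U x -> 'D_(delta_mx 0 i) (fun y => F y 0 j) x
      = ('D_(delta_mx 0 i) F x) 0 j.
    by move=> Ux; rewrite derive_mx ?mxE//; exact: derF.
  have [||d d0 dP] := @C1_strict_scalar R n (fun y => F y 0 j) U x0 oU Ux0 _ _ e e0.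
  - move=> x i Ux; have /derivable_mxP/(_ 0 j) := derF x i Ux; exact.
  - move=> i; have [_ [cD _]] := dF i.
    apply/continuous_normP => r r0.
    have /continuous_normP/(_ r r0)[d1 d10 d1P] := cD x0 Ux0.
    have /nbhs_normP[d2 /= d20 d2U] : nbhs x0 U by exact: open_nbhs_nbhs.
    exists (Num.min d1 d2) => [|x]; first by rewrite lt_min d10.
    rewrite lt_min => /andP[xd1 xd2].
    have Ux : U x by apply: d2U; rewrite /ball_ /= distrC.
    rewrite !DE//; apply: le_lt_trans (d1P x xd1).
    have := coord_le_norm ('D_(delta_mx 0 i) F x - 'D_(delta_mx 0 i) F x0) j.
    by rewrite !mxE.
  near=> d'; move=> x x' xd xd'.
  have dd' : d' < d by near: d'; exact: nbhs_right_lt.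
  have := dP x x' (lt_trans xd dd') (lt_trans xd' dd').
  by under eq_bigr do rewrite DE//.
move=> H.
have [d [d0 dP]] : exists d : R, 0 < d /\ forall j, forall x x' : 'rV[R]_n,
    `|x - x0| < d -> `|x' - x0| < d ->
    `|F x' 0 j - F x 0 j - \sum_i (x' - x) 0 i * ('D_(delta_mx 0 i) F x0) 0 j|
       <= e * `|x' - x|.
  near ((0 : R)^'+) => d; exists d; split; first by [].
  by near: d.
exists d => // x x' xd xd'; apply: normrV_le.
  by rewrite mulr_ge0// ltW.
move=> j; have := dP j x x' xd xd'; congr (`|_| <= _); rewrite !mxE.
by congr (_ - _); apply: eq_bigr => i _; rewrite !mxE.
Unshelve. all: by end_near. Qed.

Lemma C1_diff (R : realType) (n m : nat) (F : 'rV[R]_n -> 'rV[R]_m)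
    (U : set 'rV[R]_n) (x0 : 'rV[R]_n) :
  open U -> U x0 -> C_on 1 U F ->
  differentiable F x0 /\ forall v, 'D_v F x0 = v *m partial_mx F x0.
Proof.
move=> oU Ux0 cF.
have [|dF DF] := @differentiable_approx R n _ F x0
  (fun i => 'D_(delta_mx 0 i) F x0).
  move=> e e0; have [d d0 dP] := C1_strict oU Ux0 cF e0.
  exists d => // v vd; have := dP x0 (x0 + v).
  rewrite subrr normr0 [x0 + v - x0]addrAC subrr add0r => /(_ d0 vd).
  by rewrite mul_partial_mx.
by split => // v; rewrite DF mul_partial_mx.
Qed.

Lemma C1_diff_scalar (R : realType) (n : nat) (f : 'rV[R]_n -> R)
    (U : set 'rV[R]_n) (x0 : 'rV[R]_n) :
  open U -> U x0 -> C_on 1 U f ->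
  differentiable f x0 /\
  forall v, 'D_v f x0 = \sum_i v 0 i * 'D_(delta_mx 0 i) f x0.
Proof.
move=> oU Ux0 [cF dF].
apply: (@differentiable_approx R n _ f x0
  (fun i => 'D_(delta_mx 0 i) f x0)).
move=> e e0.
have [||d d0 dP] := @C1_strict_scalar R n f U x0 oU Ux0 _ _ e e0.
- by move=> x i Ux; have [d _] := dF i; exact: d.
- by move=> i; have [_ [cD _]] := dF i; exact: cD.
exists d => // v vd; have := dP x0 (x0 + v).
by rewrite subrr normr0 [x0 + v - x0]addrAC subrr add0r => /(_ d0 vd).
Qed.

Lemma jacobianE (R : realType) (n m : nat) (F : 'rV[R]_n -> 'rV[R]_m)
    (x : 'rV[R]_n) :
  differentiable F x -> 'J F x = partial_mx F x.
Proof.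
move=> dF; apply/matrixP => i j.
by rewrite !mxE deriveEjacobian// -rowE !mxE.
Qed.

(** * Expansion and local surjectivity *)

Lemma cvg_bigsum (R : realType) (T : Type) (F : set_system T) (FF : Filter F)
    (V : normedModType R) (I : Type) (r : seq I) (f : I -> T -> V) (l : I -> V) :
  (forall i, f i x @[x --> F] --> l i) ->
  (\sum_(i <- r) f i x) @[x --> F] --> \sum_(i <- r) l i.
Proof.
move=> fl; elim: r => [|i r IH].
  rewrite big_nil; under eq_fun do rewrite big_nil.
  exact: cvg_cst.
rewrite big_cons; under eq_fun do rewrite big_cons.
exact: (cvgD (fl i) IH).
Qed.

Lemma cvg_rowP (R : realType) (T : Type) (F : set_system T) (FF : Filter F)
    (n : nat) (f : T -> 'rV[R]_n) (l : 'rV[R]_n) :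
  f x @[x --> F] --> l <-> forall i, f x 0 i @[x --> F] --> l 0 i.
Proof.
split=> [/cvgrPdist_le fl i|fl].
  apply/cvgrPdist_le => e e0; apply: filterS (fl e e0) => x.
  by apply: le_trans; have := coord_le_norm (l - f x) i; rewrite !mxE.
apply/cvgrPdist_le => e e0.
have : \forall x \near F, forall i, `|l 0 i - f x 0 i| <= e.
  by apply: filter_forall => i; have /cvgrPdist_le := fl i; exact.
apply: filterS => x H; apply: normrV_le; first exact: ltW.
by move=> i; rewrite !mxE.
Qed.

Lemma cvg_mulmx_row (R : realType) (T : Type) (F : set_system T) (FF : Filter F)
    (n m : nat) (f : T -> 'rV[R]_n) (A : T -> 'M[R]_(n, m)) (l : 'rV[R]_n)
    (B : 'M[R]_(n, m)) :
  f x @[x --> F] --> l -> (forall i j, A x i j @[x --> F] --> B i j) ->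
  f x *m A x @[x --> F] --> l *m B.
Proof.
move=> /cvg_rowP fl AB; apply/cvg_rowP => j.
rewrite mxE; under eq_fun do rewrite mxE.
by apply: cvg_bigsum => i; apply: cvgM; [exact: fl|exact: AB].
Qed.

Lemma mulmx_row_bound (R : realType) (n m : nat) (A : 'M[R]_(n, m)) :
  exists2 c : R, 0 < c & forall v : 'rV[R]_n, `|v *m A| <= c * `|v|.
Proof.
pose s := \sum_i \sum_j `|A i j|.
have s0 : 0 <= s by apply: sumr_ge0 => i _; apply: sumr_ge0.
exists (1 + s) => [|v]; first by rewrite ltr_pwDl.
apply: normrV_le => [|j]; first by rewrite mulr_ge0// addr_ge0.
rewrite mxE; apply: (le_trans (ler_norm_sum _ _ _)).
apply: (@le_trans _ _ (s * `|v|)); last by rewrite ler_wpM2r// lerDr.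
rewrite /s mulr_suml; apply: ler_sum => i _.
rewrite normrM mulrC ler_pM// ?coord_le_norm//.
by rewrite (bigD1 j)//= lerDl sumr_ge0.
Qed.

(** A right inverse K of the derivative gives |v| <= c |v J|, and near x0
    the increment of F differs from v J by at most |v| / (2 c). *)
Lemma strict_expanding (R : realType) (n m : nat) (F : 'rV[R]_n -> 'rV[R]_m)
    (x0 : 'rV[R]_n) (J : 'M[R]_(n, m)) :
  row_free J ->
  (forall e : R, 0 < e -> exists2 d : R, 0 < d & forall x x' : 'rV[R]_n,
    `|x - x0| < d -> `|x' - x0| < d ->
    `|F x' - F x - (x' - x) *m J| <= e * `|x' - x|) ->
  exists2 c : R, 0 < c & exists2 d : R, 0 < d & forall x x' : 'rV[R]_n,
    `|x - x0| < d -> `|x' - x0| < d -> c * `|x' - x| <= `|F x' - F x|.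
Proof.
move=> /row_freeP[K JK] HF.
have [c c0 cP] := mulmx_row_bound K.
have e0 : 0 < c^-1 / 2 by rewrite divr_gt0// invr_gt0.
have [d d0 dP] := HF _ e0.
exists (c^-1 / 2) => //; exists d => // x x' xd xd'.
have := dP x x' xd xd'; set v := x' - x; set w := F x' - F x => H.
have vJ : c^-1 * `|v| <= `|v *m J|.
  rewrite -ler_pdivlMl ?invr_gt0// invrK.
  by have := cP (v *m J); rewrite -mulmxA JK mulmx1.
have : `|v *m J| <= `|w| + `|w - v *m J|.
  rewrite -[v *m J in leLHS](subKr w); apply: (le_trans (ler_normB _ _)).
  by [].
move=> H2; have := le_trans vJ H2.
move: H; set a := `|v|; set b := `|w|; set q := `|w - _| => H H3.
suff : c^-1 * a - c^-1 / 2 * a <= b.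
  by apply: le_trans; rewrite le_eqVlt; apply/orP; left; apply/eqP; field; rewrite gt_eqF.
by rewrite lerBlDr (le_trans H3)// lerD2l.
Qed.

(** Surjectivity is obtained by minimizing the distance to the target over a
    closed ball. The minimum is interior because F expands distances, and at
    an interior minimum which is not the target a Newton step would decrease
    the distance. *)
Lemma strict_onto (R : realType) (n : nat) (F : 'rV[R]_n -> 'rV[R]_n)
    (x0 : 'rV[R]_n) (J : 'M[R]_n) :
  row_free J ->
  (forall e : R, 0 < e -> exists2 d : R, 0 < d & forall x x' : 'rV[R]_n,
    `|x - x0| < d -> `|x' - x0| < d ->
    `|F x' - F x - (x' - x) *m J| <= e * `|x' - x|) ->
  (exists2 d : R, 0 < d & forall x, `|x - x0| < d -> {for x, continuous F}) ->
  forall D : R, 0 < D ->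
  exists2 r : R, 0 < r & forall y, `|y - F x0| < r ->
    exists2 x, `|x - x0| < D & F x = y.
Proof.
move=> rJ HF [d1 d10 Fcont] D D0.
have [c c0 [d2 d20 exF]] := strict_expanding rJ HF.
have /row_freeP[K JK] := rJ.
have KJ : K *m J = 1%:M by exact: mulmx1C.
have [k k0 kP] := mulmx_row_bound K.
have e0 : 0 < k^-1 / 2 by rewrite divr_gt0// invr_gt0.
have [d3 d30 dP] := HF _ e0.
pose r := Num.min (Num.min (d1 / 2) (d2 / 2)) (Num.min (d3 / 2) (D / 2)).
have r0 : 0 < r by rewrite !lt_min !divr_gt0.
have rd1 : r < d1.
  by rewrite !gt_min ltr_pdivrMr// mulr2n mulrDr mulr1 ltrDl d10.
have rd2 : r < d2.
  by rewrite !gt_min (ltr_pdivrMr _ d2)// mulr2n mulrDr mulr1 ltrDl d20 !orbT.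
have rd3 : r < d3.
  by rewrite !gt_min (ltr_pdivrMr _ d3)// mulr2n mulrDr mulr1 ltrDl d30 !orbT.
have rD : r < D.
  by rewrite !gt_min (ltr_pdivrMr _ D)// mulr2n mulrDr mulr1 ltrDl D0 !orbT.
exists (c * r / 2) => [|y yr]; first by rewrite !mulr_gt0// invr_gt0.
pose C := closed_ball_ Num.Def.normr x0 r.
have Cx0 : C x0 by rewrite /C/closed_ball_/= subrr normr0 ltW.
have Ccomp : compact C by exact: closed_ball_rV_compact.
have hcont : {within C, continuous (fun x => `|F x - y|)}.
  apply: continuous_in_subspaceT => x /set_mem; rewrite /C/closed_ball_/= => xC.
  have : {for x, continuous F}.
    by apply: Fcont; rewrite distrC (le_lt_trans xC).
  move=> /continuous_normP cF; apply/continuous_normP => e' e'0.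
  have [d' d'0 d'P] := cF e' e'0; exists d' => // z /d'P.
  apply: le_lt_trans; rewrite (le_trans (ler_dist_dist _ _))//.
  by rewrite opprB addrA subrK.
have [|x1 /set_mem x1C x1min] := EVT_min_rV _ Ccomp hcont; first by exists x0.
have minP x : `|x0 - x| <= r -> `|F x1 - y| <= `|F x - y|.
  by move=> xr; apply: x1min; apply: mem_set.
have h1 : `|F x1 - y| < c * r / 2.
  by apply: le_lt_trans (minP x0 Cx0) _; rewrite distrC.
have x1r : `|x1 - x0| < r.
  rewrite -(ltr_pM2l c0); apply: le_lt_trans (exF x0 x1 _ _) _.
  - by rewrite subrr normr0.
  - by rewrite distrC (le_lt_trans x1C).
  - rewrite -[F x1](subrK y) -addrA; apply: (le_lt_trans (ler_normD _ _)).
    rewrite [ltRHS](_ : _ = c * r / 2 + c * r / 2); last by field.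
    by rewrite ltrD.
exists x1; first exact: lt_trans x1r rD.
apply/eqP; rewrite -subr_eq0 -normr_le0 leNgt; apply/negP => h0.
set h := `|F x1 - y| in minP h0 h1.
pose w := (y - F x1) *m K.
have wJ : w *m J = y - F x1 by rewrite -mulmxA KJ mulmx1.
have wk : `|w| <= k * h by rewrite /h distrC; exact: kP.
(* a fraction t of the Newton step w, short enough to stay in the ball; it turns
   the distance h into at most (1 - t) h + t h / 2 *)
pose t := Num.min (1 / 2) ((r - `|x1 - x0|) / (2 * (k * h))).
have t0 : 0 < t.
  rewrite lt_min divr_gt0//= divr_gt0 ?subr_gt0// mulr_gt0// mulr_gt0//.
have t1 : t < 1 by rewrite gt_min ltr_pdivrMr// mul1r ltr1n.
have tw : `|t *: w| < r - `|x1 - x0|.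
  rewrite normrZ (gtr0_norm t0).
  apply: (@le_lt_trans _ _ (t * (k * h))); first by rewrite ler_wpM2l// ltW.
  apply: (@le_lt_trans _ _ ((r - `|x1 - x0|) / 2)).
    rewrite -ler_pdivlMr ?mulr_gt0//.
    have : t <= (r - `|x1 - x0|) / (2 * (k * h)) by rewrite ge_min lexx orbT.
    by rewrite invfM mulrA.
  by rewrite ltr_pdivrMr// mulr2n mulrDr mulr1 ltrDl subr_gt0.
have x2r : `|x1 + t *: w - x0| < r.
  rewrite addrAC; apply: (le_lt_trans (ler_normD _ _)).
  by rewrite -ltrBrDl.
have := minP (x1 + t *: w); rewrite distrC => /(_ (ltW x2r)); apply/negP.
rewrite -ltNge.
have := dP x1 (x1 + t *: w) (lt_trans x1r rd3) (lt_trans x2r rd3).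
rewrite [x1 + t *: w - x1]addrAC subrr add0r -scalemxAl wJ => H.
rewrite (_ : F _ - y = (F (x1 + t *: w) - F x1 - t *: (y - F x1)) +
  (1 - t) *: (F x1 - y)); last first.
  rewrite scalerBl scale1r -[y - F x1]opprB scalerN opprK.
  by rewrite addrACA subrr addr0 addrA subrK.
apply: (le_lt_trans (ler_normD _ _)).
rewrite [`|(1 - t) *: _|]normrZ (ger0_norm (_ : 0 <= 1 - t)) ?subr_ge0 ?ltW//.
rewrite -/h; apply: (@le_lt_trans _ _ (k^-1 / 2 * (t * (k * h)) + (1 - t) * h)).
  rewrite lerD2r; apply: (le_trans H).
  apply: ler_wpM2l; first exact: ltW.
  by rewrite normrZ (gtr0_norm t0) ler_wpM2l// ltW.
rewrite [X in X + _](_ : _ = t * h / 2); last by field; rewrite gt_eqF.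
rewrite -subr_gt0 [X in 0 < X](_ : _ = t * h / 2); last by field.
by rewrite divr_gt0// mulr_gt0.
Qed.

(** * Second derivatives and curves *)

Lemma diff_increment_bound (R : realType) (V : normedModType R) (g : V -> R)
    (x : V) :
  differentiable g x ->
  forall e : R, 0 < e -> exists2 d : R, 0 < d &
    forall a b : V, `|a| < d -> `|b| < d ->
    `|g (x + a) - g (x + b) - 'D_(a - b) g x| <= e * (`|a| + `|b|).
Proof.
move=> dg e e0; have [d d0 dP] := differentiable_bound dg e0.
exists d => // a b /dP Ha /dP Hb.
rewrite deriveE// linearB/= -!deriveE//.
rewrite (_ : _ - _ = (g (x + a) - g x - 'D_a g x)
   - (g (x + b) - g x - 'D_b g x)); last by ring.
by rewrite (le_trans (ler_normB _ _))// mulrDr lerD.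
Qed.

Lemma is_derive_translate (R : realType) (V W : normedModType R) (f : V -> W)
    (y a v : V) (df : W) :
  is_derive (y + a) v f df -> is_derive y v (fun z => f (z + a)) df.
Proof.
have E : (fun h : R => h^-1 *: (((fun z => f (z + a)) \o shift y) (h *: v)
      - f (y + a))) =
    (fun h : R => h^-1 *: ((f \o shift (y + a)) (h *: v) - f (y + a))).
  by apply/funext => h /=; rewrite addrA.
by case=> D1 D2; split; rewrite /derivable /derive E.
Qed.

(** The mean value theorem in the direction w, applied to the difference F y
    = f (y + t v) - f y, leaves an increment of gw, which is estimated by
    its differential at x. *)
Lemma second_difference (R : realType) (V : normedModType R) (f gw : V -> R)
    (U : set V) (x v w : V) :
  open U -> U x -> (forall y, U y -> is_derive y w f (gw y)) ->
  differentiable gw x ->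
  forall e : R, 0 < e -> exists2 d : R, 0 < d & forall t : R, 0 < t < d ->
    `|f (x + t *: v + t *: w) - f (x + t *: v) - f (x + t *: w) + f x
      - t ^+ 2 * 'D_v gw x| <= e * t ^+ 2.
Proof.
move=> oU Ux dfw dgw e e0.
pose c := `|v| + `|w| + 1.
have c0 : 0 < c by rewrite ltr_wpDl// addr_ge0.
have e'0 : 0 < e / (2 * c) by rewrite divr_gt0// mulr_gt0.
have [d d0 dP] := diff_increment_bound dgw e'0.
have /nbhs_normP[d1 /= d10 d1U] : nbhs x U by exact: open_nbhs_nbhs.
have m0 : 0 < Num.min d d1 by rewrite lt_min d0.
exists (Num.min d d1 / c) => [|t /andP[t0]]; first by rewrite divr_gt0.
rewrite ltr_pdivlMr// lt_min => /andP[td td1].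
have small (a b : R) : `|a| <= t -> `|b| <= t ->
    `|a *: v + b *: w| < d /\ U (x + a *: v + b *: w) /\
    `|a *: v + b *: w| <= c * t.
  move=> at_ bt.
  have H : `|a *: v + b *: w| <= c * t.
    apply: (le_trans (ler_normD _ _)); rewrite !normrZ /c !mulrDl mul1r.
    rewrite -[leLHS]addr0 lerD//; last exact: ltW.
    by rewrite lerD// mulrC ler_wpM2l.
  rewrite mulrC in td td1.
  split; first exact: le_lt_trans H td.
  split => //; apply: d1U; rewrite /ball_ /= -addrA opprD addrA subrr sub0r normrN.
  exact: le_lt_trans H td1.
have tt : `|t| <= t by rewrite gtr0_norm.
have t00 : `|0 : R| <= t by rewrite normr0 ltW.
pose F y := f (y + t *: v) - f y.
have dF (s : R) : 0 <= s <= 1 ->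
    is_derive (x + s *: (t *: w)) w F
      (gw (x + s *: (t *: w) + t *: v) - gw (x + s *: (t *: w))).
  move=> /andP[s0 s1].
  have st : `|s * t| <= t.
    by rewrite ger0_norm; [apply: ler_piMl => //; exact: ltW|rewrite mulr_ge0// ltW].
  apply: is_deriveB.
    have [_ [UU _]] := small t (s * t) tt st.
    have UU' : U (x + s *: (t *: w) + t *: v) by rewrite scalerA addrAC.
    exact: is_derive_translate (dfw _ UU').
  apply: dfw; have [_ [+ _]] := small 0 (s * t) t00 st.
  by rewrite scale0r addr0 scalerA.
have [|s sI sE] := @segment_mvt R V F x (t *: w).
  by move=> s /dF[D _]; have [] := is_derive_scale t D.
have [ders E] := dF s sI.
have [_ E2] := is_derive_scale t ders.
rewrite (_ : _ + f x = F (x + t *: w) - F x); last first.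
  by rewrite /F [x + t *: w + _]addrAC; ring.
rewrite sE E2 E expr2.
have /andP[s0 s1] := sI.
have st : `|s * t| <= t.
  by rewrite ger0_norm; [apply: ler_piMl => //; exact: ltW|rewrite mulr_ge0// ltW].
have [A1 [_ A2]] := small t (s * t) tt st.
have [B1 [_ B2]] := small 0 (s * t) t00 st.
rewrite scale0r add0r in B1 B2.
have Dlin : 'D_(t *: v) gw x = t * 'D_v gw x.
  by rewrite deriveE// linearZ/= -deriveE.
have := dP _ _ A1 B1; rewrite addrK Dlin !addrA.
rewrite !scalerA [x + (s * t) *: w + _]addrAC.
set G := gw _; set G' := gw _; set D := 'D_v gw x => H.
rewrite (_ : _ - _ = t * (G - G' - t * D)); last by rewrite /=; ring.
rewrite normrM gtr0_norm// [leLHS]mulrC mulrA; apply: ler_wpM2r; first exact: ltW.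
apply: (le_trans H).
apply: (@le_trans _ _ (e / (2 * c) * (c * t + c * t))).
  by apply: ler_wpM2l; [exact: ltW|exact: lerD].
by rewrite le_eqVlt; apply/orP; left; apply/eqP; field; rewrite gt_eqF.
Qed.

(** Both mixed derivatives are the limit of the same second difference
    quotient, which is symmetric in v and w. *)
Lemma schwarz (R : realType) (V : normedModType R) (f gv gw : V -> R)
    (U : set V) (x v w : V) :
  open U -> U x ->
  (forall y, U y -> is_derive y v f (gv y)) ->
  (forall y, U y -> is_derive y w f (gw y)) ->
  differentiable gv x -> differentiable gw x ->
  'D_v gw x = 'D_w gv x.
Proof.
move=> oU Ux dv dw dgv dgw; apply/eqP; rewrite -subr_eq0 -normr_le0.
apply/ler_addgt0Pr => e e0; rewrite add0r.
have e2 : 0 < e / 2 by rewrite divr_gt0.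
have [d d0 dP] := @second_difference R V f gw U x v w oU Ux dw dgw _ e2.
have [d' d'0 d'P] := @second_difference R V f gv U x w v oU Ux dv dgv _ e2.
pose t := Num.min d d' / 2.
have m0 : 0 < Num.min d d' by rewrite lt_min d0.
have t0 : 0 < t by rewrite divr_gt0.
have tm : t < Num.min d d' by rewrite ltr_pdivrMr// mulr2n mulrDr mulr1 ltrDl.
move: tm; rewrite lt_min => /andP[td td'].
have := dP t; rewrite t0 td => /(_ isT) H1.
have := d'P t; rewrite t0 td' => /(_ isT) H2.
have t20 : 0 < t ^+ 2 by rewrite exprn_gt0.
rewrite -(ler_pM2r t20) -[X in `|_| * X](gtr0_norm t20) -normrM.
rewrite [x + _ + t *: v]addrAC in H2.
move: H1 H2; set A := f (x + _ + _); set B := f (x + _); set C := f (x + _).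
set P := 'D_v _ _; set Q := 'D_w _ _ => H1 H2.
rewrite (_ : (P - Q) * t ^+ 2 = (A - C - B + f x - t ^+ 2 * Q) -
   (A - B - C + f x - t ^+ 2 * P)); last by ring.
apply: (le_trans (ler_normB _ _)).
rewrite (_ : e * t ^+ 2 = e / 2 * t ^+ 2 + e / 2 * t ^+ 2); last by field.
exact: lerD.
Qed.

Lemma near_eq_differentiable (R : realType) (V W : normedModType R)
    (f g : V -> W) (x : V) :
  (\near x, f x = g x) -> differentiable f x -> differentiable g x.
Proof.
move=> fg df; have fgx := nbhs_singleton fg.
have dh : differentiable (g - f) x.
  have [|] // := @differentiable_flat R V W (g - f) x.
  move=> e e0; have /nbhs_normP[d /= d0 dP] := fg; exists d => // v vd.
  rewrite !fctE fgx subrr subr0 dP; last first.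
    by rewrite /ball_/= opprD addrA subrr sub0r normrN.
  by rewrite subrr normr0 mulr_ge0// ltW.
by rewrite -[g](subrK f); exact: differentiableD.
Qed.

Lemma derive_row (R : realType) (V : normedModType R) (m : nat)
    (F : V -> 'rV[R]_m) (x v : V) (k : 'I_m) :
  derivable F x v -> ('D_v F x) 0 k = 'D_v (fun y => F y 0 k) x.
Proof. by move=> dF; rewrite (derive_mx dF) mxE. Qed.

Lemma C2_symmetric (R : realType) (n m : nat) (F : 'rV[R]_n -> 'rV[R]_m)
    (U : set 'rV[R]_n) (x : 'rV[R]_n) (i j : 'I_n) :
  open U -> U x -> C_on 2 U F ->
  'D_(delta_mx 0 i) (fun y => 'D_(delta_mx 0 j) F y) x =
  'D_(delta_mx 0 j) (fun y => 'D_(delta_mx 0 i) F y) x.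
Proof.
move=> oU Ux [cF dF].
have C1D k : C_on 1 U (fun y => 'D_(delta_mx 0 k) F y) by have [] := dF k.
have derD k l : derivable (fun y => 'D_(delta_mx 0 k) F y) x (delta_mx 0 l).
  by have [_ /(_ l)[+ _]] := C1D k; exact.
apply/rowP => k.
apply: (etrans (derive_row k (derD j i))); apply/esym.
apply: (etrans (derive_row k (derD i j))).
have isd l y : U y -> is_derive y (delta_mx 0 l) (fun z => F z 0 k)
    (('D_(delta_mx 0 l) F y) 0 k).
  move=> Uy; have [/(_ y Uy) dl _] := dF l.
  by split; [have /derivable_mxP := dl; exact|rewrite (derive_row k dl)].
have dD l : differentiable (fun y => ('D_(delta_mx 0 l) F y) 0 k) x.
  have [d _] := C1_diff oU Ux (C1D l).
  exact: (differentiable_comp d (differentiable_coord _ 0 k)).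
exact: (schwarz oU Ux (isd j) (isd i) (dD j) (dD i)).
Qed.

Lemma C1_curve_comp (R : realType) (n m : nat) (F : 'rV[R]_n -> 'rV[R]_m)
    (U : set 'rV[R]_n) (c : R -> 'rV[R]_n) (t : R) :
  open U -> C_on 1 U F -> U (c t) -> derivable c t 1 ->
  derivable (F \o c) t 1 /\
  derive1 (F \o c) t = derive1 c t *m partial_mx F (c t).
Proof.
move=> oU cF Uc /derivable1_diffP dc.
have [dF DF] := C1_diff oU Uc cF.
have dFc : differentiable (F \o c) t by exact: differentiable_comp.
split; first exact/derivable1_diffP.
rewrite (derive1E' dFc) (derive1E' dc) (diff_comp dc dF) -DF.
by rewrite (deriveE _ dF).
Qed.

Lemma C1_curve_comp_continuous (R : realType) (n m : nat)
    (F : 'rV[R]_n -> 'rV[R]_m) (U : set 'rV[R]_n) (c : R -> 'rV[R]_n) (t : R) :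
  open U -> C_on 1 U F -> U (c t) -> (\forall s \near t, derivable c s 1) ->
  {for t, continuous (derive1 c)} ->
  {for t, continuous (derive1 (F \o c))}.
Proof.
move=> oU cF Uc dc cc.
have ct : {for t, continuous c}.
  by apply: differentiable_continuous; apply/derivable1_diffP; exact: nbhs_singleton dc.
have nU : \forall s \near t, U (c s).
  by apply: ct; exact: open_nbhs_nbhs.
have E : \forall s \near t,
    derive1 c s *m partial_mx F (c s) = derive1 (F \o c) s.
  near=> s; have [||_ ->//] := @C1_curve_comp R n m F U c s oU cF.
    by near: s.
  by near: s.
have E0 : derive1 c t *m partial_mx F (c t) = derive1 (F \o c) t by exact: nbhs_singleton E.
suff : derive1 (F \o c) s @[s --> t] --> derive1 (F \o c) t by [].
rewrite -E0.
apply: cvg_trans (near_eq_cvg E) _.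
apply: cvg_mulmx_row; first exact: cc.
move=> i j; under eq_fun do rewrite mxE.
rewrite mxE.
have [_ /(_ i)[_ [/(_ _ Uc) cD _]]] := cF.
have cDc : 'D_(delta_mx 0 i) F (c s) @[s --> t] --> 'D_(delta_mx 0 i) F (c t).
  exact: (cvg_comp _ _ ct cD).
by have /cvg_rowP := cDc; exact.
Unshelve. all: by end_near. Qed.

Lemma row_mul_bound (R : realType) (m k : nat) (B : 'M[R]_(m, k)) (c : R) (v : 'rV[R]_m) :
  0 <= c -> (forall i j, `|B i j| <= c) -> `|v *m B| <= m%:R * c * `|v|.
Proof.
move=> c0 Bc; apply: normrV_le => [|j]; first by rewrite !mulr_ge0.
rewrite mxE; apply: (le_trans (ler_norm_sum _ _ _)).
apply: (@le_trans _ _ (\sum_(l < m) (`|v| * c))).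
  by apply: ler_sum => l _; rewrite normrM ler_pM// coord_le_norm.
rewrite sumr_const card_ord -[leLHS]mulr_natr.
by rewrite le_eqVlt; apply/orP; left; apply/eqP; ring.
Qed.

(** * Self-adjoint endomorphisms and Newton transformations *)

Section SymmetricMatrices.
Variable R : realType.

Definition quad (n : nat) (S : 'M[R]_n) (v : 'rV[R]_n) : R := (v *m S *m v^T) 0 0.

(** The quadratic form of a matrix split along its first coordinate, the
    shape in which an induction on the size uses it. *)
Lemma quad_block (n : nat) (a : R) (b : 'rV[R]_n) (D : 'M[R]_n) (t : R)
    (v : 'rV[R]_n) :
  quad (block_mx a%:M b (b^T) D : 'M[R]_(1 + n)) (row_mx (t%:M) v) =
  t ^+ 2 * a + 2 * t * (v *m b^T) 0 0 + quad D v.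
Proof.
rewrite /quad mul_row_block tr_row_mx mul_row_col tr_scalar_mx mul_mx_scalar.
rewrite !mul_scalar_mx mulmxDl -scalemxAl.
have -> : b *m v^T = (v *m b^T)^T by rewrite trmx_mul trmxK.
move: (v *m b^T) (v *m D *m v^T) => p q.
by rewrite !mxE eqxx mulr1n; ring.
Qed.

(** Cholesky factorization, by induction on the size: the Schur complement
    of the top left entry a is again positive semidefinite. *)
Lemma psd_factor (n : nat) (S : 'M[R]_n) :
  S^T = S -> (forall v, 0 <= quad S v) -> exists G : 'M[R]_n, S = G *m G^T.
Proof.
elim: n S => [|n IH] S symS psdS.
  by exists 0; apply/matrixP => -[].
pose S' : 'M[R]_(1 + n) := S.
pose a := ulsubmx S' 0 0; pose b := ursubmx S'; pose D := drsubmx S'.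
have symS' : S'^T = S' by exact: symS.
have bE : dlsubmx S' = b^T by rewrite /b -{1}symS' trmx_ursub.
have aE : ulsubmx S' = a%:M by exact: mx11_scalar.
have symD : D^T = D by rewrite /D -{2}symS' trmx_drsub.
have SE : S' = block_mx a%:M b (b^T) D by rewrite -(submxK S') bE aE.
have psd t v : 0 <= t ^+ 2 * a + 2 * t * (v *m b^T) 0 0 + quad D v.
  by rewrite -quad_block -SE; exact: psdS.
have a0 : 0 <= a.
  by have := psd 1 0; rewrite /quad !mul0mx !mxE mulr0 !addr0 expr1n mul1r.
(* if a = 0 but b has a nonzero entry, the form is negative at some sum of the
   j-th basis vector and of a multiple of the first one *)
have b0 : a = 0 -> b = 0.
  move=> az; apply/rowP => j; rewrite [RHS]mxE; apply/eqP; rewrite -[_ == _]negbK.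
  apply/negP => bj.
  have := psd (- (quad D (delta_mx 0 j) + 1) / (2 * b 0 j)) (delta_mx 0 j).
  rewrite az mulr0 add0r -rowE [(row _ _) 0 0]mxE [b^T _ _]mxE.
  rewrite (_ : 2 * _ * b 0 j = - (quad D (delta_mx 0 j) + 1)); last by field.
  by rewrite opprD addrAC addNr add0r ler0N1.
pose s := Num.sqrt a; pose c := s^-1 *: b^T.
have sc : s *: c = b^T.
  have [az|an] := eqVneq a 0; first by rewrite /c (b0 az) trmx0 !scaler0.
  rewrite /c scalerA divff ?scale1r// /s sqrtr_eq0 -ltNge lt_neqAle eq_sym an.
  exact: a0.
have cc : c *m c^T = a^-1 *: (b^T *m b).
  rewrite /c linearZ/= trmxK -scalemxAl -scalemxAr scalerA -invfM.
  by rewrite -expr2 sqr_sqrtr.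
have [||G' G'E] := IH (D - c *m c^T).
- by rewrite linearB/= symD trmx_mul trmxK.
- move=> v; have := psd (- a^-1 * (v *m b^T) 0 0) v.
  have -> : quad (D - c *m c^T) v = quad D v - a^-1 * (v *m b^T) 0 0 ^+ 2.
    rewrite /quad mulmxBr mulmxBl [LHS]mxE; congr (_ + _).
    rewrite cc [LHS]mxE -scalemxAr -scalemxAl [X in - X]mxE; congr (- (_ * _)).
    have -> : v *m (b^T *m b) *m v^T = (v *m b^T) *m (v *m b^T)^T.
      by rewrite trmx_mul trmxK !mulmxA.
    by move: (v *m b^T) => p; rewrite mxE big_ord1 mxE expr2.
  have [->|an] := eqVneq a 0; last by congr (0 <= _); field.
  by rewrite invr0 oppr0 !(mul0r, mulr0, add0r) subr0.
pose G1 : 'M[R]_(1 + n) := block_mx s%:M 0 c G'.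
exists G1; suff : S' = G1 *m G1^T by [].
rewrite SE /G1 tr_block_mx mulmx_block !trmx0 tr_scalar_mx !mulmx0 !mul0mx.
rewrite !addr0 -scalar_mxM -expr2 sqr_sqrtr// mul_scalar_mx mul_mx_scalar sc.
rewrite (_ : s *: c^T = b) ?[c *m c^T + _]addrC; last first.
  by rewrite -[RHS]trmxK -sc [RHS]linearZ.
by rewrite -G'E subrK.
Qed.

Lemma quad_mul (n : nat) (G : 'M[R]_n) v : quad (G *m G^T) v = quad 1%:M (v *m G).
Proof. by rewrite /quad mulmx1 trmx_mul !mulmxA. Qed.

Lemma quad1 (n : nat) (v : 'rV[R]_n) : quad 1%:M v = \sum_i v 0 i ^+ 2.
Proof.
by rewrite /quad mulmx1 mxE; apply: eq_bigr => i _; rewrite mxE expr2.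
Qed.

(** Writing Q = E E^T turns the trace into the sum of the values of S on the
    rows of E^T. *)
Lemma trace_nsd_psd (n : nat) (S Q : 'M[R]_n) :
  (forall v, quad S v <= 0) -> Q^T = Q -> (forall v, 0 <= quad Q v) ->
  \tr (S *m Q) <= 0.
Proof.
move=> nsdS symQ /(psd_factor symQ)[E ->].
rewrite mulmxA mxtrace_mulC mulmxA; apply: sumr_le0 => i _.
have := nsdS (row i E^T); rewrite /quad; congr (_ <= _).
rewrite -row_mul tr_row trmxK mxE [RHS]mxE.
by apply: eq_bigr => j _; rewrite !mxE.
Qed.

Lemma cauchy_schwarz_sum (I : finType) (a b : I -> R) :
  (\sum_i a i * b i) ^+ 2 <= (\sum_i a i ^+ 2) * (\sum_i b i ^+ 2).
Proof.
set P := \sum_i a i * b i; set A := \sum_i a i ^+ 2; set B := \sum_i b i ^+ 2.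
have B0 : 0 <= B by apply: sumr_ge0 => i _; rewrite sqr_ge0.
have [Bz|Bn] := eqVneq B 0.
  have bz i : b i = 0.
    by apply/eqP; rewrite -sqrf_eq0; move/eqP: Bz; rewrite psumr_eq0 => [/allP/(_ i)|*];
      [rewrite mem_index_enum => /(_ isT)|exact: sqr_ge0].
  by rewrite /P big1 ?expr0n ?Bz ?mulr0// => i _; rewrite bz mulr0.
have Bp : 0 < B by rewrite lt_neqAle eq_sym Bn.
have : 0 <= \sum_i (a i * B - P * b i) ^+ 2.
  by apply: sumr_ge0 => i _; rewrite sqr_ge0.
rewrite (_ : \sum_i _ = B * (A * B - P ^+ 2)); first by rewrite pmulr_rge0// subr_ge0.
rewrite (eq_bigr (fun i => B ^+ 2 * a i ^+ 2 + (- 2 * P * B * (a i * b i)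
  + P ^+ 2 * b i ^+ 2))) => [|i _]; last by ring.
by rewrite !big_split/= -!mulr_sumr -/A -/B -/P; ring.
Qed.

Lemma posdef_unitmx (n : nat) (g : 'M[R]_n) :
  (forall v, v != 0 -> 0 < quad g v) -> g \in unitmx.
Proof.
move=> pos; rewrite -row_free_unit -kermx_eq0; apply/negPn/negP => /rowV0Pn[v].
move=> /sub_kermxP vg /pos; rewrite /quad vg mul0mx mxE ltxx.
by [].
Qed.

(** For a metric g and a symmetric form h, the endomorphism h g^-1 is
    self-adjoint, hence symmetric in orthonormal coordinates; the Cholesky
    factor of g provides these coordinates. This replaces the spectral
    theorem. *)
Lemma selfadjoint_similar (n : nat) (g h : 'M[R]_n) :
  g^T = g -> (forall v, v != 0 -> 0 < quad g v) -> h^T = h ->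
  exists G B : 'M[R]_n, [/\ G \in unitmx, g = G *m G^T, B^T = B &
    h *m invmx g *m G = G *m B].
Proof.
move=> symg pos symh.
have ug := posdef_unitmx pos.
have [|G gE] := psd_factor symg.
  move=> v; have [->|/pos/ltW//] := eqVneq v 0.
  by rewrite /quad !mul0mx mxE.
have uG : G \in unitmx by move: ug; rewrite gE unitmx_mul => /andP[].
have uGt : G^T \in unitmx by rewrite unitmx_tr.
exists G, (invmx G *m h *m invmx G^T); split => //.
  by rewrite !trmx_mul symh trmx_inv trmx_inv trmxK mulmxA.
rewrite !mulmxA mulmxV// mul1mx -[RHS]mulmx1 -[1%:M](mulVmx uG) !mulmxA.
congr (_ *m G); rewrite -!mulmxA; congr (h *m _).
apply: (can_inj (mulKmx ug)); rewrite mulmxV// gE.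
by rewrite !mulmxA -[G *m _ *m _]mulmxA mulmxV// mulmx1 mulmxV.
Qed.

Lemma mxtrace_sym_sqr (n : nat) (B : 'M[R]_n) :
  B^T = B -> \tr (B ^+ 2) = \sum_i \sum_j B i j ^+ 2.
Proof.
move=> symB; rewrite expr2 -mulmxE; apply: eq_bigr => i _; rewrite mxE; apply: eq_bigr => j _.
by rewrite expr2; congr (_ * _); rewrite -{1}symB mxE.
Qed.

Lemma pow_conj (n : nat) (A B G : 'M[R]_n) (j : nat) :
  A *m G = G *m B -> A ^+ j *m G = G *m B ^+ j.
Proof.
move=> AG; elim: j => [|j IH]; first by rewrite !expr0 mul1mx mulmx1.
rewrite exprSr exprS -!mulmxE -mulmxA AG mulmxA IH.
by rewrite -mulmxA !mulmxE -exprS -exprSr.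
Qed.

Lemma trace_conj (n : nat) (A B G : 'M[R]_n) :
  G \in unitmx -> A *m G = G *m B -> \tr A = \tr B.
Proof.
move=> uG AG; rewrite -[A](mulmxK uG) AG mxtrace_mulC mulmxA mulVmx//.
by rewrite mul1mx.
Qed.

Lemma pow_entry_bound (n : nat) (B : 'M[R]_n) (c : R) (j : nat) :
  0 <= c -> (forall i k, `|B i k| <= c) ->
  forall i k, `|(B ^+ j) i k| <= (n%:R * c) ^+ j.
Proof.
move=> c0 Bc; elim: j => [|j IH] i k.
  by rewrite !expr0 mxE; case: eqP => _; rewrite ?normr1 ?normr0.
rewrite exprSr -mulmxE mxE; apply: (le_trans (ler_norm_sum _ _ _)).
apply: (@le_trans _ _ (\sum_(l < n) (n%:R * c) ^+ j * c)).
  by apply: ler_sum => l _; rewrite normrM ler_pM.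
rewrite sumr_const card_ord -[leLHS]mulr_natr [leRHS]exprSr.
by rewrite le_eqVlt; apply/orP; left; apply/eqP; ring.
Qed.

Lemma pow_trace_bound (n : nat) (B : 'M[R]_n) (c : R) (j : nat) :
  0 <= c -> (forall i k, `|B i k| <= c) ->
  `|\tr (B ^+ j)| <= n%:R * (n%:R * c) ^+ j.
Proof.
move=> c0 Bc; apply: (le_trans (ler_norm_sum _ _ _)).
apply: (@le_trans _ _ (\sum_(l < n) (n%:R * c) ^+ j)).
  by apply: ler_sum => l _; exact: pow_entry_bound.
by rewrite sumr_const card_ord -[leLHS]mulr_natr mulrC.
Qed.

(** Either the characteristic polynomial splits and each eigenvalue is
    bounded by the norm of a conjugate of A, or all the values are the
    default 0. *)
Lemma eigenvalues_bound (n : nat) (A B G : 'M[R]_n) (c : R) :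
  0 <= c -> G \in unitmx -> A *m G = G *m B -> (forall i k, `|B i k| <= c) ->
  forall i, `|eigenvalues A 0 i| <= n%:R * c.
Proof.
move=> c0 uG AG Bc i; rewrite /eigenvalues; case: xgetP => [k _ kE|_]; last first.
  by rewrite mxE normr0 mulr_ge0.
have : root (char_poly A) (k 0 i).
  by rewrite kE (bigD1 i)//= rootM root_XsubC eqxx.
rewrite -eigenvalue_root_char => /eigenvalueP[v vA v0].
have w0 : 0 < `|v *m G|.
  rewrite normr_gt0; apply: contra v0 => /eqP vG.
  by rewrite -[v](mulmxK uG) vG mul0mx.
rewrite -(ler_pM2r w0) -normrZ scalemxAl -vA -mulmxA AG mulmxA.
exact: row_mul_bound.
Qed.

Lemma elementary_symmetric_bound (n r : nat) (c : R) (k : 'rV[R]_n) :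
  (forall i, `|k 0 i| <= c) ->
  `|elementary_symmetric r k| <= \sum_(I : {set 'I_n} | #|I| == r) c ^+ r.
Proof.
move=> kc; apply: (le_trans (ler_norm_sum _ _ _)).
apply: ler_sum => I /eqP <-; rewrite normr_prod -prodr_const.
by apply: ler_prod => i _; rewrite normr_ge0 kc.
Qed.

Definition newton_mx (n r : nat) (A : 'M[R]_n) : 'M[R]_n :=
  \sum_(j < r.+1)
    ((-1) ^+ j * elementary_symmetric (r - j)%N (eigenvalues A)) *: A ^+ j.

(** In orthonormal coordinates the trace of the square is the sum of the
    squares of the entries, so K bounds the entries of the shape operator,
    then its powers, its eigenvalues and the coefficients of the Newton
    transformation. *)
Lemma newton_trace_bound (n r : nat) (K : R) :
  exists2 C : R, 0 <= C & forall g h : 'M[R]_n,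
    g^T = g -> (forall v, v != 0 -> 0 < quad g v) -> h^T = h ->
    \tr ((h *m invmx g) ^+ 2) <= K ->
    `|\tr (newton_mx r (h *m invmx g))| <= C /\
    `|\tr (h *m invmx g *m newton_mx r (h *m invmx g))| <= C.
Proof.
pose c := 1 + `|K|; pose d := n%:R * c.
have c0 : 0 <= c by rewrite addr_ge0.
have d0 : 0 <= d by rewrite mulr_ge0.
pose s (q : nat) := \sum_(I : {set 'I_n} | #|I| == q) d ^+ q.
have s0 q : 0 <= s q by apply: sumr_ge0 => I _; rewrite exprn_ge0.
pose C0 := \sum_(j < r.+1) s (r - j)%N * (n%:R * d ^+ j).
pose C1 := \sum_(j < r.+1) s (r - j)%N * (n%:R * d ^+ j.+1).
have C00 : 0 <= C0.
  by apply: sumr_ge0 => j _; rewrite mulr_ge0// mulr_ge0// exprn_ge0.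
have C10 : 0 <= C1.
  by apply: sumr_ge0 => j _; rewrite mulr_ge0// mulr_ge0// exprn_ge0.
exists (C0 + C1) => [|g h symg pos symh]; first by rewrite addr_ge0.
have [G [B [uG gE symB AG]]] := selfadjoint_similar symg pos symh.
move: (h *m invmx g) AG => A AG trK.
have trB j : \tr (A ^+ j) = \tr (B ^+ j) by exact: trace_conj uG (pow_conj j AG).
have Bc i k : `|B i k| <= c.
  have : B i k ^+ 2 <= K.
    apply: le_trans trK; rewrite trB mxtrace_sym_sqr//.
    rewrite (bigD1 i)//= (bigD1 k)//= -addrA lerDl addr_ge0//.
      by apply: sumr_ge0 => l _; rewrite sqr_ge0.
    by apply: sumr_ge0 => l _; apply: sumr_ge0 => l' _; rewrite sqr_ge0.
  move=> BK; rewrite -ler_sqr ?nnegrE// -normrX ger0_norm ?sqr_ge0//.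
  apply: (le_trans BK); rewrite /c (le_trans (ler_norm K))//.
  rewrite sqrrD expr1n mul1r -addrA.
  have := normr_ge0 K; move: `|K| => k0 k00.
  have := sqr_ge0 k0; rewrite mulr2n; lra.
have sb q : `|elementary_symmetric q (eigenvalues A)| <= s q.
  apply: elementary_symmetric_bound => i.
  exact: (eigenvalues_bound c0 uG AG Bc).
split.
- apply: (@le_trans _ _ C0); last by rewrite lerDl.
  rewrite /newton_mx linear_sum/=; apply: (le_trans (ler_norm_sum _ _ _)).
  apply: ler_sum => j _; rewrite mxtraceZ !normrM normrX normrN1 expr1n mul1r.
  by rewrite ler_pM// trB pow_trace_bound.
- apply: (@le_trans _ _ C1); last by rewrite lerDr.
  rewrite /newton_mx mulmx_sumr linear_sum/=; apply: (le_trans (ler_norm_sum _ _ _)).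
  apply: ler_sum => j _; rewrite -scalemxAr mxtraceZ !normrM normrX normrN1.
  rewrite expr1n mul1r mulmxE -exprS.
  by rewrite ler_pM// trB pow_trace_bound.
Qed.

(** In orthonormal coordinates, the operator norm is bounded by the
    Hilbert-Schmidt norm. *)
Lemma selfadjoint_norm_bound (n : nat) (g h : 'M[R]_n) (v : 'rV[R]_n) :
  g^T = g -> (forall v, v != 0 -> 0 < quad g v) -> h^T = h ->
  quad g (v *m (h *m invmx g)) <= \tr ((h *m invmx g) ^+ 2) * quad g v.
Proof.
move=> symg pos symh.
have [G [B [uG gE symB AG]]] := selfadjoint_similar symg pos symh.
move: (h *m invmx g) AG => A AG.
rewrite (trace_conj uG (pow_conj 2 AG)) mxtrace_sym_sqr//.
rewrite gE !quad_mul -mulmxA AG mulmxA !quad1.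
move: (v *m G) => w; rewrite exchange_big/= mulr_suml; apply: ler_sum => j _.
rewrite mxE [leRHS]mulrC.
exact: cauchy_schwarz_sum.
Qed.

(** A polynomial in a self-adjoint endomorphism is self-adjoint; the factor
    g^-1 expresses this as the symmetry of a matrix. *)
Lemma newton_mx_inv_sym (n r : nat) (g h : 'M[R]_n) :
  g^T = g -> h^T = h ->
  (invmx g *m newton_mx r (h *m invmx g))^T = invmx g *m newton_mx r (h *m invmx g).
Proof.
move=> symg symh; rewrite /newton_mx mulmx_sumr linear_sum/=.
apply: eq_bigr => j _; rewrite -scalemxAr linearZ/=; congr (_ *: _).
have trX (A : 'M[R]_n) k : (A ^+ k)^T = A^T ^+ k.
  elim: k => [|k IH]; first by rewrite !expr0 trmx1.
  by rewrite exprSr exprS -!mulmxE trmx_mul IH.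
rewrite trmx_mul trX trmx_inv symg; apply: pow_conj.
by rewrite trmx_mul trmx_inv symg symh mulmxA.
Qed.
End SymmetricMatrices.

(** * Sections of local homeomorphisms onto a ball *)

(** The supremum of the initial segments on which P holds is attained by the
    third hypothesis, and can only be 1 by the second one. *)
Lemma real_induction (R : realType) (P : R -> Prop) :
  P 0 ->
  (forall t, 0 <= t < 1 -> P t ->
     exists2 d, 0 < d & forall s, t < s < t + d -> s <= 1 -> P s) ->
  (forall t, 0 < t <= 1 -> (forall s, 0 <= s < t -> P s) -> P t) ->
  forall t, 0 <= t <= 1 -> P t.
Proof.
move=> P0 Pstep Plim.
pose A : set R := [set t | 0 <= t <= 1 /\ forall s, 0 <= s <= t -> P s].
have A0 : A 0.
  split; first by rewrite lexx ler01.
  by move=> s /andP[s0 s1]; rewrite (_ : s = 0)//; apply/eqP; rewrite eq_le s0 s1.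
have ubA : has_ubound A by exists 1 => t [/andP[]].
have nA : A !=set0 by exists 0.
set m := sup A.
have m0 : 0 <= m by exact: ub_le_sup.
have m1 : m <= 1 by apply: ge_sup => // t [/andP[]].
have Pm s : 0 <= s < m -> P s.
  move=> /andP[s0 sm]; have [t [_ tA] st] := sup_gt nA sm.
  by apply: tA; rewrite s0 ltW.
have PM : P m.
  have [mz|mn] := eqVneq m 0; first by rewrite mz.
  by apply: Plim => //; rewrite lt_neqAle eq_sym mn m0.
have Am : A m.
  split=> [|s /andP[s0]]; first by rewrite m0.
  by rewrite le_eqVlt => /orP[/eqP->//|sm]; apply: Pm; rewrite s0.
suff m_eq1 : m = 1 by move=> t; rewrite -m_eq1; exact: (proj2 Am).
apply/eqP; rewrite eq_le m1 leNgt; apply/negP => ml1.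
have [|d d0 dP] := Pstep m _ PM; first by rewrite m0.
pose m' := Num.min 1 (m + d / 2).
have mm' : m < m' by rewrite lt_min ml1 ltrDl divr_gt0.
have m'd : m' < m + d.
  by rewrite gt_min ltrD2l ltr_pdivrMr// mulr2n mulrDr mulr1 ltrDl d0 orbT.
have m'1 : m' <= 1 by rewrite ge_min lexx.
have : A m'.
  split=> [|s /andP[s0 sm']]; first by rewrite (le_trans m0 (ltW mm')).
  have [sm|ms] := leP s m; first by apply: (proj2 Am); rewrite s0.
  by apply: dP; [rewrite ms (le_lt_trans sm')|rewrite (le_trans sm')].
by move=> /(ub_le_sup ubA); rewrite leNgt mm'.
Qed.

(** The connectedness of [0, 1], stated for a predicate on R with all the
    neighbourhoods relative to [0, 1]. *)
Lemma clopen_segment (R : realType) (P : R -> Prop) :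
  P 0 ->
  (forall t, 0 <= t <= 1 -> P t -> exists2 d, 0 < d &
     forall s, `|s - t| < d -> 0 <= s <= 1 -> P s) ->
  (forall t, 0 <= t <= 1 ->
     (forall d, 0 < d -> exists s, [/\ 0 <= s <= 1, `|s - t| < d & P s]) -> P t) ->
  forall t, 0 <= t <= 1 -> P t.
Proof.
move=> P0 Po Pc; apply: real_induction => //.
- move=> t /andP[t0 t1] Pt; have [|d d0 dP] := Po t _ Pt; first by rewrite t0 ltW.
  exists d => // s /andP[ts std] s1; apply: dP.
    by rewrite gtr0_norm ?subr_gt0// ltrBlDl.
  by rewrite (le_trans t0 (ltW ts)).
- move=> t /andP[t0 t1] Pt; apply: Pc => [|d d0]; first by rewrite ltW.
  exists (Num.max 0 (t - d / 2)).
  have d20 : 0 < d / 2 by rewrite divr_gt0.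
  have st : Num.max 0 (t - d / 2) < t by rewrite gt_max t0/= ltrBlDr ltrDl.
  have s0 : 0 <= Num.max 0 (t - d / 2) by rewrite le_max lexx.
  split; last by apply: Pt; rewrite s0.
    by rewrite s0 (le_trans (ltW st)).
  rewrite distrC gtr0_norm ?subr_gt0// ltrBlDl -ltrBlDr lt_max; apply/orP; right.
  by rewrite ltrD2l ltrN2 ltr_pdivrMr// mulr2n mulrDr mulr1 ltrDl.
Qed.

(** Real induction takes the place of an integral: D need not come from a
    differentiable function, so this serves both for the intrinsic distance
    and for the variation of the normal. *)
Lemma local_lipschitz (R : realType) (D : R -> R -> R) (C : R) :
  (forall a b c, D a c <= D a b + D b c) -> D 0 0 <= 0 ->
  (forall t, 0 <= t <= 1 -> exists2 d, 0 < d & forall s, `|s - t| < d ->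
     0 <= s <= 1 -> D s t <= C * `|s - t| /\ D t s <= C * `|s - t|) ->
  forall t, 0 <= t <= 1 -> D 0 t <= C * t.
Proof.
move=> tri D0 loc; apply: real_induction; first by rewrite mulr0.
- move=> t /andP[t0 t1] Pt; have [|d d0 dP] := loc t; first by rewrite t0 ltW.
  exists d => // s /andP[ts std] s1.
  have sd : `|s - t| < d by rewrite gtr0_norm ?subr_gt0// ltrBlDl.
  have sI : 0 <= s <= 1 by rewrite (le_trans t0 (ltW ts)).
  have [_] := dP s sd sI.
  rewrite gtr0_norm ?subr_gt0// => H.
  by apply: (le_trans (tri 0 t s)); apply: (le_trans (lerD Pt H)); rewrite -mulrDr addrC subrK.
- move=> t /andP[t0 t1] Pt; have [|d d0 dP] := loc t; first by rewrite t1 ltW.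
  pose s := Num.max 0 (t - d / 2).
  have d20 : 0 < d / 2 by rewrite divr_gt0.
  have st : s < t by rewrite gt_max t0/= ltrBlDr ltrDl.
  have s0 : 0 <= s by rewrite le_max lexx.
  have [||H _] := dP s.
  - rewrite distrC gtr0_norm ?subr_gt0// ltrBlDl -ltrBlDr lt_max; apply/orP; right.
    by rewrite ltrD2l ltrN2 ltr_pdivrMr// mulr2n mulrDr mulr1 ltrDl.
  - by rewrite s0 (le_trans (ltW st)).
  have Ps : D 0 s <= C * s by apply: Pt; rewrite s0.
  rewrite distrC gtr0_norm ?subr_gt0// in H.
  by apply: (le_trans (tri 0 s t)); apply: (le_trans (lerD Ps H)); rewrite -mulrDr addrC subrK.
Qed.

Lemma segment_in_ball (R : realType) (V : normedModType R) (c y y' : V) (a t : R) :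
  `|y - c| < a -> `|y' - c| < a -> 0 <= t <= 1 ->
  `|y + t *: (y' - y) - c| < a.
Proof.
move=> ya y'a /andP[t0 t1].
rewrite (_ : _ - c = (1 - t) *: (y - c) + t *: (y' - c)); last first.
  rewrite scalerBl scale1r -[RHS]addrA -scalerN -scalerDr addrAC; congr (_ + _ *: _).
  by rewrite [RHS]addrC opprB addrA subrK.
apply: (le_lt_trans (ler_normD _ _)); rewrite !normrZ (ger0_norm t0).
rewrite ger0_norm ?subr_ge0//.
rewrite [ltRHS](_ : a = (1 - t) * a + t * a); last by ring.
move: t0; rewrite le_eqVlt => /orP[/eqP<-|t0].
  by rewrite !mul0r !addr0 subr0 !mul1r.
apply: ler_ltD; last by rewrite ltr_pM2l.
by apply: ler_wpM2l; [rewrite subr_ge0|exact: ltW].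
Qed.

Lemma near_both (R : realType) (V : normedModType R) (P Q : V -> Prop) (t : V) :
  (\forall u \near t, P u) -> (\forall u \near t, Q u) ->
  exists2 d : R, 0 < d & forall u, `|u - t| < d -> P u /\ Q u.
Proof.
move=> nP nQ.
have : \forall u \near t, P u /\ Q u by near=> u; split; near: u.
move=> /nbhs_normP[d /= d0 dP]; exists d => // u ud.
by apply: dP; rewrite /ball_/= distrC.
Unshelve. all: by end_near. Qed.

Lemma segment_continuous (R : realType) (V : normedModType R) (T : topologicalType)
  (s : V -> T) (y v : V) (t : R) :
  {for (y + t *: v), continuous s} -> {for t, continuous (fun u : R => s (y + u *: v))}.
Proof.
move=> cs; apply: (@cvg_comp _ _ _ (fun u : R => y + u *: v) s _ (nbhs (y + t *: v))) => //.
apply: cvgD; first exact: cvg_cst.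
apply: cvgZr_tmp; exact: cvg_id.
Qed.

Section Covering.
Variables (R : realType) (T : topologicalType) (n : nat).
Variables (F : T -> 'rV[R]_n) (Om : set T).
Hypothesis hausT : hausdorff_space T.
Hypothesis F_cont : continuous F.

(** Om is where F is known to be a local homeomorphism, so a section has to
    stay in it in order to be extended. *)
Definition section_on (s : 'rV[R]_n -> T) (c : 'rV[R]_n) (a : R) :=
  forall y, `|y - c| < a -> [/\ F (s y) = y, {for y, continuous s} & Om (s y)].

Definition locally_injective_at (q : T) :=
  exists2 U : set T, nbhs q U & forall a b, U a -> U b -> F a = F b -> a = b.

Hypothesis inj_loc : forall q, Om q -> locally_injective_at q.

(** The parameters at which two lifts agree form a closed set because T is
    Hausdorff, and an open one because F is locally injective. *)
Lemma section_unique_segment (s s' : 'rV[R]_n -> T) (y y' : 'rV[R]_n) :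
  (forall t : R, 0 <= t <= 1 -> let z := y + t *: (y' - y) in
    [/\ F (s z) = z, {for z, continuous s} & Om (s z)]) ->
  (forall t : R, 0 <= t <= 1 -> let z := y + t *: (y' - y) in
    [/\ F (s' z) = z & {for z, continuous s'}]) ->
  s y = s' y -> s y' = s' y'.
Proof.
move=> sec sec' syy.
pose z (t : R) := y + t *: (y' - y).
suff H : forall t : R, 0 <= t <= 1 -> s (z t) = s' (z t).
  have := H 1; rewrite ler01 lexx => /(_ isT).
  by rewrite /z scale1r addrC subrK.
apply: clopen_segment; first by rewrite /z scale0r addr0.
- move=> t tI E; have [_ cs Os] := sec t tI; have [_ cs'] := sec' t tI.
  have [U nU Uinj] := inj_loc Os.
  have c1 : \forall u \near t, U (s (z u)) by exact: (segment_continuous cs).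
  have c2 : \forall u \near t, U (s' (z u)).
    by apply: (segment_continuous cs'); rewrite -/(z t) -E.
  have [d d0 dP] := near_both c1 c2.
  exists d => // u ud uI; have [//|] := dP u.
  move=> U1 U2; apply: Uinj => //.
  by have [-> _ _] := sec u uI; have [-> _] := sec' u uI.
- move=> t tI H; have [_ cs Os] := sec t tI; have [_ cs'] := sec' t tI.
  apply: hausT => A B nA nB.
  have c1 : \forall u \near t, A (s (z u)) by exact: (segment_continuous cs).
  have c2 : \forall u \near t, B (s' (z u)) by exact: (segment_continuous cs').
  have [d d0 dP] := near_both c1 c2.
  have [u [uI ud E]] := H d d0.
  have [//|] := dP u.
  by move=> Au Bu; exists (s (z u)); split => //; rewrite E.
Qed.

Lemma section_unique (s s' : 'rV[R]_n -> T) (c c' y y' : 'rV[R]_n) (a a' : R) :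
  section_on s c a -> section_on s' c' a' ->
  `|y - c| < a -> `|y - c'| < a' -> `|y' - c| < a -> `|y' - c'| < a' ->
  s y = s' y -> s y' = s' y'.
Proof.
move=> sec sec' ya ya' y'a y'a'; apply: section_unique_segment => t tI.
  by apply: sec; exact: segment_in_ball.
by have [] := sec' (y + t *: (y' - y)) (segment_in_ball ya' y'a' tI).
Qed.

Lemma section_sub (s : 'rV[R]_n -> T) (c c' : 'rV[R]_n) (a a' : R) :
  section_on s c a -> `|c' - c| + a' <= a -> section_on s c' a'.
Proof.
move=> sec ca y ya; apply: sec; rewrite -(subrK c' y) -addrA.
by rewrite (le_lt_trans (ler_normD _ _))// (lt_le_trans _ ca)// [ltLHS]addrC ltrD2l.
Qed.

Lemma section_near (s s' : 'rV[R]_n -> T) (c : 'rV[R]_n) :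
  {for c, continuous s'} -> (exists2 d : R, 0 < d & forall z, `|z - c| < d -> s z = s' z) ->
  {for c, continuous s}.
Proof.
move=> cs' [d d0 dP]; have E : s c = s' c by apply: dP; rewrite subrr normr0.
have nE : \forall z \near c, s' z = s z.
  by apply/nbhs_normP; exists d => // z /=; rewrite distrC => /dP.
suff : s z @[z --> c] --> s c by [].
by rewrite E; exact: cvg_trans (near_eq_cvg nE) cs'.
Qed.

Hypothesis onto_loc : forall q, Om q ->
  exists s, exists2 e : R, 0 < e & section_on s (F q) e /\ s (F q) = q.

Variables (p : T) (rho : R).
Hypothesis Op : Om p.
Hypothesis rho0 : 0 < rho.

(** A sequence inside the open ball that converges to z, also when z is on
    its boundary. *)
Definition radial (z : 'rV[R]_n) (k : nat) : 'rV[R]_n :=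
  F p + (1 - k.+1%:R^-1) *: (z - F p).

Hypothesis complete_sec : forall s a z, 0 < a <= rho ->
  section_on s (F p) a -> s (F p) = p -> `|z - F p| <= a ->
  exists2 q, Om q & s (radial z k) @[k --> \oo] --> q.

Lemma radial_coef (k : nat) : 0 <= (1 - k.+1%:R^-1 : R) < 1.
Proof.
by rewrite subr_ge0 invf_le1// ler1n/= gtrBl invr_gt0 ltr0n.
Qed.

Lemma radial_lt z a k : 0 < a -> `|z - F p| <= a -> `|radial z k - F p| < a.
Proof.
move=> a0 za; have /andP[k0 k1] := radial_coef k.
rewrite /radial addrAC subrr add0r normrZ ger0_norm//.
apply: (@le_lt_trans _ _ ((1 - k.+1%:R^-1) * a)); first exact: ler_wpM2l.
by rewrite gtr_pMl.
Qed.

Lemma radial_cvg z : radial z k @[k --> \oo] --> z.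
Proof.
have H : (1 - k.+1%:R^-1 : R) @[k --> \oo] --> (1 - 0 : R).
  by apply: cvgB; [exact: cvg_cst|exact: cvg_harmonic].
rewrite -[X in _ --> X](subrK (F p)) addrC -[z - F p]scale1r -[1 in X in _ --> X]subr0.
by apply: cvgD; [exact: cvg_cst|exact: cvgZr_tmp].
Qed.

(** By completeness s has a radial limit at every point z of the closed
    ball, the boundary included, and near z it agrees with the local section
    through that limit; compactness of the closed ball makes the size b
    uniform. *)
Lemma local_extension s a : 0 < a <= rho ->
  section_on s (F p) a -> s (F p) = p ->
  exists2 b : R, 0 < b & forall y, `|y - F p| < a ->
    exists2 s', s' y = s y & section_on s' y b.
Proof.
move=> arho sec sp; have /andP[a0 _] := arho.
pose C := closed_ball_ Num.Def.normr (F p) a.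
have Ccomp : compact C by exact: closed_ball_rV_compact.
pose P (b : R) (y : 'rV[R]_n) := `|y - F p| < a ->
    exists2 s', s' y = s y & section_on s' y b.
suff [b [b0 bP]] : exists b : R, 0 < b /\ C `<=` P b.
  by exists b => // y ya; apply: bP => //; rewrite /C/closed_ball_/= distrC ltW.
move/compact_near_coveringP : Ccomp => /(_ R (0 : R)^'+ P _) H.
have HH : \forall b \near (0:R)^'+, C `<=` P b.
  apply: H => z Cz; rewrite /C/closed_ball_/= distrC in Cz.
  have [q Oq sq] := complete_sec arho sec sp Cz.
  have Fq : F q = z.
    have E : (fun k => F (s (radial z k))) = radial z.
      by apply/funext => k; have [] := sec _ (radial_lt k a0 Cz).
    have L1 : F (s (radial z k)) @[k --> \oo] --> F q.
      by apply: (cvg_comp _ _ sq); exact: F_cont.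
    have L2 : F (s (radial z k)) @[k --> \oo] --> z.
      by under eq_fun do rewrite (congr1 (fun f => f _) E); exact: radial_cvg.
    exact: (cvg_unique _ L1 L2).
  have [s' [e e0 [sec' s'q]]] := onto_loc Oq.
  rewrite Fq in sec' s'q.
  have [U nU Uinj] := inj_loc Oq.
  have [_ cs' _] : [/\ F (s' z) = z, {for z, continuous s'} & Om (s' z)].
    by apply: sec'; rewrite subrr normr0.
  have E1 : \forall k \near \oo, U (s (radial z k)) by exact: sq.
  have rz : radial z k @[k --> \oo] --> z by exact: radial_cvg.
  have E2 : \forall k \near \oo, U (s' (radial z k)).
    have : s' (radial z k) @[k --> \oo] --> s' z by apply: (cvg_comp _ _ rz); exact: cs'.
    by rewrite s'q; apply.
  have E3 : \forall k \near \oo, `|radial z k - z| < e.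
    have /cvgrPdist_lt/(_ e e0) := rz.
    by apply: filterS => k; rewrite distrC.
  near \oo => k.
  have sk : s (radial z k) = s' (radial z k).
    apply: Uinj; [by near: k|by near: k|].
    have [-> _ _] := sec _ (radial_lt k a0 Cz).
    have ke : `|radial z k - z| < e by near: k.
    by have [-> _ _] := sec' _ ke.
  have nz : \forall y \near z, `|y - z| < e / 2.
    apply/nbhs_normP; exists (e / 2); first by rewrite /= divr_gt0.
    by move=> y /=; rewrite distrC.
  near=> y b => ya.
  have yz : `|y - z| < e / 2.
    by near: y.
  have ye : `|y - z| < e.
    by rewrite (lt_trans yz)// ltr_pdivrMr// mulr2n mulrDr mulr1 ltrDl.
  have be : b < e / 2 by near: b; apply: nbhs_right_lt; rewrite divr_gt0.
  exists s'.
    apply/esym; apply: (section_unique sec sec' _ _ ya ye sk).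
      exact: radial_lt.
    by near: k.
  apply: (section_sub sec'); rewrite [leRHS]splitr.
  by rewrite lerD ?ltW.
near (0:R)^'+ => b; exists b; split => //.
by near: b.
Unshelve. all: by end_near. Qed.

(** The value of the extension at z is that of the local extension of s at
    the shrunken point F p + c (z - F p), which lies in the ball of radius
    a. *)
Lemma section_extend s a : 0 < a < rho ->
  section_on s (F p) a -> s (F p) = p ->
  exists2 a', a < a' <= rho &
    exists2 s', section_on s' (F p) a' & s' (F p) = p.
Proof.
move=> /andP[a0 arho] sec sp.
have [|b b0 bP] := local_extension _ sec sp; first by rewrite a0 ltW.
have /(_ _)/cid2-/all_sig2 [ext extE extS] : forall y, exists2 s',
    (`|y - F p| < a -> s' y = s y) & (`|y - F p| < a -> section_on s' y b).
  move=> y; have [ya|_] := boolP (`|y - F p| < a); last by exists s.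
  by have [s' s'y ss'] := bP y ya; exists s'.
have b20 : 0 < b / 2 by rewrite divr_gt0.
have b2b : b / 2 < b by rewrite ltr_pdivrMr// mulr2n mulrDr mulr1 ltrDl.
have ab0 : 0 < a + b / 2 by rewrite addr_gt0.
pose c := a / (a + b / 2).
have c0 : 0 < c by rewrite divr_gt0.
have c1 : c < 1 by rewrite ltr_pdivrMr// mul1r ltrDl.
pose y (z : 'rV[R]_n) := F p + c *: (z - F p).
have yF z : y z - F p = c *: (z - F p) by rewrite /y addrAC subrr add0r.
have zy z : z - y z = (1 - c) *: (z - F p).
  by rewrite scalerBl scale1r /y opprD addrA.
have ya z : `|z - F p| < a + b / 2 -> `|y z - F p| < a.
  move=> za; rewrite yF normrZ gtr0_norm//.
  have := za; rewrite -(ltr_pM2l c0); congr (_ < _).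
  by rewrite /c divfK// gt_eqF.
have zb z : `|z - F p| < a + b / 2 -> `|z - y z| < b / 2.
  move=> za; rewrite zy normrZ gtr0_norm ?subr_gt0//.
  have c10 : 0 < 1 - c by rewrite subr_gt0.
  have := za; rewrite -(ltr_pM2l c10); congr (_ < _).
  by rewrite /c; field; rewrite gt_eqF//; lra.
pose s' z := ext (y z) z.
have yp : y (F p) = F p by rewrite /y subrr scaler0 addr0.
exists (Num.min rho (a + b / 2)).
  by rewrite lt_min arho ltrDl b20 ge_min lexx.
exists s'; last by rewrite /s' yp extE ?sp// subrr normr0.
move=> z0; rewrite lt_min => /andP[_ z0a].
have [y0a z0b] := (ya _ z0a, zb _ z0a).
have sec0 := extS _ y0a.
have near_eq : exists2 d : R, 0 < d & forall z, `|z - z0| < d -> s' z = ext (y z0) z.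
  exists (Num.min (b / 2) (a + b / 2 - `|z0 - F p|)).
    by rewrite lt_min b20 subr_gt0.
  move=> z; rewrite lt_min => /andP[zz0 zz0'].
  have za : `|z - F p| < a + b / 2.
    rewrite -(subrK z0 z) -addrA (le_lt_trans (ler_normD _ _))//.
    by rewrite -ltrBrDr.
  have zyb : `|z - y z0| < b.
    rewrite -(subrK z0 z) -addrA (le_lt_trans (ler_normD _ _))//.
    by rewrite [ltRHS]splitr ltrD.
  have yyb : `|y z - y z0| < b.
    rewrite (_ : _ - _ = c *: (z - z0)).
      rewrite normrZ gtr0_norm// (lt_trans _ b2b)//.
      by rewrite (le_lt_trans _ zz0)// ler_piMl// ltW.
    rewrite -[y z](subrK (F p)) -addrA -[F p - _]opprB !yF -scalerBr.
    by rewrite opprB addrA subrK.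
  have E : ext (y z) (y z) = ext (y z0) (y z).
    rewrite extE ?ya//.
    apply: (section_unique sec sec0 y0a _ (ya _ za) yyb); first by rewrite subrr normr0.
    by rewrite extE.
  apply: (section_unique (extS _ (ya _ za)) sec0 _ yyb _ zyb E).
    by rewrite subrr normr0.
  by rewrite (lt_trans _ b2b)// zb.
have [F0 c0' O0] := sec0 z0 (lt_trans z0b b2b).
split=> //; exact: section_near c0' near_eq.
Qed.

(** Among the radii below rho of balls that carry a section through p, the
    supremum is attained because sections agree on overlaps, and it is rho
    because every smaller radius can be increased. *)
Lemma section_exists :
  exists2 s, section_on s (F p) rho & s (F p) = p.
Proof.
pose A : set R := [set a | 0 < a <= rho /\
  exists2 s, section_on s (F p) a & s (F p) = p].
have ubA : has_ubound A by exists rho => a [/andP[]].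
have nA : A !=set0.
  have [s [e e0 [se sp]]] := onto_loc Op.
  exists (Num.min e rho); split; first by rewrite lt_min e0 rho0 ge_min lexx orbT.
  exists s => // y; rewrite lt_min => /andP[ye _]; exact: se.
set m := sup A.
have m0 : 0 < m.
  by have [a [/andP[a0 ar] sa]] := nA; rewrite (lt_le_trans a0)// ub_le_sup//; split=> //; rewrite a0.
have mrho : m <= rho by apply: ge_sup => // a [/andP[]].
suff [s sec sp] : exists2 s, section_on s (F p) m & s (F p) = p.
  have [E|mn] := eqVneq m rho; first by exists s; rewrite // -E.
  have mlt : m < rho by rewrite lt_neqAle mn.
  have [|a' /andP[ma' a'rho] s'P] := section_extend _ sec sp; first by rewrite m0.
  suff : A a' by move=> /(ub_le_sup ubA); rewrite leNgt ma'.
  by split => //; rewrite (lt_trans m0 ma').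
have /(_ _)/cid2-/all_sig2 [rad radA radP] : forall y, exists2 a,
    A a & (`|y - F p| < m -> `|y - F p| < a).
  move=> y; have [ym|_] := boolP (`|y - F p| < m); last first.
    by have [a Aa] := nA; exists a.
  by have [a Aa ya] := sup_gt nA ym; exists a.
have /(_ _)/cid2-/all_sig2 [sc scS scp] : forall a, exists2 s,
   (A a -> section_on s (F p) a) & (A a -> s (F p) = p).
  move=> a; have [[_ [s ss sp]]|nAa] := pselect (A a); first by exists s.
  by exists (fun=> p).
have agree a a' z : A a -> A a' -> `|z - F p| < a -> `|z - F p| < a' -> sc a z = sc a' z.
  move=> Aa Aa' za za'.
  have [[/andP[a0 _] _] [/andP[a'0 _] _]] := (Aa, Aa').
  apply: (@section_unique _ _ _ _ (F p) z _ _ (scS _ Aa) (scS _ Aa') _ _ za za').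
  - by rewrite subrr normr0.
  - by rewrite subrr normr0.
  - by rewrite !scp.
exists (fun y => sc (rad y) y); last by rewrite scp.
move=> y ym; have [Fy cy Oy] := scS _ (radA y) y (radP y ym).
split=> //; apply: section_near cy _.
exists (Num.min (m - `|y - F p|) (rad y - `|y - F p|)).
  by rewrite lt_min !subr_gt0 ym radP.
move=> z; rewrite lt_min => /andP[z1 z2].
have H a : `|z - y| < a - `|y - F p| -> `|z - F p| < a.
  move=> za; rewrite -(subrK y z) -addrA (le_lt_trans (ler_normD _ _))//.
  by rewrite -ltrBrDr.
by apply: agree => //; [exact/radP/H|exact: H].
Qed.
End Covering.

(** * Euclidean norm, induced metric and charts *)

Section Euclidean.
Variable R : realType.

Definition enorm (m : nat) (v : 'rV[R]_m) : R := Num.sqrt (dot v v).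

Lemma dotE (m : nat) (v w : 'rV[R]_m) : dot v w = (v *m w^T) 0 0.
Proof. by rewrite /dot mxE; apply: eq_bigr => i _; rewrite mxE. Qed.

Lemma dotC (m : nat) (v w : 'rV[R]_m) : dot v w = dot w v.
Proof. by apply: eq_bigr => i _; rewrite mulrC. Qed.

Lemma dotDl (m : nat) (u v w : 'rV[R]_m) : dot (u + v) w = dot u w + dot v w.
Proof. by rewrite !dotE mulmxDl mxE. Qed.

Lemma dotZl (m : nat) (a : R) (v w : 'rV[R]_m) : dot (a *: v) w = a * dot v w.
Proof. by rewrite !dotE -scalemxAl mxE. Qed.

Lemma dotNl (m : nat) (v w : 'rV[R]_m) : dot (- v) w = - dot v w.
Proof. by rewrite -scaleN1r dotZl mulN1r. Qed.

Lemma dotBl (m : nat) (u v w : 'rV[R]_m) : dot (u - v) w = dot u w - dot v w.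
Proof. by rewrite dotDl dotNl. Qed.

Lemma dotDr (m : nat) (u v w : 'rV[R]_m) : dot w (u + v) = dot w u + dot w v.
Proof. by rewrite dotC dotDl !(dotC _ w). Qed.

Lemma dotZr (m : nat) (a : R) (v w : 'rV[R]_m) : dot v (a *: w) = a * dot v w.
Proof. by rewrite dotC dotZl dotC. Qed.

Lemma dotBr (m : nat) (u v w : 'rV[R]_m) : dot w (u - v) = dot w u - dot w v.
Proof. by rewrite dotC dotBl !(dotC _ w). Qed.

Lemma dot_suml (n m : nat) (a : 'I_n -> R) (w : 'I_n -> 'rV[R]_m)
    (z : 'rV[R]_m) :
  dot (\sum_i a i *: w i) z = \sum_i a i * dot (w i) z.
Proof.
elim/big_rec2: _ => [|i s t _ <-]; first by rewrite -(scale0r 0) dotZl mul0r.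
by rewrite dotDl dotZl.
Qed.

Lemma dot_ge0 (m : nat) (v : 'rV[R]_m) : 0 <= dot v v.
Proof. by apply: sumr_ge0 => i _; rewrite -expr2 sqr_ge0. Qed.

Lemma enorm_ge0 (m : nat) (v : 'rV[R]_m) : 0 <= enorm v.
Proof. exact: sqrtr_ge0. Qed.

Lemma enorm_sqr (m : nat) (v : 'rV[R]_m) : enorm v ^+ 2 = dot v v.
Proof. by rewrite sqr_sqrtr// dot_ge0. Qed.

Lemma dot_cauchy_schwarz (m : nat) (v w : 'rV[R]_m) :
  `|dot v w| <= enorm v * enorm w.
Proof.
rewrite -ler_sqr ?nnegrE ?mulr_ge0 ?enorm_ge0// -normrX ger0_norm ?sqr_ge0//.
rewrite exprMn !enorm_sqr; have := cauchy_schwarz_sum (v 0) (w 0).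
by congr (_ <= _ * _); apply: eq_bigr => i _; rewrite expr2.
Qed.

Lemma norm_le_enorm (m : nat) (v : 'rV[R]_m) : `|v| <= enorm v.
Proof.
apply: normrV_le => [|i]; first exact: enorm_ge0.
rewrite -sqrtr_sqr ler_sqrt ?dot_ge0// /dot (bigD1 i)//= -expr2 lerDl.
by apply: sumr_ge0 => j _; rewrite -expr2 sqr_ge0.
Qed.

Lemma enorm_le_norm (m : nat) (v : 'rV[R]_m) : enorm v <= m%:R * `|v|.
Proof.
rewrite -ler_sqr ?nnegrE ?mulr_ge0 ?enorm_ge0// enorm_sqr.
apply: (@le_trans _ _ (\sum_(i < m) `|v| ^+ 2)).
  apply: ler_sum => i _; rewrite -expr2 -real_normK ?num_real//.
  by rewrite ler_sqr ?nnegrE// coord_le_norm.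
rewrite sumr_const card_ord exprMn -[leLHS]mulr_natl ler_wpM2r ?sqr_ge0//.
by rewrite -natrX ler_nat; case: m {v} => // m; rewrite leq_pmull.
Qed.

Lemma enormD (m : nat) (v w : 'rV[R]_m) : enorm (v + w) <= enorm v + enorm w.
Proof.
rewrite -ler_sqr ?nnegrE ?addr_ge0 ?enorm_ge0// enorm_sqr sqrrD !enorm_sqr.
rewrite dotDl !dotDr (dotC w v).
have := dot_cauchy_schwarz v w; have := ler_norm (dot v w).
rewrite mulr2n; lra.
Qed.

Lemma enormZ (m : nat) (a : R) (v : 'rV[R]_m) : enorm (a *: v) = `|a| * enorm v.
Proof.
by rewrite /enorm dotZl dotZr mulrA -expr2 sqrtrM ?sqr_ge0// sqrtr_sqr.
Qed.
End Euclidean.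

Section PatchMetric.
Context (R : realType) (n m : nat) (phi : 'rV[R]_n -> 'rV[R]_m).

Lemma metricE (x : 'rV[R]_n) :
  metric phi x = partial_mx phi x *m (partial_mx phi x)^T.
Proof.
apply/matrixP => i j; rewrite !mxE; apply: eq_bigr => k _.
by rewrite !mxE.
Qed.

Lemma metric_sym (x : 'rV[R]_n) : (metric phi x)^T = metric phi x.
Proof. by rewrite metricE trmx_mul trmxK. Qed.

Lemma ipE (x v w : 'rV[R]_n) :
  ip phi x v w = dot (v *m partial_mx phi x) (w *m partial_mx phi x).
Proof. by rewrite /ip metricE dotE trmx_mul !mulmxA. Qed.

Lemma metric_posdef (x : 'rV[R]_n) :
  row_free (partial_mx phi x) -> forall v, v != 0 -> 0 < quad (metric phi x) v.
Proof.
move=> rf v v0; rewrite /quad -/(ip phi x v v) ipE.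
rewrite lt_neqAle dot_ge0 andbT eq_sym; apply: contra v0 => /eqP vJ.
have : `|v *m partial_mx phi x| <= 0.
  by apply: (le_trans (norm_le_enorm _)); rewrite /enorm vJ sqrtr0.
rewrite normr_le0 => /eqP vJ0.
have /row_freeP[K JK] := rf.
by rewrite -[v]mulmx1 -JK mulmxA vJ0 mul0mx.
Qed.
End PatchMetric.

Section Charts.
Context (R : realType) (n : nat) (M : smooth_manifold R n).

Lemma cimg_coord (c : chart R n M) p : cdom c p -> cimg c (coord c p).
Proof. by exists p. Qed.

Lemma param_cdom (c : chart R n M) x : cimg c x -> cdom c (param c x).
Proof. by move=> [p pc <-]; rewrite coordK. Qed.

Lemma paramK (c : chart R n M) x : cimg c x -> coord c (param c x) = x.
Proof. by move=> [p pc <-]; rewrite coordK. Qed.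

Lemma near_cdom (c : chart R n M) p : cdom c p -> \forall q \near p, cdom c q.
Proof. by move=> pc; apply: open_nbhs_nbhs; split=> //; exact: cdom_open. Qed.

Lemma near_cimg (c : chart R n M) x : cimg c x -> \forall y \near x, cimg c y.
Proof. by move=> xc; apply: open_nbhs_nbhs; split=> //; exact: cimg_open. Qed.

Lemma C_manifold_continuous (W : normedModType R) (k : nat) (F : M -> W) :
  C_manifold k F -> continuous F.
Proof.
move=> CF p; pose c := chart_at p.
have pc : cdom c p := chart_at_dom p.
have cphi : {for coord c p, continuous (F \o param c)}.
  have H := CF c (chart_at_atlas p); have xc := cimg_coord pc.
  by case: k {CF} H => [|k] [H _]; exact: H.
have H : (F \o param c) (coord c q) @[q --> p] --> (F \o param c) (coord c p).
  exact: (cvg_comp _ _ (coord_continuous pc) cphi).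
rewrite /= coordK// in H.
have E : \forall q \near p, F (param c (coord c q)) = F q.
  by apply: filterS (near_cdom pc) => q qc; rewrite coordK.
exact: cvg_trans (near_eq_cvg E) H.
Qed.

Definition overlap (c d : chart R n M) : set 'rV[R]_n :=
  coord c @` (cdom c `&` cdom d).

Lemma overlapP (c d : chart R n M) x :
  overlap c d x <-> cimg c x /\ cdom d (param c x).
Proof.
split=> [[p [pc pd] <-]|[[p pc <-]]]; first by rewrite coordK//; split=> //; exists p.
by rewrite coordK// => pd; exists p.
Qed.

Lemma overlap_open (c d : chart R n M) : open (overlap c d).
Proof.
rewrite openE => x /overlapP[xc xd].
have n1 := near_cimg xc.
have n2 : \forall y \near x, cdom d (param c y).
  by apply: (param_continuous xc); exact: near_cdom.
rewrite /interior/=; suff : \forall y \near x, overlap c d y by [].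
near=> y; apply/overlapP; split; by near: y.
Unshelve. all: by end_near. Qed.
End Charts.

(** * Length of curves *)

Lemma near_eq_derive1 (R : realType) (V : normedModType R) (f g : R -> V) (t : R) :
  (\forall s \near t, f s = g s) -> derivable f t 1 ->
  derivable g t 1 /\ derive1 g t = derive1 f t.
Proof.
move=> fg df; split; first exact: near_eq_derivable fg df.
rewrite !derive1E; apply/esym; exact: near_eq_derive fg.
Qed.

Section Length.
Context (R : realType) (n : nat) (M : smooth_manifold R n).
Variable X : M -> 'rV[R]_n.+1.
Hypothesis hX : smooth_immersion X.

Lemma patch_C (c : chart R n M) k : atlas c -> C_on k (cimg c) (X \o param c).
Proof. by move=> ac; exact: (proj1 hX k). Qed.

Lemma curve_deriv (g : R -> M) (c : chart R n M) (t : R) :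
  C1_curve g -> atlas c -> cdom c (g t) ->
  derivable (X \o g) t 1 /\
  derive1 (X \o g) t = derive1 (coord c \o g) t *m
     partial_mx (X \o param c) (coord c (g t)).
Proof.
move=> [cg dg] ac gt.
have [dcg _] := dg c t ac gt.
have Uc : cimg c ((coord c \o g) t) by exact: cimg_coord.
have [D1 D2] := C1_curve_comp (cimg_open (c:=c)) (patch_C 1 ac) Uc dcg.
have E : \forall s \near t,
    ((X \o param c) \o (coord c \o g)) s = (X \o g) s.
  have gc : \forall s \near t, cdom c (g s) by apply: cg; exact: near_cdom.
  near=> s; rewrite /= coordK//.
  by near: s.
have [? ->] := near_eq_derive1 E D1.
by split.
Unshelve. all: by end_near. Qed.

Lemma curve_deriv_continuous (g : R -> M) :
  C1_curve g -> continuous (derive1 (X \o g)).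
Proof.
move=> Cg t; have [cg dg] := Cg.
pose c := chart_at (g t).
have ac : atlas c := chart_at_atlas (g t).
have gt : cdom c (g t) := chart_at_dom (g t).
have gc : \forall s \near t, cdom c (g s) by apply: cg; exact: near_cdom.
have Uc : cimg c ((coord c \o g) t) by exact: cimg_coord.
have dn : \forall s \near t, derivable (coord c \o g) s 1.
  near=> s; have [|//] := dg c s ac.
  by near: s.
have [_ cc] := dg c t ac gt.
have := C1_curve_comp_continuous (cimg_open (c:=c)) (patch_C 1 ac) Uc dn cc.
have E : \forall s \near t,
    derive1 ((X \o param c) \o (coord c \o g)) s = derive1 (X \o g) s.
  near=> s.
  have gs : cdom c (g s) by near: s.
  have [_ ->] := curve_deriv Cg ac gs.
  have [dcg _] := dg c s ac gs.
  have Us : cimg c ((coord c \o g) s) by exact: cimg_coord.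
  by have [_ ->] := C1_curve_comp (cimg_open (c:=c)) (patch_C 1 ac) Us dcg.
move=> H; suff : derive1 (X \o g) s @[s --> t] --> derive1 (X \o g) t by [].
have E0 : derive1 ((X \o param c) \o (coord c \o g)) t = derive1 (X \o g) t.
  exact: (nbhs_singleton E).
rewrite -E0; exact: cvg_trans (near_eq_cvg E) H.
Unshelve. all: by end_near. Qed.

Lemma speedE (g : R -> M) (t : R) :
  C1_curve g -> speed X g t = enorm (derive1 (X \o g) t).
Proof.
move=> Cg.
have [_ ->] := curve_deriv Cg (chart_at_atlas (g t)) (chart_at_dom (g t)).
by rewrite /speed /tnorm /inner ipE.
Qed.

Lemma continuous_enorm (m : nat) (f : R -> 'rV[R]_m) (t : R) :
  {for t, continuous f} -> {for t, continuous (fun s => enorm (f s))}.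
Proof.
move=> cf; rewrite /enorm.
apply: (@cvg_comp _ _ _ (fun s => dot (f s) (f s)) (@Num.sqrt R) _
  (nbhs (dot (f t) (f t)))); last exact: sqrt_continuous.
have fc i : f s 0 i @[s --> t] --> f t 0 i by have /cvg_rowP := cf; exact.
by apply: cvg_bigsum => i; apply: cvgM.
Qed.

Lemma speed_continuous (g : R -> M) : C1_curve g -> continuous (speed X g).
Proof.
move=> Cg; rewrite (_ : speed X g = fun t => enorm (derive1 (X \o g) t)).
  by move=> t; apply: continuous_enorm; exact: curve_deriv_continuous.
by apply/funext => t; exact: speedE.
Qed.

Lemma continuous_itv_integrable (f : R -> R) (a b : R) :
  continuous f -> (@lebesgue_measure R).-integrable `[a, b] (EFin \o f).
Proof.
move=> cf; apply: continuous_compact_integrable; first exact: segment_compact.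
exact: continuous_subspaceT.
Qed.

Lemma curve_length_ge0 (g : R -> M) : 0 <= curve_length X g.
Proof. by apply: Rintegral_ge0 => t _; exact: sqrtr_ge0. Qed.

Lemma curve_length_le (g : R -> M) (B : R) :
  C1_curve g -> (forall t, 0 <= t <= 1 -> speed X g t <= B) ->
  curve_length X g <= B.
Proof.
move=> Cg gB; rewrite /curve_length.
apply: (@le_trans _ _ (Rintegral (@lebesgue_measure R) `[0, 1] (fun=> B))).
  apply: le_Rintegral => //.
  - by apply: continuous_itv_integrable; exact: speed_continuous.
  - by apply: continuous_itv_integrable => t; exact: cvg_cst.
rewrite Rintegral_cst//= lebesgue_measure_itv/= lte_fin ltr01 oppr0.
by rewrite adde0/= mulr1.
Qed.

(** The fundamental theorem of calculus, applied to each coordinate of X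
    along the curve. *)
Lemma curve_chord_le (g : R -> M) (a b : R) :
  C1_curve g -> 0 <= a -> a <= b -> b <= 1 ->
  `|X (g b) - X (g a)| <= curve_length X g.
Proof.
move=> Cg a0 ab b1; apply: normrV_le => [|j]; first exact: curve_length_ge0.
rewrite !mxE; move: ab; rewrite le_eqVlt => /orP[/eqP->|ab].
  by rewrite subrr normr0 curve_length_ge0.
pose f (t : R) : R := X (g t) 0 j.
pose f' (t : R) : R := (derive1 (X \o g) t) 0 j.
have cf' : continuous f'.
  by move=> t; have /cvg_rowP/(_ j) := curve_deriv_continuous Cg (x:=t); exact.
have df (t : R) : is_derive t 1 f (f' t).
  have [D _] := curve_deriv Cg (chart_at_atlas (g t)) (chart_at_dom (g t)).
  have D' : derivable f t 1 by have /derivable_mxP := D; exact.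
  split => //; rewrite /f' derive1E; apply/esym; exact: derive_row.
have cf : continuous f.
  move=> t; apply: differentiable_continuous; apply/derivable1_diffP.
  by have [] := df t.
have FTC : Rintegral (@lebesgue_measure R) `[a, b] f' = f b - f a.
  rewrite /Rintegral (@continuous_FTC2 _ f' f)//.
  - exact: continuous_subspaceT.
  - split.
    + by move=> t _; have [] := df t.
    + by apply: cvg_at_right_filter; exact: cf.
    + by apply: cvg_at_left_filter; exact: cf.
  - by move=> t _; rewrite derive1E; have [] := df t.
have If' : (@lebesgue_measure R).-integrable `[a, b] (EFin \o f').
  exact: continuous_itv_integrable.
have Is c d : (@lebesgue_measure R).-integrable `[c, d] (EFin \o speed X g).
  by apply: continuous_itv_integrable; exact: speed_continuous.
rewrite -/(f b) -/(f a) -FTC.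
apply: (le_trans (le_normr_Rintegral _ If')) => //.
apply: (@le_trans _ _ (Rintegral (@lebesgue_measure R) `[a, b] (speed X g))).
  apply: le_Rintegral => //.
    by apply: continuous_itv_integrable => t; apply: cvg_norm; exact: cf'.
  move=> t _; rewrite -/(speed X g t) speedE//.
  by rewrite (le_trans (coord_le_norm _ j))// norm_le_enorm.
rewrite /curve_length /Rintegral fine_le//.
- exact: integrable_fin_num.
- exact: integrable_fin_num.
apply: ge0_subset_integral => //.
- by apply: measurable_int; exact: Is.
- by move=> t _; rewrite lee_fin sqrtr_ge0.
- move=> t /=; rewrite !in_itv/= => /andP[t1 t2].
  by rewrite (le_trans a0)//= (le_trans t2).
Qed.
End Length.

(** * The intrinsic distance and its topology *)

Section Distance.
Context (R : realType) (n : nat) (M : smooth_manifold R n).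
Variable X : M -> 'rV[R]_n.+1.
Hypothesis hX : smooth_immersion X.

Lemma piecewise_C1_ge0 p q l : piecewise_C1 X p q l -> 0 <= l.
Proof.
elim=> // g l' Cg _ l'0; rewrite addr_ge0//; exact: curve_length_ge0.
Qed.

Lemma dist_le p q l : piecewise_C1 X p q l -> dist X p q <= l.
Proof.
move=> pql; apply: ge_inf => //; exists 0 => l' /=; exact: piecewise_C1_ge0.
Qed.

Lemma dist_ge0 p q : 0 <= dist X p q.
Proof.
have [[l pql]|no] := pselect (exists l, piecewise_C1 X p q l).
  by apply: lb_le_inf => [|l' /=]; [exists l|exact: piecewise_C1_ge0].
rewrite /dist (_ : [set l | _] = set0) ?inf0//.
by apply/seteqP; split=> l //= pql; apply: no; exists l.
Qed.

Lemma piecewise_C1_trans p q r l l' :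
  piecewise_C1 X p q l -> piecewise_C1 X q r l' -> piecewise_C1 X p r (l + l').
Proof.
move=> pq; elim; first by rewrite addr0.
by move=> g l2 Cg _ IH; rewrite addrA; exact: piecewise_C1_rcons.
Qed.

(** Curves must be defined on the whole line, where a straight segment may
    leave the chart; sin (pi t / 2) runs from 0 to 1 on [0, 1] and stays in
    [-1, 1]. *)
Definition segment_time (t : R) : R := sin (pi / 2 * t).

Lemma segment_time0 : segment_time 0 = 0.
Proof. by rewrite /segment_time mulr0 sin0. Qed.

Lemma segment_time1 : segment_time 1 = 1.
Proof. by rewrite /segment_time mulr1 sin_pihalf. Qed.

Lemma segment_time_bound t : `|segment_time t| <= 1.
Proof. by rewrite ler_norml sin_geN1 sin_le1. Qed.

Lemma is_derive_segment_time (t : R) :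
  is_derive t 1 segment_time (cos (pi / 2 * t) * (pi / 2)).
Proof.
apply: is_derive1_comp.
rewrite (_ : *%R (pi / 2) = (pi / 2 : R) \*: id)//.
by apply: is_derive_eq; rewrite [_%:A]mulr1.
Qed.

Lemma segment_speed_bound (t : R) : `|cos (pi / 2 * t) * (pi / 2)| <= 2 :> R.
Proof.
rewrite normrM -[leRHS]mul1r ler_pM//.
  by rewrite ler_norml cos_geN1 cos_le1.
rewrite ger0_norm ?divr_ge0 ?pi_ge0//; apply/ltW/pihalf_lt2.
Qed.

Definition segment_line (x V : 'rV[R]_n) (t : R) := x + segment_time t *: V.

Lemma segment_line_derivable x V (t : R) :
  derivable (segment_line x V) t 1 /\
  derive1 (segment_line x V) t = (cos (pi / 2 * t) * (pi / 2)) *: V.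
Proof.
have [ds Ds] := is_derive_segment_time t.
have [d1 D1] : is_derive t 1 (fun s => segment_time s *: V)
     ((cos (pi / 2 * t) * (pi / 2)) *: V).
  have dd : differentiable segment_time t by exact/derivable1_diffP.
  have dZ := differentiableZl V dd.
  split; first exact/derivable1_diffP.
  by rewrite (deriveE _ dZ) (diffZl V dd) -Ds (deriveE _ dd).
have dc : derivable (cst x : R -> 'rV[R]_n) t 1 by exact: derivable_cst.
have E : segment_line x V = cst x + (fun s => segment_time s *: V) by [].
have dsum := derivableD dc d1.
rewrite E; split; first exact dsum.
by rewrite derive1E (deriveD dc d1) derive_cst add0r D1.
Qed.

Lemma segment_line_continuous x V : continuous (segment_line x V).
Proof.
move=> t; apply: differentiable_continuous; apply/derivable1_diffP.
exact: (proj1 (segment_line_derivable x V t)).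
Qed.

Lemma segment_line_C1 x V : continuous (derive1 (segment_line x V)).
Proof.
rewrite (_ : derive1 _ = fun t : R => (cos (pi / 2 * t) * (pi / 2)) *: V); last first.
  by apply/funext => t; exact: (proj2 (segment_line_derivable x V t)).
move=> t; apply: cvgZr_tmp; apply: cvgM; last exact: cvg_cst.
apply: (@cvg_comp _ _ _ (fun u : R => pi / 2 * u) (@cos R) _ (nbhs (pi / 2 * t))).
  by apply: cvgM; [exact: cvg_cst|exact: cvg_id].
exact: continuous_cos.
Qed.

(** The factor 2 bounds the speed pi / 2 of the parametrization of the
    segment. *)
Lemma chart_segment (c : chart R n M) (x V : 'rV[R]_n) (B : R) :
  atlas c -> (forall s : R, `|s| <= 1 -> cimg c (x + s *: V)) ->
  (forall s : R, `|s| <= 1 ->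
     enorm (V *m partial_mx (X \o param c) (x + s *: V)) <= B) ->
  exists2 l, piecewise_C1 X (param c x) (param c (x + V)) l & l <= 2 * B.
Proof.
move=> ac inc VB; pose l := segment_line x V; pose g := param c \o l.
have lc t : cimg c (l t) by apply: inc; exact: segment_time_bound.
have dl t : derivable l t 1 by exact: (proj1 (segment_line_derivable x V t)).
have cg : continuous g.
  move=> t; apply: (@cvg_comp _ _ _ l (param c) _ (nbhs (l t))).
    exact: segment_line_continuous.
  exact: param_continuous.
have Cg : C1_curve g.
  split => // d t ad gt.
  have ot : overlap c d (l t) by apply/overlapP.
  have C1T : C_on 1 (overlap c d) (coord d \o param c) by exact: atlas_smooth.
  have E : coord d \o g = (coord d \o param c) \o l by [].
  have [D1 _] := C1_curve_comp (@overlap_open _ _ _ c d) C1T ot (dl t).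
  rewrite E; split; first exact: D1.
  have dln : \forall s \near t, derivable l s 1 by near=> s; exact: dl.
  have cl := @segment_line_C1 x V t.
  exact: (C1_curve_comp_continuous (@overlap_open _ _ _ c d) C1T ot dln cl).
exists (curve_length X g).
  have g0 : g 0 = param c x.
    by rewrite /g/=/l /segment_line segment_time0 scale0r addr0.
  have g1 : g 1 = param c (x + V).
    by rewrite /g/=/l /segment_line segment_time1 scale1r.
  rewrite -g1 -[curve_length _ _]add0r; apply: piecewise_C1_rcons => //.
  rewrite g0; exact: piecewise_C1_nil.
apply: (curve_length_le hX) => // t _.
rewrite (speedE hX t Cg).
have [_ D] := C1_curve_comp (cimg_open (c:=c)) (patch_C hX 1 ac) (lc t) (dl t).
have E : X \o g = (X \o param c) \o l by [].
rewrite E D (proj2 (segment_line_derivable x V t)) -scalemxAl enormZ.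
apply: ler_pM => //; first exact: enorm_ge0.
  exact: segment_speed_bound.
by apply: VB; exact: segment_time_bound.
Unshelve. all: by end_near. Qed.

(** Nearby points of a chart are joined by a coordinate segment. The roles
    of x and y can be exchanged, which spares reversing curves. *)
Lemma chart_reach (c : chart R n M) (x0 : 'rV[R]_n) : atlas c -> cimg c x0 ->
  exists2 d : R, 0 < d & forall x y, `|x - x0| < d -> `|y - x0| < d ->
    cimg c x /\ exists l, piecewise_C1 X (param c x) (param c y) l.
Proof.
move=> ac xc.
have /nbhs_normP[d /= d0 dP] := near_cimg xc.
have dC x : `|x - x0| < d -> cimg c x.
  by move=> xd; apply: dP; rewrite /ball_/= distrC.
exists (d / 3) => [|x y xd yd]; first by rewrite divr_gt0.
have xd' : `|x - x0| < d.
  by rewrite (lt_trans xd)// ltr_pdivrMr//; lra.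
split; first exact: dC.
have inc (s : R) : `|s| <= 1 -> cimg c (x + s *: (y - x)).
  move=> s1; apply: dC; rewrite addrAC.
  apply: (le_lt_trans (ler_normD _ _)); rewrite normrZ.
  have yx : `|y - x| < d / 3 + d / 3.
    rewrite -(subrK x0 y) -addrA (le_lt_trans (ler_normD _ _))//.
    by rewrite ltrD// distrC.
  have : `|s| * `|y - x| <= `|y - x| by rewrite ler_piMl.
  lra.
have [B BP] : exists B, forall s : R, `|s| <= 1 ->
    enorm ((y - x) *m partial_mx (X \o param c) (x + s *: (y - x))) <= B.
  pose f (s : R) := enorm ((y - x) *m partial_mx (X \o param c) (x + s *: (y - x))).
  have cf : {within `[-1, 1], continuous f}.
    apply: continuous_in_subspaceT => s; rewrite inE/= in_itv/= => s1.
    apply: continuous_enorm; apply: cvg_mulmx_row; first exact: cvg_cst.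
    move=> i j; under eq_fun do rewrite mxE; rewrite mxE.
    have [_ /(_ i)[_ [cD _]]] := patch_C hX 1 ac.
    have s1' : `|s| <= 1 by rewrite ler_norml.
    have cDs : {for (x + s *: (y - x)), continuous
        (fun z => 'D_(delta_mx 0 i) (X \o param c) z)} by apply: cD; exact: inc.
    by have /cvg_rowP/(_ j) := segment_continuous cDs; exact.
  have [|s0 _ s0P] := EVT_max (_ : -1 <= 1) cf; first by lra.
  by exists (f s0) => s; rewrite ler_norml => s1; apply: s0P; rewrite in_itv.
have [l H _] := chart_segment ac inc BP.
by exists l; rewrite addrC subrK in H.
Qed.

Hypothesis hM_connected : connected [set: M].

Lemma chart_nbhs (q : M) (d : R) : 0 < d ->
  \forall q' \near q, cdom (chart_at q) q' /\
    `|coord (chart_at q) q' - coord (chart_at q) q| < d.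
Proof.
move=> d0; have qc := chart_at_dom q.
have n1 := near_cdom qc.
have n2 : \forall q' \near q, `|coord (chart_at q) q' - coord (chart_at q) q| < d.
  have /cvgrPdist_lt/(_ d d0) := coord_continuous qc.
  by apply: filterS => q'; rewrite distrC.
near=> q'; split; by near: q'.
Unshelve. all: by end_near. Qed.

(** The distance is an infimum, which is meaningful only if some curve joins
    the two points; by connectedness this always happens. *)
Lemma reachable (p q : M) : exists l, piecewise_C1 X p q l.
Proof.
pose A : set M := [set q | exists l, piecewise_C1 X p q l].
suff AT : A = [set: M] by have : A q by rewrite AT.
have loc q0 : \forall q' \near q0, (exists l, piecewise_C1 X q0 q' l) /\
    (exists l, piecewise_C1 X q' q0 l).
  have ac := chart_at_atlas q0; have qc := chart_at_dom q0.
  have [d d0 dP] := chart_reach ac (cimg_coord qc).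
  apply: filterS (chart_nbhs q0 d0) => q' [q'c q'd].
  have z : `|coord (chart_at q0) q0 - coord (chart_at q0) q0| < d.
    by rewrite subrr normr0.
  have [_ [l1 H1]] := dP _ _ z q'd.
  have [_ [l2 H2]] := dP _ _ q'd z.
  rewrite !coordK// in H1 H2.
  by split; [exists l1|exists l2].
have oA : open A.
  rewrite openE => q0 [l pq0]; apply: filterS (loc q0) => q' [[l' q0q'] _].
  by exists (l + l'); exact: piecewise_C1_trans pq0 q0q'.
have clA : closed A.
  move=> q0 q0A; have [q' [[l pq'] [_ [l' q'q0]]]] := q0A _ (loc q0).
  by exists (l + l'); exact: piecewise_C1_trans pq' q'q0.
apply: hM_connected.
- by exists p; exists 0; exact: piecewise_C1_nil.
- by exists A => //; rewrite setTI.
- by exists A => //; rewrite setTI.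
Qed.

Lemma dist_lt_curve (p q : M) (e : R) : dist X p q < e ->
  exists2 l, piecewise_C1 X p q l & l < e.
Proof.
by move=> /inf_lt[|l /= pql le]; [exact: reachable|exists l].
Qed.

Lemma dist_triangle (p q r : M) : dist X p r <= dist X p q + dist X q r.
Proof.
apply/ler_addgt0Pr => e e0.
have e2 : 0 < e / 2 by rewrite divr_gt0.
have [l pq le] : exists2 l, piecewise_C1 X p q l & l < dist X p q + e / 2.
  by apply: dist_lt_curve; rewrite ltrDl.
have [l' qr le'] : exists2 l, piecewise_C1 X q r l & l < dist X q r + e / 2.
  by apply: dist_lt_curve; rewrite ltrDl.
have := dist_le (piecewise_C1_trans pq qr); lra.
Qed.

Lemma dist_refl (p : M) : dist X p p = 0.
Proof.
apply/eqP; rewrite eq_le dist_ge0 andbT; apply: dist_le.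
exact: piecewise_C1_nil.
Qed.
End Distance.

Section DistanceTopology.
Context (R : realType) (n : nat) (M : smooth_manifold R n).
Variable X : M -> 'rV[R]_n.+1.
Hypothesis hX : smooth_immersion X.

Lemma patch_diff (c : chart R n M) x : atlas c -> cimg c x ->
  differentiable (X \o param c) x /\
  forall v, 'D_v (X \o param c) x = v *m partial_mx (X \o param c) x.
Proof. by move=> ac xc; exact: C1_diff (cimg_open (c:=c)) xc (patch_C hX 1 ac). Qed.

Lemma patch_free (c : chart R n M) x : atlas c -> cimg c x ->
  row_free (partial_mx (X \o param c) x).
Proof.
move=> ac xc; rewrite -jacobianE; first exact: (proj2 hX).
by have [] := patch_diff ac xc.
Qed.

Lemma patch_expanding (c : chart R n M) x : atlas c -> cimg c x ->
  exists2 m : R, 0 < m & exists2 d : R, 0 < d & forall y z,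
    `|y - x| < d -> `|z - x| < d ->
    m * `|z - y| <= `|X (param c z) - X (param c y)|.
Proof.
move=> ac xc.
exact: (strict_expanding (patch_free ac xc)
  (C1_strict (cimg_open (c:=c)) xc (patch_C hX 1 ac))).
Qed.

Lemma immersion_continuous : continuous X.
Proof. exact: C_manifold_continuous (proj1 hX 0%N). Qed.

(** Leaving a small coordinate ball costs a definite length, because the
    immersion expands coordinates there and a chord is no longer than the
    curve. Curves are followed backwards from p, the end at which they are
    built. *)
Lemma dist_nbhs (p : M) (V : set M) : nbhs p V ->
  connected [set: M] ->
  exists2 e : R, 0 < e & forall q, dist X q p < e -> V q.
Proof.
move=> nV hconn; pose c := chart_at p.
have pc : cdom c p := chart_at_dom p.
have ac : atlas c := chart_at_atlas p.
pose x0 := coord c p; have xc : cimg c x0 := cimg_coord pc.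
have [m m0 [d d0 dP]] := patch_expanding ac xc.
have nV' : \forall x \near x0, V (param c x).
  by apply: (param_continuous xc); rewrite coordK.
have [d1 d10 d1P] := near_both (near_cimg xc) nV'.
pose r := Num.min d d1 / 2.
have mn0 : 0 < Num.min d d1 by rewrite lt_min d0.
have r0 : 0 < r by rewrite divr_gt0.
have : r < Num.min d d1 by rewrite ltr_pdivrMr// mulr2n mulrDr mulr1 ltrDl.
rewrite lt_min => /andP[rd rd1].
pose K (q : M) := cdom c q /\ `|coord c q - x0| < r.
have openK q : K q -> \forall q' \near q, K q'.
  move=> [qc qr].
  have n2 : \forall q' \near q, `|coord c q' - coord c q| < r - `|coord c q - x0|.
    have /cvgrPdist_lt/(_ (r - `|coord c q - x0|)) := coord_continuous qc.
    by rewrite subr_gt0 => /(_ qr); apply: filterS => q'; rewrite distrC.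
  have n1 := near_cdom qc.
  near=> q'; split; first by near: q'.
  rewrite -(subrK (coord c q) (coord c q')) -addrA (le_lt_trans (ler_normD _ _))//.
  by rewrite -ltrBrDr; near: q'.
pose C := closed_ball_ Num.Def.normr x0 r.
have CE x : C x -> `|x - x0| <= r by rewrite /C/closed_ball_/= distrC.
have Ccomp : compact C by exact: closed_ball_rV_compact.
have Cclosed : closed (param c @` C).
  apply: (compact_closed (@manifold_hausdorff _ _ M)).
  apply: continuous_compact => //.
  apply: continuous_in_subspaceT => x /set_mem/CE xr.
  by apply: param_continuous; have [|] := d1P x; rewrite ?(le_lt_trans xr).
(* a short curve that ends in the ball K starts in it: being in K is an open
   condition, and a closed one, as limits stay in the image of the compact ball
   C and the bound on the length keeps them off its boundary *)
have curveK (g : R -> M) : C1_curve g -> K (g 1) ->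
    `|X (g 1) - X p| + curve_length X g < m * r -> K (g 0).
  move=> Cg K1 len; have [cg _] := Cg.
  have cg' (t : R) : {for t, continuous (fun s : R => g (1 - s))}.
    apply: (@cvg_comp _ _ _ (fun s : R => 1 - s) g _ (nbhs (1 - t))); last exact: cg.
    by apply: cvgB; [exact: cvg_cst|exact: cvg_id].
  suff H : forall t : R, 0 <= t <= 1 -> K (g (1 - t)).
    by have := H 1; rewrite subrr lexx ler01; exact.
  apply: clopen_segment; first by rewrite subr0.
  - move=> t tI /openK nK.
    have nt : \forall s \near t, K (g (1 - s)) by exact: (cg' t).
    by have [d2 d20 d2P] := near_both nt nt; exists d2 => // s /d2P[].
  - move=> t /andP[t0 t1] clo.
    have clq : closure (param c @` C) (g (1 - t)).
      move=> W nW.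
      have nt : \forall s \near t, W (g (1 - s)) by exact: (cg' t).
      have [d2 d20 d2P] := near_both nt nt.
      have [s [_ sd [sc sr]]] := clo d2 d20.
      exists (g (1 - s)); split; last by case: (d2P s sd).
      exists (coord c (g (1 - s))); last by rewrite coordK.
      by rewrite /C/closed_ball_/= distrC ltW.
    have [x Cx xE] := Cclosed _ clq.
    have xr := CE _ Cx.
    have [xci _] := d1P x (le_lt_trans xr rd1).
    rewrite -xE; split; first exact: param_cdom.
    rewrite paramK// -(ltr_pM2l m0).
    have := dP x0 x; rewrite subrr normr0 => /(_ d0 (le_lt_trans xr rd)).
    move=> /le_lt_trans; apply; rewrite coordK// xE.
    apply: le_lt_trans len.
    rewrite -(subrK (X (g 1)) (X (g (1 - t)))) -addrA addrC.
    apply: (le_trans (ler_normD _ _)); rewrite lerD2l distrC.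
    by apply: (curve_chord_le hX) => //; rewrite ?subr_ge0// gerBl.
exists (m * r) => [|q /(dist_lt_curve hX hconn)[l]]; first by rewrite mulr_gt0.
have H q' l' : piecewise_C1 X q q' l' -> K q' -> `|X q' - X p| + l' < m * r -> K q.
  elim=> // g l2 Cg pl2 IH K1 len.
  have l20 := piecewise_C1_ge0 pl2.
  have K0 : K (g 0).
    apply: curveK => //; apply: le_lt_trans len.
    by rewrite lerD2l lerDr.
  apply: IH => //; apply: le_lt_trans len.
  rewrite [l2 + _]addrC addrA lerD2r -(subrK (X (g 1)) (X (g 0))) -addrA addrC.
  apply: (le_trans (ler_normD _ _)); rewrite lerD2l distrC.
  by apply: (curve_chord_le hX) => //; rewrite ler01.
move=> qp lt; have : K q.
  apply: (H _ _ qp); first by split=> //; rewrite subrr normr0.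
  by rewrite subrr normr0 add0r.
move=> [qc qr]; have [_] := d1P _ (lt_trans qr rd1).
by rewrite coordK.
Unshelve. all: by end_near. Qed.
End DistanceTopology.

(** * Differentiability of the unit normal *)

Section MatrixDerivative.
Context (R : realType) (V : normedModType R).

Lemma differentiable_bigsum (I : Type) (r : seq I) (f : I -> V -> R) (x : V) :
  (forall i, differentiable (f i) x) ->
  differentiable (fun y => \sum_(i <- r) f i y) x.
Proof.
move=> df; elim: r => [|i r IH].
  under eq_fun do rewrite big_nil.
  exact: differentiable_cst.
under eq_fun do rewrite big_cons.
exact: (differentiableD (df i) IH).
Qed.

Lemma differentiable_bigprod (I : Type) (r : seq I) (f : I -> V -> R) (x : V) :
  (forall i, differentiable (f i) x) ->
  differentiable (fun y => \prod_(i <- r) f i y) x.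
Proof.
move=> df; elim: r => [|i r IH].
  under eq_fun do rewrite big_nil.
  exact: differentiable_cst.
under eq_fun do rewrite big_cons.
exact: (differentiableM (df i) IH).
Qed.

Lemma differentiable_mul (f g : V -> R) (x : V) :
  differentiable f x -> differentiable g x -> differentiable (fun y => f y * g y) x.
Proof. by move=> df dg; exact: (differentiableM df dg). Qed.

Lemma differentiable_mull (a : R) (f : V -> R) (x : V) :
  differentiable f x -> differentiable (fun y => a * f y) x.
Proof.
by move=> df; apply: (differentiable_mul _ df); exact: differentiable_cst.
Qed.

Lemma differentiable_det (n : nat) (A : V -> 'M[R]_n) (x : V) :
  (forall i j, differentiable (fun y => A y i j) x) ->
  differentiable (fun y => \det (A y)) x.
Proof.
move=> dA; apply: differentiable_bigsum => s.
apply: differentiable_mull; by apply: differentiable_bigprod => i.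
Qed.

Lemma near_unitmx (n : nat) (A : V -> 'M[R]_n) (x : V) :
  (forall i j, differentiable (fun y => A y i j) x) -> A x \in unitmx ->
  \forall y \near x, A y \in unitmx.
Proof.
move=> dA; rewrite unitmxE unitfE => d0.
have /continuous_normP cd := differentiable_continuous (differentiable_det dA).
have [|e e0 eP] := cd `|\det (A x)|; first by rewrite normr_gt0.
apply/nbhs_normP; exists e => // y; rewrite /ball_/= distrC => /eP.
rewrite unitmxE unitfE; apply: contraTneq => ->.
by rewrite sub0r normrN ltxx.
Qed.

Lemma differentiable_invmx (n : nat) (A : V -> 'M[R]_n) (x : V) (i j : 'I_n) :
  (forall i j, differentiable (fun y => A y i j) x) -> A x \in unitmx ->
  differentiable (fun y => invmx (A y) i j) x.
Proof.
move=> dA uA.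
have dd := differentiable_det dA.
have d0 : \det (A x) != 0 by move: uA; rewrite unitmxE unitfE.
have nu := near_unitmx dA uA.
apply: (@near_eq_differentiable _ _ _
   (fun y => (\det (A y))^-1 * \adj (A y) i j)).
  near=> y; rewrite /invmx.
  have -> : A y \in unitmx by near: y.
  by rewrite [RHS]mxE.
apply: differentiable_mul.
  exact: differentiableV.
under eq_fun do rewrite mxE.
apply: differentiable_mull.
by apply: differentiable_det => k l; under eq_fun do rewrite !mxE.
Unshelve. all: by end_near. Qed.

Lemma differentiable_rowP (n : nat) (F : V -> 'rV[R]_n) (x : V) :
  (forall i, differentiable (fun y => F y 0 i) x) -> differentiable F x.
Proof.
move=> dF; rewrite (_ : F = \sum_(i < n) (fun y => F y 0 i *: delta_mx 0 i)).
  by apply: differentiable_sum => i; exact: differentiableZl.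
apply/funext => y; rewrite fct_sumE; apply/rowP => j.
rewrite summxE (bigD1 j)//= !mxE !eqxx mulr1 big1 ?addr0// => i ij.
by rewrite !mxE eqxx/= eq_sym (negbTE ij) mulr0.
Qed.

Lemma differentiable_row (n : nat) (F : V -> 'rV[R]_n) (x : V) i :
  differentiable F x -> differentiable (fun y => F y 0 i) x.
Proof. by move=> dF; exact: (differentiable_comp dF (differentiable_coord _ 0 i)). Qed.

Lemma is_derive_bigsum (I : Type) (r : seq I) (f : I -> V -> R) (df : I -> R)
    (x v : V) :
  (forall i, is_derive x v (f i) (df i)) ->
  is_derive x v (fun y => \sum_(i <- r) f i y) (\sum_(i <- r) df i).
Proof.
move=> dfi; elim: r => [|i r IH].
  by under eq_fun do rewrite big_nil; rewrite big_nil; exact: is_derive_cst.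
under eq_fun do rewrite big_cons.
by rewrite big_cons; exact: (is_deriveD (dfi i) IH).
Qed.

Lemma is_derive_mul (f g : V -> R) (df dg : R) (x v : V) :
  is_derive x v f df -> is_derive x v g dg ->
  is_derive x v (fun y => f y * g y) (df * g x + f x * dg).
Proof.
move=> Df Dg; have H := is_deriveM Df Dg.
apply: (is_derive_eq H).
by rewrite addrC [g x *: df]mulrC.
Qed.

Lemma is_derive_coord (n : nat) (F : V -> 'rV[R]_n) (x v : V) i :
  derivable F x v -> is_derive x v (fun y => F y 0 i) (('D_v F x) 0 i).
Proof.
move=> dF; split; last by rewrite (derive_row i dF).
by have /derivable_mxP := dF; exact.
Qed.

Lemma is_derive_dot (n : nat) (F G : V -> 'rV[R]_n) (x v : V) :
  derivable F x v -> derivable G x v ->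
  is_derive x v (fun y => dot (F y) (G y))
    (dot ('D_v F x) (G x) + dot (F x) ('D_v G x)).
Proof.
move=> dF dG; rewrite /dot -big_split/=.
by apply: is_derive_bigsum => i; apply: is_derive_mul; exact: is_derive_coord.
Qed.
End MatrixDerivative.

Lemma cvg_dot (R : realType) (T : Type) (F : set_system T) (FF : Filter F)
    (m : nat) (f g : T -> 'rV[R]_m) (a b : 'rV[R]_m) :
  f x @[x --> F] --> a -> g x @[x --> F] --> b ->
  dot (f x) (g x) @[x --> F] --> dot a b.
Proof.
move=> /cvg_rowP fa /cvg_rowP gb.
by apply: cvg_bigsum => i; apply: cvgM; [exact: fa|exact: gb].
Qed.

(** The rows of J are independent, and orthogonal to N. *)
Lemma frame_unitmx (R : realType) (n : nat) (J : 'M[R]_(n, n.+1)) (N : 'rV[R]_n.+1) :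
  row_free J -> dot N N = 1 -> N *m J^T = 0 ->
  (col_mx N J : 'M[R]_(1 + n)) \in unitmx.
Proof.
move=> rJ NN NJ; rewrite -row_free_unit -kermx_eq0; apply/negPn/negP => /rowV0Pn[v].
move=> /sub_kermxP; rewrite -[v]hsubmxK mul_row_col => E v0.
have NNt : N *m N^T = 1%:M.
  by apply/matrixP => i j; rewrite !ord1 -dotE NN !mxE.
have JNt : J *m N^T = 0 by rewrite -[J]trmxK -trmx_mul NJ trmx0.
have l0 : lsubmx v = 0.
  have := congr1 (fun A => A *m N^T) E.
  by rewrite mulmxDl -!mulmxA NNt JNt mulmx1 mulmx0 addr0 mul0mx.
have /row_freeP[K JK] := rJ.
have r0 : rsubmx v = 0.
  move: E; rewrite l0 mul0mx add0r => /(congr1 (fun A => A *m K)).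
  by rewrite -mulmxA JK mulmx1 mul0mx.
move/eqP: v0; apply; rewrite -[v]hsubmxK l0 r0.
by rewrite row_mx0 ?linear0 ?row_mx0.
Qed.

Section Normal.
Context (R : realType) (n : nat) (M : smooth_manifold R n).
Variables (X N : M -> 'rV[R]_n.+1).
Hypothesis hX : smooth_immersion X.
Hypothesis hN : unit_normal_field X N.

Lemma normal_continuous : continuous N. Proof. by case: hN. Qed.
Lemma normal_unit p : dot (N p) (N p) = 1. Proof. by case: hN. Qed.

Lemma normal_frame (c : chart R n M) x : atlas c -> cimg c x ->
  N (param c x) *m (partial_mx (X \o param c) x)^T = 0.
Proof.
move=> ac xc; have [_ _ Northo] := hN.
apply/rowP => i; rewrite [RHS]mxE.
have := Northo c (param c x) (delta_mx 0 i) ac (param_cdom xc).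
rewrite paramK// dotE => E; rewrite -[RHS]E [LHS]mxE [RHS]mxE.
by apply: eq_bigr => k _; rewrite !mxE.
Qed.

(** The normal field is only assumed continuous; it is smooth because it
    solves, up to normalization, a linear system with smooth coefficients. *)
Lemma normal_differentiable (c : chart R n M) x0 : atlas c -> cimg c x0 ->
  differentiable (N \o param c) x0.
Proof.
move=> ac x0c; pose phi := X \o param c; pose nu := N \o param c.
pose N0 := nu x0.
pose A (x : 'rV[R]_n) : 'M[R]_(1 + n) := (col_mx N0 (partial_mx phi x))^T.
have cphi : forall k, C_on k (cimg c) phi by move=> k; exact: patch_C.
have dA i j : differentiable (fun x => A x i j) x0.
  under eq_fun do rewrite /A mxE.
  case: (splitP j) => k jk.
    have -> : j = lshift n k by apply/val_inj.
    under eq_fun do rewrite col_mxEu; exact: differentiable_cst.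
  have -> : j = rshift 1 k by apply/val_inj.
  under eq_fun do rewrite col_mxEd mxE.
  have [_ /(_ k)[_ C1]] := cphi 2%N.
  apply: (@differentiable_row _ _ _ (fun x => 'D_(delta_mx 0 k) phi x)).
  exact: (proj1 (C1_diff (cimg_open (c:=c)) x0c C1)).
have uA0 : A x0 \in unitmx.
  rewrite unitmx_tr; apply: frame_unitmx; first exact: patch_free.
    exact: normal_unit.
  exact: normal_frame.
(* w is orthogonal to the frame and has product 1 with N0: it is normal, and
   close to N0 *)
pose w (x : 'rV[R]_n) : 'rV[R]_(1 + n) := row_mx 1%:M 0 *m invmx (A x).
have dw : differentiable w x0.
  apply: differentiable_rowP => j; rewrite /w; under eq_fun do rewrite mxE.
  apply: differentiable_bigsum => i.
  apply: differentiable_mull.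
  exact: differentiable_invmx.
have cnu : {for x0, continuous nu}.
  apply: (@cvg_comp _ _ _ (param c) N _ (nbhs (param c x0))).
    exact: param_continuous.
  exact: normal_continuous.
have nk : \forall x \near x0, 0 < dot (nu x) N0.
  have H : dot (nu x) N0 @[x --> x0] --> dot (nu x0) N0.
    by apply: (cvg_dot (nbhs_filter x0)); [exact: cnu|exact: cvg_cst].
  rewrite [dot (nu x0) N0]normal_unit in H.
  have /cvgrPdist_lt/(_ 1 ltr01) := H; apply: filterS => x.
  by rewrite ltr_distlC subrr => /andP[].
have nA : \forall x \near x0, A x \in unitmx.
  exact: near_unitmx.
have nuw x : cimg c x -> A x \in unitmx -> nu x = dot (nu x) N0 *: w x.
  move=> xc uA; apply: (can_inj (mulmxK uA)).
  rewrite -scalemxAl /w mulmxKV// /A tr_col_mx mul_mx_row.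
  rewrite [nu x *m (partial_mx _ _)^T]normal_frame// scale_row_mx scaler0.
  congr row_mx; apply/matrixP => i j; rewrite !ord1 -dotE !mxE eqxx mulr1.
  by [].
have dwpos x : cimg c x -> A x \in unitmx -> 0 < dot (nu x) N0 ->
    0 < dot (w x) (w x) /\ dot (nu x) N0 = (Num.sqrt (dot (w x) (w x)))^-1.
  move=> xc uA k0; have := normal_unit (param c x).
  rewrite -[N (param c x)]/(nu x) {1 2}(nuw x xc uA) dotZl dotZr.
  set k := dot _ N0 in k0 *; set s := dot _ _ => E.
  have s0 : 0 < s.
    rewrite lt_neqAle dot_ge0 andbT; apply/eqP => s0.
    by move/eqP: E; rewrite -s0 !mulr0 eq_sym oner_eq0.
  split => //; have k2 : k ^+ 2 = s^-1.
    apply: (mulIf (lt0r_neq0 s0)); rewrite mulVf ?lt0r_neq0// -E; ring.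
  by rewrite -sqrtrV ?ltW// -k2 sqrtr_sqr gtr0_norm.
have ds : differentiable (fun x => dot (w x) (w x)) x0.
  apply: differentiable_bigsum => i.
  by apply: differentiable_mul; exact: differentiable_row.
have [s0 _] := dwpos x0 x0c uA0 (nbhs_singleton nk).
apply: (@near_eq_differentiable _ _ _
  (fun x => (Num.sqrt (dot (w x) (w x)))^-1 *: w x)).
  near=> x.
  have xc : cimg c x by near: x; exact: near_cimg.
  have uA : A x \in unitmx by near: x.
  have k0 : 0 < dot (nu x) N0 by near: x.
  by have [_ <-] := dwpos x xc uA k0; rewrite -nuw.
apply: differentiable_rowP => i; under eq_fun do rewrite mxE.
apply: differentiable_mul.
  apply: differentiableV; last by rewrite gt_eqF// sqrtr_gt0.
  apply: (@differentiable_comp _ _ _ _ (fun x => dot (w x) (w x)) (@Num.sqrt R)) => //.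
  by apply/derivable1_diffP; case: (is_derive1_sqrt s0).
exact: differentiable_row.
Unshelve. all: by end_near. Qed.
End Normal.

(** * The second fundamental form *)

Section Shape.
Context (R : realType) (n : nat) (M : smooth_manifold R n).
Variables (X N : M -> 'rV[R]_n.+1).
Hypothesis hX : smooth_immersion X.
Hypothesis hN : unit_normal_field X N.
Variables (c : chart R n M) (x : 'rV[R]_n).
Hypothesis ac : atlas c.
Hypothesis xc : cimg c x.

Let phi := X \o param c.
Let nu := N \o param c.
Let J := partial_mx phi x.

Definition second_form : 'M[R]_n :=
  \matrix_(i, j) dot (nu x) ('D_(delta_mx 0 i) (fun y => 'D_(delta_mx 0 j) phi y) x).

Lemma second_formE i j : second_form i j =
  dot (nu x) ('D_(delta_mx 0 i) (fun y => 'D_(delta_mx 0 j) phi y) x).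
Proof. exact: mxE. Qed.

Lemma patch_deriv_diff j :
  differentiable (fun y => 'D_(delta_mx 0 j) phi y) x /\
  forall v, 'D_v (fun y => 'D_(delta_mx 0 j) phi y) x =
    v *m partial_mx (fun y => 'D_(delta_mx 0 j) phi y) x.
Proof.
have [_ /(_ j)[_ C1]] := patch_C hX 2 ac.
exact: (C1_diff (cimg_open (c:=c)) xc C1).
Qed.

Lemma second_form_sym : second_form^T = second_form.
Proof.
have trE (A : 'M[R]_n) i j : A^T i j = A j i by rewrite mxE.
apply/matrixP => i j; rewrite trE (second_formE j i) (second_formE i j).
apply: (congr1 (dot (nu x))).
exact: (C2_symmetric j i (cimg_open (c:=c)) xc (patch_C hX 2 ac)).
Qed.

Lemma dot_deriv_second_form v j :
  dot (nu x) ('D_v (fun y => 'D_(delta_mx 0 j) phi y) x) = (v *m second_form) 0 j.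
Proof.
rewrite (proj2 (patch_deriv_diff j)) mul_partial_mx [RHS]mxE dotC dot_suml.
by apply: eq_bigr => i _; rewrite [dot _ (nu x)]dotC (second_formE i j).
Qed.

Let dnu : differentiable nu x := normal_differentiable hX hN ac xc.

Lemma normal_deriv_unit v : dot ('D_v nu x) (nu x) = 0.
Proof.
have dv : derivable nu x v by exact: diff_derivable.
have H := is_derive_dot dv dv.
have E : \forall y \near x, dot (nu y) (nu y) = cst (1 : R) y.
  by near=> y; rewrite (normal_unit hN).
have := near_eq_is_derive E H => -[_].
rewrite derive_cst [dot (nu x) _]dotC -mulr2n => /esym/eqP.
by rewrite mulrn_eq0/= => /eqP.
Unshelve. all: by end_near. Qed.

(** Differentiating the orthogonality of the normal and of the frame. *)
Lemma normal_deriv_frame v j :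
  dot ('D_v nu x) ('D_(delta_mx 0 j) phi x) = - (v *m second_form) 0 j.
Proof.
have dv : derivable nu x v by exact: diff_derivable.
have dj : derivable (fun y => 'D_(delta_mx 0 j) phi y) x v.
  by apply: diff_derivable; exact: (proj1 (patch_deriv_diff j)).
have H := is_derive_dot dv dj.
have E : \forall y \near x, dot (nu y) ('D_(delta_mx 0 j) phi y) = cst (0 : R) y.
  near=> y; have yc : cimg c y by near: y; exact: near_cimg.
  have /rowP/(_ j) := normal_frame hN ac yc.
  rewrite [RHS]mxE => <-; rewrite mxE.
  by apply: eq_bigr => k _; rewrite !mxE.
have := near_eq_is_derive E H => -[_].
by rewrite derive_cst dot_deriv_second_form => /esym/eqP; rewrite addr_eq0 => /eqP.
Unshelve. all: by end_near. Qed.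

Lemma patch_free_x : row_free J.
Proof. exact: (patch_free hX ac xc). Qed.

Lemma metric_unit : metric phi x \in unitmx.
Proof. exact: (posdef_unitmx (metric_posdef patch_free_x)). Qed.

Lemma tangent_components_normal_deriv v :
  tangent_components phi x (- 'D_v nu x) =
  v *m (second_form *m invmx (metric phi x)).
Proof.
rewrite /tangent_components mulmxA; congr (_ *m _); apply/rowP => j.
by rewrite mxE dotNl normal_deriv_frame opprK.
Qed.

(** Weingarten equation: the derivative of the normal is minus the second
    fundamental form with an index raised. *)
Lemma patch_shapeE :
  patch_shape phi nu x = second_form *m invmx (metric phi x).
Proof.
apply/matrixP => i j; rewrite mxE tangent_components_normal_deriv.
by rewrite -rowE mxE.
Qed.

(** The normal and the frame span the ambient space. *)
Lemma frame_ext (w : 'rV[R]_n.+1) :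
  dot w (nu x) = 0 -> w *m J^T = 0 -> w = 0.
Proof.
move=> wN wJ.
have uA : (col_mx (nu x) J : 'M[R]_(1 + n)) \in unitmx.
  apply: frame_unitmx; [exact: patch_free_x|exact: (normal_unit hN _)|].
  exact: normal_frame.
apply: (can_inj (mulmxK (_ : (col_mx (nu x) J : 'M[R]_(1 + n))^T \in unitmx))).
  by rewrite unitmx_tr.
rewrite mul0mx tr_col_mx mul_mx_row wJ (_ : w *m _ = 0) ?row_mx0//.
by apply/matrixP => i j; rewrite !ord1 -dotE wN mxE.
Qed.

Lemma normal_derivE v : 'D_v nu x = - (v *m patch_shape phi nu x *m J).
Proof.
apply/eqP; rewrite -addr_eq0; apply/eqP; apply: frame_ext.
  rewrite dotDl normal_deriv_unit add0r dotC dotE.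
  have := normal_frame hN ac xc => E.
  by rewrite trmx_mul mulmxA E mul0mx mxE.
have JJ : J *m J^T = metric phi x by rewrite metricE.
rewrite mulmxDl patch_shapeE -(mulmxA _ J) JJ mulmxA mulmxKV ?metric_unit//.
apply/rowP => j; rewrite [LHS]mxE [RHS]mxE.
rewrite (_ : ('D_v nu x *m J^T) 0 j = dot ('D_v nu x) ('D_(delta_mx 0 j) phi x)).
  by rewrite normal_deriv_frame addNr.
by rewrite mxE; apply: eq_bigr => k _; rewrite !mxE.
Qed.

(** The derivative of the normal is the shape operator up to sign, which is
    self-adjoint for the metric. *)
Lemma normal_deriv_bound v :
  dot ('D_v nu x) ('D_v nu x) <=
  \tr (patch_shape phi nu x ^+ 2) * dot (v *m J) (v *m J).
Proof.
rewrite normal_derivE dotNl dotC dotNl opprK.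
rewrite -!ipE patch_shapeE.
exact: (selfadjoint_norm_bound v (metric_sym phi x) (metric_posdef patch_free_x)
  second_form_sym).
Qed.
End Shape.

(** * Uniform graphs *)

Lemma C1_partial_continuous (R : realType) (n m : nat) (F : 'rV[R]_n -> 'rV[R]_m)
    (U : set 'rV[R]_n) (x0 : 'rV[R]_n) (e : R) :
  U x0 -> C_on 1 U F -> 0 < e ->
  exists2 d : R, 0 < d & forall x v : 'rV[R]_n, `|x - x0| < d ->
    `|v *m partial_mx F x - v *m partial_mx F x0| <= e * `|v|.
Proof.
move=> Ux0 [_ dF] e0.
have e'0 : 0 < e / n.+1%:R by rewrite divr_gt0.
have H i : exists2 d : R, 0 < d & forall x, `|x - x0| < d ->
    `|'D_(delta_mx 0 i) F x - 'D_(delta_mx 0 i) F x0| < e / n.+1%:R.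
  have [_ [cD _]] := dF i.
  by have /continuous_normP := cD x0 Ux0; apply.
have /(_ _)/cid2-/all_sig2[d d0 dP] := H.
exists (\big[Num.min/1]_i d i) => [|x v xd].
  by elim/big_rec: _ => // i a _ a0; rewrite lt_min d0.
rewrite -mulmxBr.
have B : forall i j, `|(partial_mx F x - partial_mx F x0) i j| <= e / n.+1%:R.
  move=> i j; rewrite !mxE; have xdi : `|x - x0| < d i.
    by apply: (lt_le_trans xd); rewrite (bigD1 i)//= ge_min lexx.
  apply: le_trans (ltW (dP i x xdi)).
  by have := coord_le_norm ('D_(delta_mx 0 i) F x - 'D_(delta_mx 0 i) F x0) j; rewrite !mxE.
apply: (le_trans (row_mul_bound v (ltW e'0) B)); apply: ler_wpM2r => //.
rewrite mulrCA; apply: ler_piMr; first exact: ltW.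
by rewrite ler_pdivrMr ?ltr0Sn// mul1r ler_nat.
Qed.

Section DropCoordinate.
Context (R : realType) (n : nat) (i : 'I_n.+1).

Definition drop_coord (w : 'rV[R]_n.+1) : 'rV[R]_n := \row_j w 0 (lift i j).

Lemma drop_coordB v w : drop_coord (v - w) = drop_coord v - drop_coord w.
Proof. by apply/rowP => j; rewrite !mxE. Qed.

Lemma drop_coord_norm w : `|drop_coord w| <= `|w|.
Proof. by apply: normrV_le => // j; rewrite mxE coord_le_norm. Qed.

Lemma drop_coord_continuous : continuous drop_coord.
Proof.
move=> w; apply/(@continuous_normP R 'rV[R]_n.+1 'rV[R]_n) => e e0.
exists e => // v; apply: le_lt_trans.
by rewrite -drop_coordB drop_coord_norm.
Qed.

Lemma drop_coord_mul (m : nat) (v : 'rV[R]_m) (A : 'M[R]_(m, n.+1)) :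
  drop_coord (v *m A) = v *m \matrix_(k, j) A k (lift i j).
Proof. by apply/rowP => j; rewrite !mxE; apply: eq_bigr => k _; rewrite !mxE. Qed.

(** Orthogonality to nu recovers the missing coordinate of v from the
    others, after division by the coordinate of nu, which c0 bounds from
    below. *)
Lemma tangent_drop_coord (v nu : 'rV[R]_n.+1) (c0 : R) :
  0 < c0 -> dot nu nu = 1 -> dot v nu = 0 -> c0 < `|nu 0 i| ->
  `|v| <= (1 + n%:R / c0) * `|drop_coord v|.
Proof.
move=> c00 nn vn nui.
have nu1 j : `|nu 0 j| <= 1.
  apply: (le_trans (coord_le_norm _ j)); apply: (le_trans (norm_le_enorm _)).
  by rewrite /enorm nn sqrtr1.
have w0 := normr_ge0 (drop_coord v).
have nc0 : 0 <= n%:R / c0 by rewrite divr_ge0// ltW.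
have wj j : `|v 0 (lift i j)| <= `|drop_coord v|.
  by have := coord_le_norm (drop_coord v) j; rewrite mxE.
have vi : `|v 0 i| * c0 <= n%:R * `|drop_coord v|.
  apply: (@le_trans _ _ `|v 0 i * nu 0 i|).
    by rewrite normrM ler_wpM2l// ltW.
  have : v 0 i * nu 0 i = - \sum_(j < n) v 0 (lift i j) * nu 0 (lift i j).
    by move/eqP: vn; rewrite /dot (bigD1_ord i)//= addr_eq0 => /eqP.
  move=> ->; rewrite normrN; apply: (le_trans (ler_norm_sum _ _ _)).
  apply: (@le_trans _ _ (\sum_(j < n) `|drop_coord v|)); last first.
    by rewrite sumr_const card_ord -[leLHS]mulr_natl.
  by apply: ler_sum => j _; rewrite normrM -[leRHS]mulr1 ler_pM.
apply: normrV_le => [|j]; first by rewrite mulr_ge0// addr_ge0.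
rewrite mulrDl mul1r.
case: (unliftP i j) => [k ->|->].
  by rewrite (le_trans (wj k))// lerDl mulr_ge0.
rewrite (@le_trans _ _ (n%:R / c0 * `|drop_coord v|))// ?lerDr//.
by rewrite mulrAC ler_pdivlMr.
Qed.
End DropCoordinate.

Section Graph.
Context (R : realType) (n : nat) (M : smooth_manifold R n).
Variables (X N : M -> 'rV[R]_n.+1) (K : R).
Hypothesis hconn : connected [set: M].
Hypothesis hX : smooth_immersion X.
Hypothesis hN : unit_normal_field X N.
Hypothesis K0 : 0 <= K.
Hypothesis hA : forall p, shape_sqnorm X N p <= K ^+ 2.
Variables (i : 'I_n.+1) (c0 : R).
Hypothesis c00 : 0 < c0.

Definition proj (q : M) : 'rV[R]_n := drop_coord i (X q).
(** The points near which the hypersurface is a graph over the i-th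
    coordinate hyperplane, with a slope controlled by c0. *)
Definition graphical : set M := [set q | c0 < `|N q 0 i|].

(* the constant of [tangent_drop_coord] *)
Let c1 : R := 1 + n%:R / c0.

Lemma c1_ge1 : 1 <= c1.
Proof. by rewrite lerDl divr_ge0// ltW. Qed.

Lemma proj_continuous : continuous proj.
Proof.
move=> q; apply: (@cvg_comp _ _ _ X (drop_coord i) _ (nbhs (X q))).
  exact: (immersion_continuous hX).
exact: drop_coord_continuous.
Qed.

Lemma graphical_open q : graphical q -> \forall q' \near q, graphical q'.
Proof.
move=> gq.
have H : `|N q' 0 i| @[q' --> q] --> `|N q 0 i|.
  apply: cvg_norm; have /cvg_rowP := normal_continuous hN (x:=q); exact.
have /cvgrPdist_lt/(_ (`|N q 0 i| - c0)) := H.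
rewrite subr_gt0 => /(_ gq); apply: filterS => q'.
by rewrite /graphical/= ltr_distlC => /andP[]; rewrite subKr.
Qed.

Let pmx (c : chart R n M) x : 'M[R]_n :=
  \matrix_(k, j) partial_mx (X \o param c) x k (lift i j).

Lemma proj_strict (c : chart R n M) x : atlas c -> cimg c x ->
  forall e : R, 0 < e -> exists2 d : R, 0 < d & forall y z : 'rV[R]_n,
    `|y - x| < d -> `|z - x| < d ->
    `|proj (param c z) - proj (param c y) - (z - y) *m pmx c x| <= e * `|z - y|.
Proof.
move=> ac xc e e0.
have [d d0 dP] := C1_strict (cimg_open (c:=c)) xc (patch_C hX 1 ac) e0.
exists d => // y z yd zd; rewrite -drop_coord_mul -!drop_coordB.
exact: le_trans (drop_coord_norm _ _) (dP y z yd zd).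
Qed.

Lemma tangent_bound q (v : 'rV[R]_n) : graphical q ->
  `|v *m partial_mx (X \o param (chart_at q)) (coord_at q)| <=
    c1 * `|v *m pmx (chart_at q) (coord_at q)|.
Proof.
move=> gq; rewrite -drop_coord_mul.
have ac := chart_at_atlas q; have qc := chart_at_dom q.
apply: (tangent_drop_coord c00 (normal_unit hN q)) => //.
have := normal_frame hN ac (cimg_coord qc); rewrite coordK// => NJ.
by rewrite dotC dotE trmx_mul mulmxA NJ mul0mx mxE.
Qed.

Lemma pmx_free q : graphical q -> row_free (pmx (chart_at q) (coord_at q)).
Proof.
move=> gq; rewrite -kermx_eq0; apply/negPn/negP => /rowV0Pn[v /sub_kermxP vP v0].
have ac := chart_at_atlas q; have qc := chart_at_dom q.
have := tangent_bound v gq; rewrite vP normr0 mulr0 normr_le0 => /eqP vJ.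
have /row_freeP[L JL] := patch_free hX ac (cimg_coord qc).
by move/eqP: v0; apply; rewrite -[v]mulmx1 -JL mulmxA vJ mul0mx.
Qed.

Lemma proj_expanding q : graphical q ->
  exists2 m : R, 0 < m & exists2 d : R, 0 < d & forall y z : 'rV[R]_n,
    `|y - coord_at q| < d -> `|z - coord_at q| < d ->
    m * `|z - y| <= `|proj (param (chart_at q) z) - proj (param (chart_at q) y)|.
Proof.
move=> gq.
have ac := chart_at_atlas q; have qc := chart_at_dom q.
apply: (@strict_expanding _ _ _ (proj \o param (chart_at q)) _ _ (pmx_free gq)).
exact: proj_strict ac (cimg_coord qc).
Qed.

Lemma proj_locally_injective q : graphical q -> locally_injective_at proj q.
Proof.
move=> gq; have [m m0 [d d0 dP]] := proj_expanding gq.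
exists [set q' | cdom (chart_at q) q' /\ `|coord (chart_at q) q' - coord_at q| < d].
  exact: chart_nbhs.
move=> a b [ac ad] [bc bd] E.
have := dP _ _ ad bd; rewrite !coordK// E subrr normr0 pmulr_rle0// normr_le0 subr_eq0.
by move=> /eqP ab; rewrite -(coordK ac) -(coordK bc) ab.
Qed.

Lemma proj_local_section q : graphical q ->
  exists s, exists2 e : R, 0 < e &
    section_on proj graphical s (proj q) e /\ s (proj q) = q.
Proof.
move=> gq; pose c := chart_at q; pose x0 := coord_at q.
have ac : atlas c := chart_at_atlas q; have qc : cdom c q := chart_at_dom q.
have xc : cimg c x0 := cimg_coord qc.
have px : param c x0 = q by exact: coordK.
have [m m0 [d d0 dP]] := proj_expanding gq.
have ng : \forall x \near x0, graphical (param c x).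
  by apply: (param_continuous xc); rewrite px; exact: graphical_open.
have [d1 d10 d1P] := near_both (near_cimg xc) ng.
have D0 : 0 < Num.min d d1 by rewrite lt_min d0.
have Fc : exists2 d2 : R, 0 < d2 & forall x, `|x - x0| < d2 ->
    {for x, continuous (proj \o param c)}.
  exists d1; first exact: d10.
  move=> x xd1; have [xci _] := d1P x xd1.
  apply: (@cvg_comp _ _ _ (param c) proj _ (nbhs (param c x))).
    exact: param_continuous.
  exact: proj_continuous.
have [r r0 rP] := strict_onto (pmx_free gq) (proj_strict ac xc) Fc D0.
have /(_ _)/cid2-/all_sig2[xi xi1 xi2] : forall y, exists2 x,
    (`|y - proj q| < r -> `|x - x0| < Num.min d d1) &
    (`|y - proj q| < r -> proj (param c x) = y).
  move=> y; have [yr|_] := boolP (`|y - proj q| < r); last by exists x0.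
  by have [|x xd xy] := rP y; [rewrite /= px|exists x].
have xid y : `|y - proj q| < r -> `|xi y - x0| < d.
  by move=> /xi1; rewrite lt_min => /andP[].
have xid1 y : `|y - proj q| < r -> `|xi y - x0| < d1.
  by move=> /xi1; rewrite lt_min => /andP[].
exists (param c \o xi), r => //; split.
  move=> y yr; have [xci gx] := d1P _ (xid1 y yr).
  split => //=; first exact: xi2.
  apply: (@cvg_comp _ _ _ xi (param c) _ (nbhs (xi y))); last exact: param_continuous.
  apply/(@continuous_normP R 'rV[R]_n 'rV[R]_n) => e e0.
  exists (Num.min (m * e) (r - `|y - proj q|)) => [|z].
    by rewrite lt_min mulr_gt0// subr_gt0.
  rewrite lt_min => /andP[z1 z2].
  have zr : `|z - proj q| < r.
    rewrite -(subrK y z) -addrA (le_lt_trans (ler_normD _ _))//.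
    by rewrite -ltrBrDr.
  rewrite -(ltr_pM2l m0); apply: le_lt_trans z1.
  have := dP _ _ (xid _ yr) (xid _ zr).
  by rewrite !xi2.
have pr : `|proj q - proj q| < r by rewrite subrr normr0.
have z : `|x0 - x0| < d by rewrite subrr normr0.
have := dP _ _ z (xid _ pr); rewrite xi2// px subrr normr0 pmulr_rle0//.
by rewrite normr_le0 subr_eq0 /= => /eqP ->.
Qed.

(* Length of a short segment compared with its projection: the factor n + 1
   passes from the sup norm to the Euclidean norm, c1 + c1 comes from the
   projection up to a factor 2 in the first order expansion, and 1 from the
   variation of the derivative along the segment. *)
Let L0 : R := n.+1%:R * (c1 + c1 + 1).

Lemma L0_ge0 : 0 <= L0.
Proof.
have c10 : 0 <= c1 := le_trans ler01 c1_ge1.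
apply: mulr_ge0 => //; apply: addr_ge0 => //; exact: addr_ge0.
Qed.

(** Infinitesimal comparison of the intrinsic distance, and of the variation
    of the normal, with the flat projection. The neighbourhood depends on q,
    as it has to make the first order errors small compared with the
    expansion constant of the chart at q, but the constants do not. *)
Lemma proj_lipschitz q : graphical q ->
  \forall q' \near q,
    [/\ dist X q q' <= 2 * L0 * `|proj q' - proj q|,
        dist X q' q <= 2 * L0 * `|proj q' - proj q| &
        `|N q' 0 i - N q 0 i| <= (K * L0 + 1) * `|proj q' - proj q|].
Proof.
move=> gq; pose c := chart_at q; pose x0 := coord_at q.
have ac : atlas c := chart_at_atlas q; have qc : cdom c q := chart_at_dom q.
have xc : cimg c x0 := cimg_coord qc.
have px : param c x0 = q by exact: coordK.
have [m m0 [d d0 dP]] := proj_expanding gq.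
have [d1 d10 d1P] := proj_strict ac xc m0.
have [d2 d20 d2P] := C1_partial_continuous xc (patch_C hX 1 ac) m0.
have dnu := normal_differentiable hX hN ac xc.
have [d3 d30 d3P] := differentiable_bound dnu m0.
have [d4 d40 d4P] := near_both (near_cimg xc) (near_cimg xc).
pose D := Num.min (Num.min (d / 2) (d1 / 2)) (Num.min (d2 / 2) (Num.min (d3 / 2) (d4 / 2))).
have D0 : 0 < D by rewrite !lt_min !divr_gt0.
apply: filterS (chart_nbhs q D0) => q' [q'c].
rewrite -/c; set x' := coord c q'; rewrite -[coord c q]/x0.
rewrite !lt_min => /andP[/andP[xd xd1] /andP[xd2 /andP[xd3 xd4]]].
set V := x' - x0 in xd xd1 xd2 xd3 xd4.
have px' : param c x' = q' by exact: coordK.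
have half (a b : R) : 0 < b -> a < b / 2 -> a < b by move=> b0 ab; lra.
have zd (e : R) : 0 < e -> `|x0 - x0| < e by rewrite subrr normr0.
have mV : m * `|V| <= `|proj q' - proj q|.
  by have := dP x0 x' (zd _ d0) (half _ _ d0 xd); rewrite px px'.
set f := `|proj q' - proj q| in mV *.
have VP : `|V *m pmx c x0| <= f + f.
  have := d1P x0 x' (zd _ d10) (half _ _ d10 xd1); rewrite px px' -/V => H.
  rewrite -[V *m _](subKr (proj q' - proj q)).
  apply: (le_trans (ler_normB _ _)); rewrite lerD2l.
  exact: le_trans H mV.
have VJ : `|V *m partial_mx (X \o param c) x0| <= (c1 + c1) * f.
  apply: (le_trans (tangent_bound V gq)).
  rewrite (_ : (c1 + c1) * f = c1 * (f + f)); last by ring.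
  by apply: ler_wpM2l => //; rewrite (le_trans _ c1_ge1).
have f0 : 0 <= f := normr_ge0 _.
have VJx x : `|x - x0| < d2 ->
    enorm (V *m partial_mx (X \o param c) x) <= L0 * f.
  move=> xd2'; apply: (le_trans (enorm_le_norm _)); rewrite /L0 -mulrA.
  apply: ler_wpM2l => //.
  rewrite -[V *m _](subrK (V *m partial_mx (X \o param c) x0)).
  apply: (le_trans (ler_normD _ _)); rewrite addrC mulrDl mul1r lerD//.
  exact: le_trans (d2P x V xd2') mV.
have sc (y : 'rV[R]_n) (a : R) (s : R) : `|y - x0| < a / 2 -> 0 < a -> `|s| <= 1 ->
   forall W, `|W| = `|V| -> `|V| < a / 2 -> `|y + s *: W - x0| < a.
  move=> ya a0 s1 W WV Va; rewrite addrAC (le_lt_trans (ler_normD _ _))//.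
  rewrite normrZ WV; have : `|s| * `|V| <= `|V| by rewrite ler_piMl.
  lra.
split.
- have [||l H1 H2] := @chart_segment _ _ _ X hX c x0 V (L0 * f) ac.
  + move=> s s1; have xs : `|x0 + s *: V - x0| < d4.
      by apply: sc => //; apply: zd; rewrite divr_gt0.
    by have [] := d4P _ xs.
  + move=> s s1; apply: VJx.
    by apply: sc => //; apply: zd; rewrite divr_gt0.
  rewrite px /V addrC subrK px' in H1.
  rewrite -mulrA; exact: le_trans (dist_le H1) H2.
- have VN : `|- V| = `|V| by rewrite normrN.
  have [||l H1 H2] := @chart_segment _ _ _ X hX c x' (- V) (L0 * f) ac.
  + move=> s s1; have xs : `|x' + s *: (- V) - x0| < d4 by apply: sc.
    by have [] := d4P _ xs.
  + move=> s s1; rewrite mulNmx -scaleN1r enormZ normrN normr1 mul1r; apply: VJx.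
    by apply: sc.
  rewrite px' /V opprB addrC subrK px in H1.
  rewrite -mulrA; exact: le_trans (dist_le H1) H2.
- have /d3P : `|V| < d3 by exact: half.
  have xV : x0 + V = x' by rewrite addrC subrK.
  rewrite xV /= px px' => H.
  have L0f : 0 <= L0 * f by exact: (mulr_ge0 L0_ge0 f0).
  have KL0f : 0 <= K * (L0 * f) by exact: mulr_ge0.
  have DN : `|'D_V (N \o param c) x0| <= K * (L0 * f).
    apply: (le_trans (norm_le_enorm _)).
    rewrite -ler_sqr ?nnegrE ?enorm_ge0//.
    rewrite exprMn enorm_sqr.
    apply: (le_trans (normal_deriv_bound hX hN ac xc V)).
    apply: (le_trans (ler_wpM2r (dot_ge0 _) (hA q))).
    apply: ler_wpM2l; first exact: sqr_ge0.
    rewrite -enorm_sqr ler_sqr ?nnegrE ?enorm_ge0//.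
    by apply: VJx; exact: zd.
  have NV : `|N q' - N q| <= K * (L0 * f) + f.
    rewrite -(subrK ('D_V (N \o param c) x0) (N q' - N q)).
    apply: (le_trans (ler_normD _ _)); rewrite [leRHS]addrC.
    exact: (lerD (le_trans H mV) DN).
  rewrite mulrDl mul1r -mulrA; apply: le_trans NV.
  by have := coord_le_norm (N q' - N q) i; rewrite !mxE.
Qed.

(* Lipschitz constant of the normal: K bounds the shape operator, and 1 covers
   the first order error. *)
Let L1 : R := K * L0 + 1.

Lemma L1_gt0 : 0 < L1.
Proof. by rewrite ltr_wpDl// mulr_ge0// L0_ge0. Qed.

Lemma section_lipschitz s c a y y' :
  section_on proj graphical s c a -> `|y - c| < a -> `|y' - c| < a ->
  dist X (s y) (s y') <= 2 * L0 * `|y' - y| /\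
  `|N (s y) 0 i - N (s y') 0 i| <= L1 * `|y' - y|.
Proof.
move=> sec ya y'a; pose z (t : R) := y + t *: (y' - y).
have zsec t : 0 <= t <= 1 ->
    [/\ proj (s (z t)) = z t, {for z t, continuous s} & graphical (s (z t))].
  by move=> tI; apply: sec; exact: segment_in_ball.
have z0 : z 0 = y by rewrite /z scale0r addr0.
have z1 : z 1 = y' by rewrite /z scale1r addrC subrK.
have loc t : 0 <= t <= 1 -> exists2 d : R, 0 < d & forall u, `|u - t| < d ->
    0 <= u <= 1 ->
    [/\ dist X (s (z t)) (s (z u)) <= 2 * L0 * `|y' - y| * `|u - t|,
       dist X (s (z u)) (s (z t)) <= 2 * L0 * `|y' - y| * `|u - t| &
       `|N (s (z u)) 0 i - N (s (z t)) 0 i| <= L1 * `|y' - y| * `|u - t|].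
  move=> tI; have [Ft ct gt] := zsec t tI.
  have nt := segment_continuous ct (proj_lipschitz gt).
  have [d d0 dP] := near_both nt nt.
  exists d => // u ud uI; have [[H1 H2 H3] _] := dP u ud.
  have [Fu _ _] := zsec u uI.
  have E : `|proj (s (z u)) - proj (s (z t))| = `|y' - y| * `|u - t|.
    by rewrite Fu Ft /z opprD addrACA subrr add0r -scalerBl normrZ mulrC.
  rewrite -/(z u) -/(z t) E mulrA in H1.
  rewrite -/(z u) -/(z t) E mulrA in H2.
  by rewrite -/(z u) -/(z t) E mulrA in H3.
split.
- have := @local_lipschitz _ (fun t u => dist X (s (z t)) (s (z u)))
    (2 * L0 * `|y' - y|) _ _ _ 1.
  rewrite ler01 lexx z0 z1 mulr1; apply=> //.
  + by move=> a' b' c'; exact: (dist_triangle hX hconn).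
  + by rewrite dist_refl.
  + by move=> t /loc[d d0 dP]; exists d => // u ud uI; have [] := dP u ud uI.
- have := @local_lipschitz _ (fun t u => `|N (s (z t)) 0 i - N (s (z u)) 0 i|)
    (L1 * `|y' - y|) _ _ _ 1.
  rewrite ler01 lexx z0 z1 mulr1; apply=> //.
  + move=> a' b' c'; rewrite -[X in X - _](subrK (N (s (z b')) 0 i)) -addrA.
    exact: ler_normD.
  + by rewrite subrr normr0.
  + move=> t /loc[d d0 dP]; exists d => // u ud uI; have [_ _ H] := dP u ud uI.
    by split=> //; rewrite distrC.
Qed.

Hypothesis hcomplete : complete_hypersurface X.
Variables (p : M) (rho : R).
Hypothesis Np : 2 * c0 < `|N p 0 i|.
Hypothesis rho0 : 0 < rho.
Hypothesis rhoc : L1 * rho <= c0 / 2.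

(** The section is Lipschitz from the ball to the complete space M, so it
    has a limit q along radial segments; q is still graphical since the i-th
    coordinate of the normal, more than 2 c0 at p, loses at most L1 rho <=
    c0 / 2. *)
Lemma section_complete s a z : 0 < a <= rho ->
  section_on proj graphical s (proj p) a -> s (proj p) = p ->
  `|z - proj p| <= a ->
  exists2 q, graphical q & s (radial proj p z k) @[k --> \oo] --> q.
Proof.
move=> /andP[a0 arho] sec sp za; pose y k := radial proj p z k.
have ya k : `|y k - proj p| < a by exact: radial_lt.
have yz : y k @[k --> \oo] --> z by exact: radial_cvg.
have lip k l := section_lipschitz sec (ya k) (ya l).
have pa : `|proj p - proj p| < a by rewrite subrr normr0.
have C0 : 0 < 2 * L0 + 1 by rewrite ltr_wpDl// mulr_ge0// L0_ge0.
have [|q qlim] := hcomplete (x := fun k => s (y k)).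
  move=> e e0.
  have e2 : 0 < e / (2 * L0 + 1) / 2 by rewrite !divr_gt0.
  have /cvgrPdist_lt/(_ _ e2)[k0 _ k0P] := yz.
  exists k0 => k l kk kl; have [H _] := lip k l; apply: (le_lt_trans H).
  have ykl : `|y l - y k| < e / (2 * L0 + 1).
    rewrite -(subrK z (y l)) -addrA (le_lt_trans (ler_normD _ _))//.
    rewrite [ltRHS]splitr ltrD//; last exact: k0P.
    by rewrite distrC; exact: k0P.
  rewrite ltr_pdivlMr// in ykl; apply: le_lt_trans ykl.
  by rewrite mulrC ler_wpM2l// lerDl.
have sq : s (y k) @[k --> \oo] --> q.
  move=> W nW; have [e e0 eP] := dist_nbhs hX nW hconn.
  have /cvgrPdist_lt/(_ e e0) := qlim.
  apply: filterS => k; rewrite sub0r normrN => H.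
  by apply: eP; apply: le_lt_trans H; exact: ler_norm.
exists q => //.
have Nk k : 3 / 2 * c0 <= `|N (s (y k)) 0 i|.
  have [_ H] := section_lipschitz sec pa (ya k); rewrite sp in H.
  have H2 : L1 * `|y k - proj p| <= c0 / 2.
    apply: le_trans rhoc; apply: ler_wpM2l; first exact: ltW L1_gt0.
    exact: le_trans (ltW (ya k)) arho.
  have H3 := lerB_dist (N p 0 i) (N (s (y k)) 0 i).
  have H4 := le_trans H H2; have Np' := Np.
  move: H3 H4 Np'; move: `|N p 0 i - _| `|N p 0 i| `|N _ 0 i| => r1 r2 r3; lra.
have NL : `|N (s (y k)) 0 i| @[k --> \oo] --> `|N q 0 i|.
  apply: cvg_norm.
  have H : N (s (y k)) @[k --> \oo] --> N q.
    apply: (@cvg_comp _ _ _ (fun k => s (y k)) N _ (nbhs q)) => //.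
    exact: (normal_continuous hN).
  by have /cvg_rowP := H; exact.
have : 3 / 2 * c0 <= `|N q 0 i|.
  rewrite leNgt; apply/negP => lt.
  have /cvgrPdist_lt/(_ (3 / 2 * c0 - `|N q 0 i|)) := NL.
  rewrite subr_gt0 => /(_ lt)[k0 _ /(_ k0 (leqnn _))] /=.
  rewrite ltr_distl => /andP[+ _]; have := Nk k0; lra.
rewrite /graphical/=; have := c00; lra.
Qed.

Lemma graph_section :
  exists2 s, section_on proj graphical s (proj p) rho & s (proj p) = p.
Proof.
apply: section_exists => //.
- exact: (@manifold_hausdorff _ _ M).
- exact: proj_continuous.
- exact: proj_locally_injective.
- exact: proj_local_section.
- rewrite /graphical/=; have := c00; have := Np; lra.
- by move=> s a z ar sec sp za; exact: section_complete ar sec sp za.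
Qed.
End Graph.

(** Uniform graph property. Some coordinate of the unit normal at p is at
    least 1 / (n + 1) in absolute value. The bound on the second fundamental
    form makes it stay away from 0 at the points of the sheet through p
    whose projection along that coordinate is within rho of that of p, with
    rho depending on n and K only. Where it does not vanish the projection
    is a local homeomorphism, and completeness lets a section of it be
    continued up to distance rho. *)
Lemma uniform_graph (R : realType) (n : nat) (M : smooth_manifold R n)
    (X N : M -> 'rV[R]_n.+1) (K : R) :
  connected [set: M] -> smooth_immersion X -> unit_normal_field X N ->
  complete_hypersurface X -> 0 <= K -> (forall p, shape_sqnorm X N p <= K ^+ 2) ->
  exists2 rho : R, 0 < rho & forall p : M, exists i, exists G s,
    [/\ section_on (proj X i) G s (proj X i p) rho, s (proj X i p) = p &
        forall q, G q -> locally_injective_at (proj X i) q].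
Proof.
move=> hconn hX hN hcomplete K0 hA.
pose c0 : R := (4 * n.+1%:R)^-1.
have c00 : 0 < c0 by rewrite invr_gt0 mulr_gt0.
pose L1 : R := K * (n.+1%:R * ((1 + n%:R / c0) + (1 + n%:R / c0) + 1)) + 1.
have L10 : 0 < L1 by exact: L1_gt0.
pose rho := c0 / 2 / L1.
have rho0 : 0 < rho by rewrite !divr_gt0.
exists rho => // p.
have [i Ni] : exists i, 2 * c0 < `|N p 0 i|.
  apply: contrapT => no; have : `|N p| <= 2 * c0.
    apply: normrV_le => [|i]; first by rewrite mulr_ge0// ltW.
    by rewrite leNgt; apply/negP => lt; apply: no; exists i.
  have := enorm_le_norm (N p); rewrite /enorm (normal_unit hN) sqrtr1 => H1 H2.
  have : 1 <= n.+1%:R * (2 * c0) by apply: (le_trans H1); exact: ler_wpM2l.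
  rewrite (_ : _ * _ = 2^-1); first by lra.
  by rewrite /c0; field.
have rhoc : L1 * rho <= c0 / 2 by rewrite mulrC divfK// gt_eqF.
have [s sec sp] := graph_section hconn hX hN K0 hA c00 hcomplete Ni rho0 rhoc.
exists i, (graphical N i c0), s; split => // q.
exact: proj_locally_injective.
Qed.

(** * Derivative tests and the Hessian *)

(** If h2 were positive, h' would be positive on a small interval on the
    right of 0 and h would increase there. *)
Lemma max_second_derivative (R : realType) (h h' : R -> R) (h2 d : R) :
  0 < d -> (forall t : R, `|t| < d -> is_derive t 1 h (h' t)) ->
  is_derive (0 : R) 1 h' h2 -> (forall t, `|t| < d -> h t <= h 0) ->
  h' 0 = 0 /\ h2 <= 0.
Proof.
move=> d0 dh dh' hmax.
have h'0 : h' 0 = 0.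
  have d20 : 0 < d / 2 by rewrite divr_gt0.
  have inI t : t \in `](- (d / 2)), (d / 2)[%R -> `|t| < d.
    rewrite in_itv/= => /andP[t1 t2]; rewrite ltr_norml; apply/andP; split; lra.
  have [||||_ D0] := @derive1_at_max R h (- (d / 2)) (d / 2) 0.
  - lra.
  - by move=> t /inI/dh[].
  - by rewrite in_itv/= d20 oppr_lt0 d20.
  - by move=> t /inI/hmax.
  - by have [|_ D] := dh 0; rewrite ?normr0// -D.
split => //; rewrite leNgt; apply/negP => h20.
have [D1 D2] := dh'.
have /derivable1_diffP/differentiable_bound/(_ (h2 / 2)) := D1.
rewrite divr_gt0// => /(_ isT)[e e0 eP].
pose t := Num.min d e / 2.
have m0 : 0 < Num.min d e by rewrite lt_min d0.
have t0 : 0 < t by rewrite divr_gt0.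
have : t < Num.min d e by rewrite ltr_pdivrMr// mulr2n mulrDr mulr1 ltrDl.
rewrite lt_min => /andP[td te].
have pos s : 0 < s < e -> 0 < h' s.
  move=> /andP[s0 se]; have := eP s; rewrite gtr0_norm// => /(_ se).
  have DZ : 'D_s h' 0 = s * h2.
    have [_] := is_derive_scale s D1; rewrite D2 => <-.
    by congr ('D_ _ _ _); rewrite [s%:A]mulr1.
  rewrite add0r h'0 subr0 DZ ler_norml => /andP[+ _].
  have : 0 < s * h2 by rewrite mulr_gt0.
  lra.
have [||c] := @MVT _ h h' 0 t t0.
- move=> s; rewrite in_itv/= => /andP[s0 st]; apply: dh.
  by rewrite gtr0_norm// (lt_trans st).
- apply: derivable_within_continuous => s; rewrite in_itv/= => /andP[s0 st].
  have [|D _] := dh s; first by rewrite ger0_norm// (le_lt_trans st).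
  exact: D.
rewrite in_itv/= => /andP[c0 ct]; rewrite subr0 => E.
have : 0 < h t - h 0 by rewrite E mulr_gt0// pos// c0 (lt_trans ct).
by rewrite subr_gt0 ltNge hmax// gtr0_norm.
Qed.

Lemma sum_delta_mx (R : realType) (n : nat) (i : 'I_n) (F : 'I_n -> R) :
  \sum_j (delta_mx 0 i : 'rV[R]_n) 0 j * F j = F i.
Proof.
rewrite (bigD1 i)//= mxE !eqxx mul1r big1 ?addr0// => j ji.
by rewrite mxE eqxx/= (negbTE ji) mul0r.
Qed.

(** The one-variable test on the lines through x. The functions dw i are the
    partial derivatives of w, and S is the matrix of its second derivatives
    at x. *)
Lemma local_max_conditions (R : realType) (n : nat) (w : 'rV[R]_n -> R)
    (dw : 'I_n -> 'rV[R]_n -> R) (S : 'M[R]_n) (x : 'rV[R]_n) (d : R) :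
  0 < d ->
  (forall y v : 'rV[R]_n, `|y - x| < d -> is_derive y v w (\sum_i v 0 i * dw i y)) ->
  (forall (v : 'rV[R]_n) i, is_derive x v (dw i) (\sum_j v 0 j * S j i)) ->
  (forall y, `|y - x| < d -> w y <= w x) ->
  (forall i, dw i x = 0) /\ forall v, quad S v <= 0.
Proof.
move=> d0 dW ddW wmax.
have main (v : 'rV[R]_n) : \sum_i v 0 i * dw i x = 0 /\ quad S v <= 0.
  pose c := d / (`|v| + 1).
  have v1 : 0 < `|v| + 1 by rewrite ltr_wpDl.
  have c0 : 0 < c by rewrite divr_gt0.
  have small (t : R) : `|t| < c -> `|x + t *: v - x| < d.
    rewrite addrAC subrr add0r normrZ /c ltr_pdivlMr//.
    by apply: le_lt_trans; rewrite ler_wpM2l// lerDl.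
  have [|||] := @max_second_derivative R (fun t => w (x + t *: v))
      (fun t => \sum_i v 0 i * dw i (x + t *: v)) (quad S v) c c0.
  - by move=> t tc; apply: is_derive_line; apply: dW; exact: small.
  - have -> : quad S v = \sum_i v 0 i * (\sum_j v 0 j * S j i).
      rewrite /quad mxE; apply: eq_bigr => i _.
      by rewrite [v^T _ _]mxE [(v *m S) _ _]mxE mulrC.
    apply: is_derive_bigsum => i.
    have H : is_derive (0 : R) 1 (fun t : R => dw i (x + t *: v)) (\sum_j v 0 j * S j i).
      by apply: is_derive_line; rewrite scale0r addr0.
    have H2 := @is_derive_mul R R (cst (v 0 i)) (fun t : R => dw i (x + t *: v)) 0
      (\sum_j v 0 j * S j i) 0 1 (is_derive_cst _ _ _) H.
    by apply: (is_derive_eq H2); rewrite mul0r add0r.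
  - by move=> t tc; rewrite scale0r addr0; apply: wmax; exact: small.
  - rewrite (_ : \sum_i _ = \sum_i v 0 i * dw i x) => [H1 H2|]; first by split.
    by apply: eq_bigr => i _; rewrite scale0r addr0.
split => [i|v]; last by case: (main v).
have [+ _] := main (delta_mx 0 i).
by rewrite (sum_delta_mx i (fun j => dw j x)).
Qed.

Lemma sum_cancel (R : realType) (n : nat) (a t1 t2 : 'I_n -> R) :
  - (\sum_k a k * (t1 k + t2 k)) + \sum_k a k * t1 k = - \sum_k a k * t2 k.
Proof.
rewrite -sumrN -big_split/= -sumrN; apply: eq_bigr => k _; ring.
Qed.

Section Hessian.
Context (R : realType) (n : nat) (M : smooth_manifold R n).
Variable X : M -> 'rV[R]_n.+1.
Hypothesis hX : smooth_immersion X.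
Variables (c : chart R n M) (x : 'rV[R]_n).
Hypothesis ac : atlas c.
Hypothesis xc : cimg c x.
Let phi := X \o param c.

Let dd (i j : 'I_n) : 'rV[R]_n.+1 :=
  'D_(delta_mx 0 i) (fun y => 'D_(delta_mx 0 j) phi y) x.
Let d1 (j : 'I_n) : 'rV[R]_n.+1 := 'D_(delta_mx 0 j) phi x.
(* the Christoffel symbols of the first kind, by [christoffel_metric] *)
Let T i j l : R := dot (dd i j) (d1 l).

Lemma dd_sym i j : dd i j = dd j i.
Proof. exact: (C2_symmetric i j (cimg_open (c:=c)) xc (patch_C hX 2 ac)). Qed.

Lemma T_sym i j l : T i j l = T j i l.
Proof. exact: (congr1 (fun v => dot v (d1 l)) (dd_sym i j)). Qed.

Lemma metric_entry y j l :
  metric phi y j l = dot ('D_(delta_mx 0 j) phi y) ('D_(delta_mx 0 l) phi y).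
Proof. exact: mxE. Qed.

Lemma metric_deriv i j l :
  is_derive x (delta_mx 0 i) (fun y => metric phi y j l) (T i j l + T i l j).
Proof.
have dj k : derivable (fun y => 'D_(delta_mx 0 k) phi y) x (delta_mx 0 i).
  by apply: diff_derivable; exact: (proj1 (patch_deriv_diff hX ac xc k)).
have H := is_derive_dot (dj j) (dj l).
rewrite (_ : (fun y => metric phi y j l) =
  fun y => dot ('D_(delta_mx 0 j) phi y) ('D_(delta_mx 0 l) phi y)); last first.
  by apply/funext => y; exact: metric_entry.
apply: (is_derive_eq H); rewrite [X in _ + X]dotC.
by [].
Qed.

Lemma metric_differentiable j l : differentiable (fun y => metric phi y j l) x.
Proof.
rewrite (_ : (fun y => metric phi y j l) =
  fun y => dot ('D_(delta_mx 0 j) phi y) ('D_(delta_mx 0 l) phi y)); last first.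
  by apply/funext => y; exact: metric_entry.
apply: differentiable_bigsum => k; apply: differentiable_mul.
  exact: (differentiable_row _ (proj1 (patch_deriv_diff hX ac xc j))).
exact: (differentiable_row _ (proj1 (patch_deriv_diff hX ac xc l))).
Qed.

(** The Koszul formula expresses the Christoffel symbols, with the index
    lowered, by derivatives of the metric; in terms of the immersion only
    the tangential part of its second derivatives remains. *)
Lemma christoffel_metric i j l :
  \sum_k christoffel phi x k i j * metric phi x k l = T i j l.
Proof.
pose b m : R := 'D_(delta_mx 0 i) (fun y => metric phi y j m) x
     + 'D_(delta_mx 0 j) (fun y => metric phi y i m) x
     - 'D_(delta_mx 0 m) (fun y => metric phi y i j) x.
have bE m : b m = 2 * T i j m.
  rewrite /b.
  have [_ ->] := metric_deriv i j m; have [_ ->] := metric_deriv j i m.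
  have [_ ->] := metric_deriv m i j.
  rewrite (T_sym j i m) (T_sym m i j) (T_sym m j i).
  move: (T i j m) (T i m j) (T j m i) => r1 r2 r3; ring.
have ChE k : christoffel phi x k i j =
  2^-1 * \sum_m invmx (metric phi x) k m * b m by [].
move: b bE ChE => b bE ChE.
have gg m : \sum_k invmx (metric phi x) k m * metric phi x k l = (m == l)%:R.
  have := congr1 (fun A : 'M[R]_n => A l m) (mulmxV (metric_unit hX ac xc)).
  rewrite [LHS]mxE [RHS]mxE eq_sym => <-; apply: eq_bigr => k' _.
  by rewrite mulrC; congr (_ * _); rewrite -{1}metric_sym [LHS]mxE.
transitivity (\sum_m (2^-1 * b m) * (m == l)%:R); last first.
  rewrite (bigD1 l)//= eqxx mulr1 big1 ?addr0 => [|m ml].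
    by rewrite bE mulrA mulVf ?mul1r// pnatr_eq0.
  by rewrite (negbTE ml) mulr0.
transitivity (\sum_m \sum_k (2^-1 * b m) * (invmx (metric phi x) k m * metric phi x k l)).
  rewrite exchange_big; apply: eq_bigr => k _ /=.
  rewrite ChE mulr_sumr mulr_suml; apply: eq_bigr => m _.
  ring.
by apply: eq_bigr => m _; rewrite -mulr_sumr gg.
Qed.

Section Function.
Variable f : 'rV[R]_n -> R.
Hypothesis cf : C_on 2 (cimg c) f.

Lemma partial_diff_scalar j :
  differentiable (fun y => 'D_(delta_mx 0 j) f y) x /\
  forall v, 'D_v (fun y => 'D_(delta_mx 0 j) f y) x =
    \sum_i v 0 i * 'D_(delta_mx 0 i) (fun y => 'D_(delta_mx 0 j) f y) x.
Proof.
have [_ /(_ j)[_ C1]] := cf.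
exact: (C1_diff_scalar (cimg_open (c:=c)) xc C1).
Qed.

Lemma patch_grad_metric y : cimg c y ->
  patch_grad phi f y *m metric phi y = \row_j 'D_(delta_mx 0 j) f y.
Proof. by move=> yc; rewrite /patch_grad mulmxKV// (metric_unit hX ac yc). Qed.

Lemma patch_grad_differentiable k :
  differentiable (fun y => patch_grad phi f y 0 k) x.
Proof.
rewrite /patch_grad; under eq_fun do rewrite mxE.
apply: differentiable_bigsum => j; apply: differentiable_mul.
  by under eq_fun do rewrite mxE; exact: (proj1 (partial_diff_scalar j)).
apply: differentiable_invmx; first by move=> a b; exact: metric_differentiable.
exact: (metric_unit hX ac xc).
Qed.

(** Differentiating the equation that defines the gradient, with the index
    lowered. *)
Lemma patch_grad_deriv i l :
  \sum_k 'D_(delta_mx 0 i) (fun y => patch_grad phi f y 0 k) x * metric phi x k l =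
  'D_(delta_mx 0 i) (fun y => 'D_(delta_mx 0 l) f y) x -
  \sum_k patch_grad phi f x 0 k * (T i k l + T i l k).
Proof.
have dV k : is_derive x (delta_mx 0 i) (fun y => patch_grad phi f y 0 k)
    ('D_(delta_mx 0 i) (fun y => patch_grad phi f y 0 k) x).
  by apply: derivableP; apply: diff_derivable; exact: patch_grad_differentiable.
have H : is_derive x (delta_mx 0 i)
    (fun y => \sum_k patch_grad phi f y 0 k * metric phi y k l)
    (\sum_k ('D_(delta_mx 0 i) (fun y => patch_grad phi f y 0 k) x * metric phi x k l
       + patch_grad phi f x 0 k * (T i k l + T i l k))).
  apply: is_derive_bigsum => k; apply: (is_derive_mul (dV k)).
  exact: metric_deriv.
have E : \forall y \near x,
    \sum_k patch_grad phi f y 0 k * metric phi y k l = 'D_(delta_mx 0 l) f y.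
  apply: filterS (near_cimg xc) => y yc.
  have /rowP/(_ l) := patch_grad_metric yc.
  by rewrite [RHS]mxE => <-; rewrite mxE.
have [_] := near_eq_is_derive E H; rewrite big_split/= => ->.
by rewrite addrK.
Qed.

Lemma patch_hessE i k : patch_hess phi f x i k =
  'D_(delta_mx 0 i) (fun y => patch_grad phi f y 0 k) x +
  \sum_j christoffel phi x k i j * patch_grad phi f x 0 j.
Proof.
have -> : patch_hess phi f x i k = cov phi (delta_mx 0 i) (patch_grad phi f) x 0 k.
  exact: mxE.
rewrite /cov mxE.
exact: (sum_delta_mx i (fun i' => 'D_(delta_mx 0 i') (fun y => patch_grad phi f y 0 k) x
  + \sum_j christoffel phi x k i' j * patch_grad phi f x 0 j)).
Qed.

(** Of the two terms in each derivative of the metric, the Christoffel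
    symbols cancel one. *)
Lemma hess_metric i l : (patch_hess phi f x *m metric phi x) i l =
  'D_(delta_mx 0 i) (fun y => 'D_(delta_mx 0 l) f y) x -
  dot (dd i l) (patch_grad phi f x *m partial_mx phi x).
Proof.
rewrite mxE.
transitivity (\sum_k ('D_(delta_mx 0 i) (fun y => patch_grad phi f y 0 k) x *
    metric phi x k l + \sum_j patch_grad phi f x 0 j *
      (christoffel phi x k i j * metric phi x k l))).
  apply: eq_bigr => k _; rewrite patch_hessE mulrDl; congr (_ + _).
  by rewrite mulr_suml; apply: eq_bigr => j _; ring.
rewrite big_split/= patch_grad_deriv exchange_big/=.
rewrite -addrA; congr (_ + _).
have -> : \sum_j \sum_k patch_grad phi f x 0 j *
     (christoffel phi x k i j * metric phi x k l) =
    \sum_j patch_grad phi f x 0 j * T i j l.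
  by apply: eq_bigr => j _; rewrite -mulr_sumr christoffel_metric.
have -> : dot (dd i l) (patch_grad phi f x *m partial_mx phi x) =
    \sum_k patch_grad phi f x 0 k * T i l k.
  rewrite mul_partial_mx dotC dot_suml.
  by apply: eq_bigr => k _; rewrite [dot _ (dd i l)]dotC.
exact: (sum_cancel _ (fun k => T i k l) (fun k => T i l k)).
Qed.
End Function.
End Hessian.

(** * Comparison with a quadratic at a local maximum *)

Lemma dot_scaled_sum (R : realType) (n m : nat) (a : 'I_n -> R)
    (w : 'I_n -> 'rV[R]_m) (d : 'rV[R]_m) (k : R) :
  dot d (k *: \sum_i a i *: w i) = k * \sum_i a i * dot (w i) d.
Proof. by rewrite dotZr dotC dot_suml. Qed.

Lemma dot_tangent_le (R : realType) (m : nat) (z nu : 'rV[R]_m) :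
  dot nu nu = 1 -> dot (z - dot z nu *: nu) (z - dot z nu *: nu) <= dot z z.
Proof.
move=> nn; rewrite !(dotBl, dotBr, dotZl, dotZr) nn (dotC nu z).
have := sqr_ge0 (dot z nu); rewrite expr2 mulr1; lra.
Qed.

Lemma mxtrace_combination (R : realType) (n : nat) (S g h P : 'M[R]_n) (k t : R) :
  g \in unitmx ->
  \tr ((S + k *: g + t *: h) *m invmx g *m P) =
  \tr (S *m (invmx g *m P)) + k * \tr P + t * \tr (h *m invmx g *m P).
Proof.
move=> ug; rewrite !mulmxDl !linearD/= -!scalemxAl !mxtraceZ.
by rewrite mulmxV// mul1mx mulmxA.
Qed.

Lemma dot_comparison (R : realType) (m : nat) (d v w : 'rV[R]_m) (al eta : R) :
  dot d (2 *: (al *: v + eta *: w)) = al * 2 * dot d v + eta * 2 * dot d w.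
Proof. by rewrite dotZr dotDr !dotZr; ring. Qed.

Lemma C2_C1 (R : realType) (n : nat) (W : normedModType R)
    (U : set 'rV[R]_n) (f : 'rV[R]_n -> W) : C_on 2 U f -> C_on 1 U f.
Proof.
move=> [c0 cd]; split; first exact: c0.
by move=> i; have [d [c1 _]] := cd i; split; [exact: d|split; [exact: c1|]].
Qed.

Section MaxPoint.
Context (R : realType) (n : nat) (M : smooth_manifold R n).
Variables (X N : M -> 'rV[R]_n.+1).
Hypothesis hX : smooth_immersion X.
Hypothesis hN : unit_normal_field X N.
Variables (u : M -> R) (p : M) (al eta : R) (a : 'rV[R]_n.+1).
Hypothesis hu : C_manifold 2 u.
Hypothesis umax : \forall q \near p,
  u q - al * dot (X q) (X q) - eta * dot (X q - a) (X q - a) <=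
  u p - al * dot (X p) (X p) - eta * dot (X p - a) (X p - a).

Let c := chart_at p.
Let x := coord_at p.
Let ac : atlas c := chart_at_atlas p.
Let pc : cdom c p := chart_at_dom p.
Let xc : cimg c x := cimg_coord pc.
Let phi := X \o param c.
Let nu := N \o param c.
Let f := u \o param c.
Let J := partial_mx phi x.
Let g := metric phi x.
Let h := second_form X N c x.

Let Zf (y : 'rV[R]_n) : 'rV[R]_n.+1 := 2 *: (al *: phi y + eta *: (phi y - a)).

(** The Euclidean gradient at X p of y |-> al |y|^2 + eta |y - a|^2. *)
Definition comparison_grad : 'rV[R]_n.+1 := 2 *: (al *: X p + eta *: (X p - a)).
Let Z := comparison_grad.

Let phix : phi x = X p. Proof. by rewrite /phi/= /x /coord_at coordK. Qed.
Let nux : nu x = N p. Proof. by rewrite /nu/= /x /coord_at coordK. Qed.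
Let Zx : Zf x = Z. Proof. by rewrite /Zf phix. Qed.
Let cf : C_on 2 (cimg c) f. Proof. exact: hu. Qed.

(* first and second partial derivatives, in the chart at p, of the difference of
   u and of the quadratic function *)
Let dw (i : 'I_n) (y : 'rV[R]_n) : R :=
  'D_(delta_mx 0 i) f y - dot ('D_(delta_mx 0 i) phi y) (Zf y).

Let S : 'M[R]_n := \matrix_(j, i)
  ('D_(delta_mx 0 j) (fun y => 'D_(delta_mx 0 i) f y) x
   - (dot ('D_(delta_mx 0 j) (fun y => 'D_(delta_mx 0 i) phi y) x) Z
      + 2 * (al + eta) * g j i)).

Let SE j i : S j i = 'D_(delta_mx 0 j) (fun y => 'D_(delta_mx 0 i) f y) x
   - (dot ('D_(delta_mx 0 j) (fun y => 'D_(delta_mx 0 i) phi y) x) Z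
      + 2 * (al + eta) * g j i).
Proof. exact: mxE. Qed.

Let w (y : 'rV[R]_n) : R :=
  f y - al * dot (phi y) (phi y) - eta * dot (phi y - a) (phi y - a).

Let phi_derivable y v : cimg c y -> derivable phi y v.
Proof. by move=> yc; apply: diff_derivable; exact: (proj1 (patch_diff hX ac yc)). Qed.

Lemma is_derive_quadratic y v b : cimg c y ->
  is_derive y v (fun z => dot (phi z - b) (phi z - b))
    (2 * dot ('D_v phi y) (phi y - b)).
Proof.
move=> yc; have D : is_derive y v (fun z => phi z - b) ('D_v phi y).
  have H := is_deriveB (derivableP (@phi_derivable y v yc)) (is_derive_cst b y v).
  by apply: (is_derive_eq H); rewrite subr0.
have [D1 D2] := D; have H := is_derive_dot D1 D1.
by apply: (is_derive_eq H); rewrite D2 [dot (phi y - b) _]dotC; ring.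
Qed.

Lemma comparison_deriv y v : cimg c y -> is_derive y v w (\sum_i v 0 i * dw i y).
Proof.
move=> yc.
have C1f := C2_C1 cf.
have [df Df] := C1_diff_scalar (cimg_open (c:=c)) yc C1f.
have Hf : is_derive y v f ('D_v f y) by apply: derivableP; exact: diff_derivable.
have H0 : is_derive y v (fun z => dot (phi z) (phi z)) (2 * dot ('D_v phi y) (phi y)).
  have := @is_derive_quadratic y v 0 yc; rewrite subr0.
  by under eq_fun do rewrite subr0.
have H1 := @is_derive_quadratic y v a yc.
have H2 := is_deriveB (is_deriveB Hf (is_deriveZ al H0)) (is_deriveZ eta H1).
apply: (is_derive_eq H2).
rewrite Df (proj2 (patch_diff hX ac yc)) mul_partial_mx !dot_suml /dw.
rewrite [RHS](eq_bigr (fun i => v 0 i * 'D_(delta_mx 0 i) f y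
   - (al * 2 * (v 0 i * dot ('D_(delta_mx 0 i) phi y) (phi y))
   + eta * 2 * (v 0 i * dot ('D_(delta_mx 0 i) phi y) (phi y - a))))); last first.
  move=> i _.
  have Ed : dot ('D_(delta_mx 0 i) phi y) (Zf y) =
    al * 2 * dot ('D_(delta_mx 0 i) phi y) (phi y) +
    eta * 2 * dot ('D_(delta_mx 0 i) phi y) (phi y - a) by exact: dot_comparison.
  rewrite Ed; ring.
rewrite sumrB big_split/= -!mulr_sumr.
by rewrite /GRing.scale/= !mulrA opprD addrA.
Qed.

Lemma comparison_deriv2 v i : is_derive x v (dw i) (\sum_j v 0 j * S j i).
Proof.
have [d1 D1] := partial_diff_scalar xc cf i.
have [d2 D2] := patch_deriv_diff hX ac xc i.
have Hf : is_derive x v (fun y => 'D_(delta_mx 0 i) f y)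
    ('D_v (fun y => 'D_(delta_mx 0 i) f y) x).
  by apply: derivableP; exact: diff_derivable.
have dZ : is_derive x v Zf ((2 * (al + eta)) *: 'D_v phi x).
  have Hp := derivableP (@phi_derivable x v xc).
  have H := is_deriveZ 2 (is_deriveD (is_deriveZ al Hp)
    (is_deriveZ eta (is_deriveB Hp (is_derive_cst a x v)))).
  by apply: (is_derive_eq H); rewrite subr0 -scalerDl scalerA.
have [dZ1 dZ2] := dZ.
have d2' : derivable (fun y => 'D_(delta_mx 0 i) phi y) x v by exact: diff_derivable.
have H := is_deriveB Hf (is_derive_dot d2' dZ1).
apply: (is_derive_eq H).
have E1 : dot ('D_v (fun y => 'D_(delta_mx 0 i) phi y) x) Z = \sum_j v 0 j *
    dot ('D_(delta_mx 0 j) (fun y => 'D_(delta_mx 0 i) phi y) x) Z.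
  by rewrite D2 mul_partial_mx dot_suml.
have E2 : dot ('D_(delta_mx 0 i) phi x) ('D_v Zf x) = 2 * (al + eta) *
    \sum_j v 0 j * dot ('D_(delta_mx 0 j) phi x) ('D_(delta_mx 0 i) phi x).
  rewrite dZ2 (proj2 (patch_diff hX ac xc) v) mul_partial_mx; exact: dot_scaled_sum.
rewrite D1 Zx E1 E2.
rewrite [RHS](eq_bigr (fun j => v 0 j * 'D_(delta_mx 0 j) (fun y => 'D_(delta_mx 0 i) f y) x
   - (v 0 j * dot ('D_(delta_mx 0 j) (fun y => 'D_(delta_mx 0 i) phi y) x) Z
   + 2 * (al + eta) * (v 0 j * dot ('D_(delta_mx 0 j) phi x) ('D_(delta_mx 0 i) phi x))))).
  by rewrite sumrB big_split/= -mulr_sumr.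
move=> j _; rewrite SE /g metric_entry; ring.
Qed.

Lemma max_conditions : (forall i, dw i x = 0) /\ forall v, quad S v <= 0.
Proof.
have nm : \forall y \near x, w y <= w x.
  have cp : {for x, continuous (param c)} by exact: param_continuous xc.
  have E : param c x = p by exact: coordK.
  pose P q := u q - al * dot (X q) (X q) - eta * dot (X q - a) (X q - a) <=
    u p - al * dot (X p) (X p) - eta * dot (X p - a) (X p - a).
  have nP : \forall q \near param c x, P q by rewrite E.
  have nP' : \forall y \near x, P (param c y) by exact: (cp _ nP).
  near=> y; have : P (param c y) by near: y.
  by rewrite /P /w /f /phi/= E.
have [d d0 dP] := near_both (near_cimg xc) nm.
apply: (local_max_conditions d0 (w := w)).
- by move=> y v /dP[yc _]; exact: comparison_deriv.
- by move=> v i; exact: comparison_deriv2.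
- by move=> y /dP[].
Unshelve. all: by end_near. Qed.

Let V := patch_grad phi f x.

(** The difference has a critical point at p, so the gradient of u is the
    tangential part of that of the quadratic function. *)
Lemma grad_tangent : V *m J = Z - dot Z (N p) *: N p.
Proof.
have [dw0 _] := max_conditions.
have NJ : N p *m J^T = 0 by rewrite -nux; exact: (normal_frame hN ac xc).
have ZJ : Z *m J^T = V *m g.
  rewrite (patch_grad_metric hX ac f xc); apply/rowP => i.
  have := dw0 i; rewrite /dw Zx => /eqP; rewrite subr_eq0 => /eqP E.
  rewrite [RHS]mxE E dotC mxE; apply: eq_bigr => k _.
  by congr (_ * _); rewrite [LHS]mxE [LHS]mxE.
apply/esym/eqP; rewrite -subr_eq0; apply/eqP.
apply: (frame_ext hX hN ac xc).
  rewrite [(N \o param c) x]nux !dotBl dotZl (normal_unit hN) mulr1 subrr sub0r.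
  by rewrite dotC dotE trmx_mul mulmxA NJ mul0mx mxE oppr0.
have JJ : J *m J^T = g by rewrite /g metricE.
by rewrite !mulmxBl ZJ -scalemxAl NJ scaler0 subr0 -(mulmxA V) JJ subrr.
Qed.

Lemma grad_bound : tnorm X p (grad X u p) <= enorm Z.
Proof.
rewrite /tnorm /inner ipE -/(enorm _) -[X in enorm X]/(V *m J).
rewrite -ler_sqr ?nnegrE ?enorm_ge0// !enorm_sqr grad_tangent.
exact: dot_tangent_le (normal_unit hN p).
Qed.

(** In [hess_metric] the second derivatives of the immersion are paired with
    the gradient of u. By [grad_tangent] they are paired with Z in S too, up
    to the normal component of Z, which produces the second fundamental
    form. *)
Lemma hess_at_max : patch_hess phi f x *m g =
  S + (2 * (al + eta)) *: g + dot Z (N p) *: h.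
Proof.
apply/matrixP => i l; rewrite (hess_metric hX ac xc cf) -/V -/J grad_tangent.
have hE : h i l = dot ('D_(delta_mx 0 i) (fun y => 'D_(delta_mx 0 l) phi y) x) (N p).
  by rewrite /h second_formE dotC -[(N \o param c) x]/(nu x) nux.
have -> : (S + (2 * (al + eta)) *: g + dot Z (N p) *: h) i l =
   S i l + 2 * (al + eta) * g i l + dot Z (N p) * h i l.
  by move: S g h => A B C; rewrite !mxE.
rewrite SE hE dotBr dotZr; ring.
Qed.

Variables (r : nat) (C : R).
Hypothesis hP : forall v, 0 <= inner X p (v *m newton X N r p) v.
Hypothesis trC : `|\tr (newton_mx r (h *m invmx g))| <= C.
Hypothesis trC' : `|\tr (h *m invmx g *m newton_mx r (h *m invmx g))| <= C.
Hypothesis al0 : 0 <= al.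
Hypothesis eta0 : 0 <= eta.

(** The Hessian is the sum of the nonpositive S, whose trace against the
    Newton transformation is nonpositive, of a multiple of the metric and of
    a multiple of the second fundamental form, whose traces are bounded by
    C. *)
Lemma drift_L_bound :
  drift_L X N r u p <= 2 * (al + eta) * C + enorm Z * C + enorm (X p) * enorm Z.
Proof.
have ug : g \in unitmx by exact: (metric_unit hX ac xc).
have symg : g^T = g by exact: metric_sym.
have symh : h^T = h by exact: (second_form_sym N hX ac xc).
have shE : shape X N p = h *m invmx g by exact: (patch_shapeE hX hN ac xc).
pose P := newton_mx r (h *m invmx g).
have PE : newton X N r p = P by rewrite /P -shE.
have [_ Snsd] := max_conditions.
have symQ := newton_mx_inv_sym r symg symh.
have psdQ v : 0 <= quad (invmx g *m P) v.
  have := hP (v *m invmx g); rewrite PE /inner /ip -/g /quad; congr (0 <= _ 0 0).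
  by rewrite trmx_mul trmx_inv symg !mulmxA mulmxK.
have trS := trace_nsd_psd Snsd symQ psdQ.
have hessE : hess X u p = (S + (2 * (al + eta)) *: g + dot Z (N p) *: h) *m invmx g.
  by rewrite -hess_at_max mulmxK.
have LE : L X N r u p = \tr (S *m (invmx g *m P)) + 2 * (al + eta) * \tr P
    + dot Z (N p) * \tr (h *m invmx g *m P).
  by rewrite /L hessE PE; exact: mxtrace_combination.
have ZN : `|dot Z (N p)| <= enorm Z.
  apply: (le_trans (dot_cauchy_schwarz _ _)).
  by rewrite {2}/enorm (normal_unit hN) sqrtr1 mulr1.
have C0 : 0 <= C by exact: le_trans trC.
have B1 : 2 * (al + eta) * \tr P <= 2 * (al + eta) * C.
  apply: ler_wpM2l; first by rewrite mulr_ge0// addr_ge0.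
  exact: le_trans (ler_norm _) trC.
have B2 : dot Z (N p) * \tr (h *m invmx g *m P) <= enorm Z * C.
  by apply: (le_trans (ler_norm _)); rewrite normrM ler_pM.
have DE : 'D_(grad X u p) (patch_at X p) (coord_at p) = V *m J.
  exact: (proj2 (patch_diff hX ac xc)).
have B3 : - dot (X p) (V *m J) <= enorm (X p) * enorm Z.
  apply: (le_trans (ler_norm _)); rewrite normrN.
  apply: (le_trans (dot_cauchy_schwarz _ _)).
  apply: ler_wpM2l; first exact: enorm_ge0.
  by have := grad_bound; rewrite /tnorm /inner ipE.
rewrite /drift_L LE DE -/P in trS *.
move: trS B1 B2 B3.
move: (\tr (S *m _)) (2 * _ * \tr P) (dot Z _ * _) (dot (X p) _) => t1 t2 t3 t4.
lra.
Qed.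
End MaxPoint.

(** * Almost maximum points *)

(** The logarithm is concave. *)
Lemma ln1D_tangent (R : realType) (a b : R) : 0 <= a -> 0 <= b ->
  ln (1 + a) <= ln (1 + b) + (1 + b)^-1 * (a - b).
Proof.
move=> a0 b0.
have b1 : 0 < 1 + b by rewrite ltr_wpDr.
have a1 : 0 < 1 + a by rewrite ltr_wpDr.
have E : 1 + (1 + b)^-1 * (a - b) = (1 + a) / (1 + b).
  by field; rewrite gt_eqF.
rewrite -lerBlDl -ln_div ?posrE// -E.
by apply: le_ln1Dx; rewrite -subr_gt0 opprK [X in 0 < X]addrC E divr_gt0.
Qed.

(** The maximum of w along the section over the closed ball of radius b is
    not on the boundary sphere; near its image, every point is the value of
    the section at its own projection, by local injectivity. *)
Lemma section_local_max (R : realType) (n : nat) (T : topologicalType)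
    (F : T -> 'rV[R]_n) (G : set T) (s : 'rV[R]_n -> T) (c : 'rV[R]_n) (a b : R)
    (w : T -> R) :
  continuous F -> section_on F G s c a ->
  (forall q, G q -> locally_injective_at F q) ->
  continuous w -> 0 <= b -> b < a ->
  (forall y, `|y - c| = b -> w (s y) < w (s c)) ->
  exists2 q, w (s c) <= w q & \forall q' \near q, w q' <= w q.
Proof.
move=> cF sec inj cw b0 ba wb.
pose K := closed_ball_ Num.Def.normr c b.
have KE y : K y = (`|y - c| <= b) :> Prop by rewrite /K/closed_ball_/= distrC.
have Kc : K c by rewrite KE subrr normr0.
have cws : {within K, continuous (w \o s)}.
  apply: continuous_in_subspaceT => y /set_mem; rewrite KE => yK.
  have [_ sy _] := sec y (le_lt_trans yK ba).
  by apply: (@cvg_comp _ _ _ s w _ (nbhs (s y))); [exact: sy|exact: cw].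
have [|z /set_mem Kz zmax] := EVT_max_rV _ (@closed_ball_rV_compact _ _ c b) cws.
  by exists c.
have zK : `|z - c| <= b by rewrite -KE.
have wz : w (s c) <= w (s z) by apply: zmax; exact: mem_set.
exists (s z) => //.
have zb : `|z - c| < b.
  rewrite lt_neqAle zK andbT; apply/eqP => zb.
  by have := wb _ zb; rewrite ltNge wz.
have [Fz sz Gz] := sec z (le_lt_trans zK ba).
have [U nU Uinj] := inj _ Gz.
have cFz : F q @[q --> s z] --> z by rewrite -[z in X in _ --> X]Fz; exact: cF.
have nb : \forall q \near s z, `|F q - c| < b.
  have /cvgrPdist_lt/(_ (b - `|z - c|)) := cFz.
  rewrite subr_gt0 => /(_ zb); apply: filterS => q.
  rewrite ltrBrDr distrC => H; apply: le_lt_trans H.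
  by rewrite -[X in `|X - c|](subrK z) -addrA ler_normD.
have nU' : \forall q \near s z, U (s (F q)).
  exact: (cvg_comp F s cFz sz) nU.
near=> q.
have Fb : `|F q - c| < b by near: q.
have [FsF _ _] := sec (F q) (lt_trans Fb ba).
have -> : q = s (F q).
  by apply: Uinj; [near: q|near: q|].
have KF : K (F q) by rewrite KE ltW.
by apply: zmax; exact: mem_set.
Unshelve. all: by end_near. Qed.

Lemma drop_coord_dot (R : realType) (n : nat) (i : 'I_n.+1) (v : 'rV[R]_n.+1) :
  `|drop_coord i v| ^+ 2 <= dot v v.
Proof.
rewrite -enorm_sqr lerXn2r ?nnegrE// ?enorm_ge0//.
exact: le_trans (drop_coord_norm _ _) (norm_le_enorm _).
Qed.

(** With x = |X|, the equation a (1 + x^2) = ep makes a, 2 a x and a x^2 all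
    at most ep. The two halves of e absorb the terms in ep and in eta; the
    choice of ep does not involve B, since B depends on ep. *)
Lemma drift_arith (R : realType) (e Lo C B ep eta a z x : R) :
  0 < e -> 0 <= Lo -> 0 <= C -> 0 <= B ->
  ep = e / (2 * (Lo + 3 * C + 4)) -> eta = e / (2 * (4 * C + 2 * B + 4)) ->
  0 <= a -> 0 <= x -> x <= B -> 
  a * (1 + x ^+ 2) = ep -> 0 <= z -> z <= 2 * (a * x + eta) ->
  z < e /\ 2 * (a + eta) * C + z * C + x * z < e.
Proof.
move=> e0 L0 C0 B0 epE etaE a0 x0 xB aE z0 zle.
have ep1 : ep * (Lo + 3 * C + 4) = e / 2.
  by rewrite epE; field; rewrite gt_eqF//; lra.
have eta1 : eta * (4 * C + 2 * B + 4) = e / 2.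
  by rewrite etaE; field; rewrite gt_eqF//; lra.
have ep0 : 0 < ep by rewrite epE divr_gt0//; lra.
have eta0 : 0 < eta by rewrite etaE divr_gt0//; lra.
have ax2 : 2 * (a * x) <= ep by have := mulr_ge0 a0 (sqr_ge0 (1 - x)); lra.
have axx : a * x * x <= ep by rewrite -mulrA -expr2; lra.
have aep : a <= ep by have := mulr_ge0 a0 (sqr_ge0 x); lra.
have zep : z <= ep + 2 * eta by lra.
have epL := mulr_ge0 (ltW ep0) L0; have epC := mulr_ge0 (ltW ep0) C0.
have etaC := mulr_ge0 (ltW eta0) C0; have etaB := mulr_ge0 (ltW eta0) B0.
have zC : z * C <= (ep + 2 * eta) * C by exact: ler_wpM2r.
have aC : a * C <= ep * C by exact: ler_wpM2r.
have xz : x * z <= x * (2 * (a * x + eta)) by exact: ler_wpM2l.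
have etax : eta * x <= eta * B by rewrite ler_pM2l.
split; lra.
Qed.

Section MaximumPrinciple.
Context (R : realType) (n : nat) (M : smooth_manifold R n).
Variables (X N : M -> 'rV[R]_n.+1).
Hypothesis hconn : connected [set: M].
Hypothesis hX : smooth_immersion X.
Hypothesis hN : unit_normal_field X N.
Hypothesis hcomplete : complete_hypersurface X.
Hypothesis hA : has_ubound (range (shape_sqnorm X N)).

Let cX : continuous X := immersion_continuous hX.

(** If p is almost a maximum point of v, the penalty on the boundary of the
    graph over a ball around p exceeds what v can gain there, so the
    perturbed function has an interior maximum on the graph. *)
Lemma perturbed_max (v : M -> R) (eta : R) (o : M) :
  continuous v -> has_ubound (range v) -> 0 < eta ->
  exists q, exists a, [/\ v o <= v q, dot (X q - a) (X q - a) <= 1 &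
    \forall q' \near q, v q' - eta * dot (X q' - a) (X q' - a) <=
                        v q - eta * dot (X q - a) (X q - a)].
Proof.
move=> cv ubv eta0.
have [K K0 KA] : exists2 K : R, 0 <= K & forall p, shape_sqnorm X N p <= K ^+ 2.
  have [K0 KP] := hA; exists (1 + `|K0|); first by rewrite addr_ge0.
  move=> p; have := KP (shape_sqnorm X N p) (ex_intro2 _ _ p I erefl).
  have := ler_norm K0; have := sqr_ge0 `|K0|; have := normr_ge0 K0; lra.
have [rho rho0 graph] := uniform_graph hconn hX hN hcomplete K0 KA.
(* b <= 1 keeps q at distance at most 1 from p *)
pose b := Num.min (rho / 2) 1.
have b0 : 0 < b by rewrite lt_min divr_gt0//=.
have b1 : b <= 1 by rewrite ge_min lexx orbT.
have brho : b < rho by rewrite gt_min; apply/orP; left; lra.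
have supv : has_sup (range v) by split=> //; exists (v o), o.
have d0 : 0 < eta * b ^+ 2 by rewrite mulr_gt0// exprn_gt0.
have [p [vop vp]] : exists p, v o <= v p /\ sup (range v) - eta * b ^+ 2 < v p.
  have [_ [p _ <-] vp] := sup_adherent d0 supv.
  have [op|po] := leP (v o) (v p); first by exists p.
  by exists o; split => //; exact: lt_trans po.
have vsup q : v q <= sup (range v) by apply: ub_le_sup => //; exists q.
have [i [G [s [sec sp inj]]]] := graph p.
pose w q := v q - eta * dot (X q - X p) (X q - X p).
have cw : continuous w.
  move=> q; apply: cvgB; first exact: cv.
  apply: cvgM; first exact: cvg_cst.
  have H : X q' - X p @[q' --> q] --> X q - X p.
    by apply: cvgB; [exact: cX|exact: cvg_cst].
  exact: (cvg_dot (nbhs_filter q) H H).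
have dot0 : dot (X p - X p) (X p - X p) = 0.
  by rewrite subrr -(scale0r 0) dotZl mul0r.
have wp : w (s (proj X i p)) = v p by rewrite sp /w dot0 mulr0 subr0.
have [|q wq qmax] := section_local_max (@proj_continuous _ _ _ _ hX i) sec inj cw (ltW b0) brho.
  move=> y yb; rewrite wp /w.
  have [Fy _ _] := sec y (eq_ind_r (fun t => t < rho) brho yb).
  have : b ^+ 2 <= dot (X (s y) - X p) (X (s y) - X p).
    by apply: le_trans (drop_coord_dot i _); rewrite drop_coordB -yb -[in leLHS]Fy.
  rewrite -(ler_pM2l eta0).
  by move: (vsup (s y)) vp; move: (eta * dot _ _) => t; lra.
rewrite wp /w in wq.
have dq0 := mulr_ge0 (ltW eta0) (dot_ge0 (X q - X p)).
exists q, (X p); split => //; first by move: wq vop dq0; lra.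
have : dot (X q - X p) (X q - X p) <= b ^+ 2.
  by rewrite -(ler_pM2l eta0); move: (vsup q) vp wq; lra.
move/le_trans; apply; rewrite expr_le1//; exact: ltW.
Qed.

Variables (r : nat) (u : M -> R).
Hypothesis hP : positive_semidefinite X (newton X N r).
Hypothesis hu : C_manifold 2 u.
Hypothesis hu_bounded : has_ubound (range u).

(** The logarithmic penalty confines the points competing with o to an
    ambient ball, of radius B. At the local maximum of [perturbed_max],
    concavity replaces the logarithm by its tangent al |X|^2, and the
    quadratic comparison applies. *)
Lemma almost_max (e : R) (o : M) : 0 < e -> exists q,
  [/\ u o - e < u q, tnorm X q (grad X u q) < e & drift_L X N r u q < e].
Proof.
move=> e0.
have [K KA] := hA.
have [C C0 CP] := newton_trace_bound n r K.
pose sq q := dot (X q) (X q).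
have sq0 q : 0 <= sq q by exact: dot_ge0.
pose Lo := ln (1 + sq o).
have lnge q : 0 <= ln (1 + sq q) by rewrite ln_ge0// lerDl.
pose ep := e / (2 * (Lo + 3 * C + 4)).
have L0 : 0 <= Lo by exact: lnge.
have ep0 : 0 < ep by rewrite /ep divr_gt0//; lra.
have epL : ep * Lo < e.
  have -> : ep * Lo = e * (Lo / (2 * (Lo + 3 * C + 4))).
    by rewrite /ep; ring.
  rewrite -[ltRHS]mulr1 ltr_pM2l// ltr_pdivrMr; lra.
pose v q := u q - ep * ln (1 + sq q).
have vu q : v q <= u q by rewrite /v gerBl mulr_ge0// ltW.
have [U UP] := hu_bounded.
have uU q : u q <= U by apply: UP; exists q.
(* ln (1 + |X q|^2) <= (U - v o) / ep at these points, and |X| <= 1 + |X|^2 *)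
pose B := expR ((U - v o) / ep).
have B0 : 0 <= B by exact: expR_ge0.
have XB q : v o <= v q -> enorm (X q) <= B.
  move=> voq; have lnB : ln (1 + sq q) <= (U - v o) / ep.
    rewrite ler_pdivlMr// mulrC; move: voq (uU q); rewrite /v; lra.
  have s1 : 0 < 1 + sq q by rewrite ltr_wpDr.
  have : 1 + sq q <= B by rewrite -[leLHS]lnK ?posrE// ler_expR.
  rewrite /sq -enorm_sqr; have := sqr_ge0 (1 - enorm (X q)).
  have := sqr_ge0 (enorm (X q)); lra.
pose eta := e / (2 * (4 * C + 2 * B + 4)).
have eta0 : 0 < eta by rewrite /eta divr_gt0//; lra.
have cv : continuous v.
  move=> q.
  have H : 1 + sq q' @[q' --> q] --> 1 + sq q.
    apply: cvgD; first exact: cvg_cst.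
    exact: (cvg_dot (nbhs_filter q) (cX (x:=q)) (cX (x:=q))).
  have Hln : ln (1 + sq q') @[q' --> q] --> ln (1 + sq q).
    apply: (@cvg_comp _ _ _ (fun q' => 1 + sq q') (@ln R) _ _ _ H).
    by apply: continuous_ln; rewrite ltr_wpDr.
  apply: cvgB; first exact: (C_manifold_continuous hu).
  exact: (cvgM (cvg_cst ep) Hln).
have ubv : has_ubound (range v).
  by exists U => _ [q _ <-]; exact: le_trans (vu q) (uU q).
have [q [a [voq qa qmax]]] := perturbed_max o cv ubv eta0.
exists q.
pose al := ep / (1 + sq q).
have s1 : 0 < 1 + sq q by rewrite ltr_wpDr.
have al0 : 0 <= al by rewrite divr_ge0// ltW.
have umax : \forall q' \near q,
    u q' - al * dot (X q') (X q') - eta * dot (X q' - a) (X q' - a) <=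
    u q - al * dot (X q) (X q) - eta * dot (X q - a) (X q - a).
  apply: filterS qmax => q'.
  have := ler_wpM2l (ltW ep0) (ln1D_tangent (sq0 q') (sq0 q)).
  rewrite mulrDr [ep * (_ * _)]mulrA -/al /v -/(sq q') -/(sq q).
  move: (ep * ln (1 + sq q')) (ep * ln (1 + sq q)) => t1 t2.
  move: (eta * dot (X q' - a) _) (eta * dot (X q - a) _) => t3 t4.
  rewrite mulrBr; move: (al * sq q') (al * sq q) => t5 t6; lra.
have pcq := cimg_coord (chart_at_dom q); have ac := chart_at_atlas q.
pose g := metric (X \o param (chart_at q)) (coord_at q).
pose h := second_form X N (chart_at q) (coord_at q).
have [trC trC'] : `|\tr (newton_mx r (h *m invmx g))| <= C /\
    `|\tr (h *m invmx g *m newton_mx r (h *m invmx g))| <= C.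
  apply: CP.
  - exact: metric_sym.
  - exact: (metric_posdef (patch_free hX ac pcq)).
  - exact: (second_form_sym N hX ac pcq).
  - rewrite -(patch_shapeE hX hN ac pcq); apply: KA; by exists q.
have G := grad_bound hX hN hu umax.
have D := drift_L_bound hX hN hu umax (hP q) trC trC' al0 (ltW eta0).
have Zle : enorm (comparison_grad X q al eta a) <= 2 * (al * enorm (X q) + eta).
  rewrite /comparison_grad enormZ ger0_norm// ler_pM2l//.
  apply: le_trans (enormD _ _) _; rewrite !enormZ !ger0_norm// ?(ltW eta0)//.
  rewrite lerD2l -[leRHS]mulr1 ler_pM2l//.
  by rewrite /enorm -sqrtr1 ler_sqrt.
have alE : al * (1 + enorm (X q) ^+ 2) = ep.
  by rewrite enorm_sqr -/(sq q) /al divfK// gt_eqF.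
have [E1 E2] := drift_arith e0 L0 C0 B0 erefl erefl al0 (enorm_ge0 _) (XB q voq)
  alE (enorm_ge0 _) Zle.
split; [|exact: le_lt_trans G E1|exact: le_lt_trans D E2].
have := vu q; move: voq; rewrite /v -/Lo; move: epL; lra.
Qed.
End MaximumPrinciple.

Theorem lemma3p2 (R : realType) (n r : nat) (M : smooth_manifold R n)
    (X N : M -> 'rV[R]_n.+1)
    (hr : (1 <= r <= n)%N)
    (hM_nonempty : [set: M] !=set0)
    (hM_connected : connected [set: M])
    (hX : smooth_immersion X)
    (hN : unit_normal_field X N)
    (hcomplete : complete_hypersurface X)
    (hA : has_ubound (range (shape_sqnorm X N)))
    (hP : positive_semidefinite X (newton X N r.-1))
    (u : M -> R)
    (hu : C_manifold 2 u)
    (hu_bounded : has_ubound (range u)) :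
  exists x : nat -> M,
    u (x k) @[k --> \oo] --> sup (range u) /\
    forall k : nat, (0 < k)%N ->
      tnorm X (x k) (grad X u (x k)) < k%:R^-1 /\
      drift_L X N r.-1 u (x k) < k%:R^-1.
Proof.
have [p0 _] := hM_nonempty.
have supu : has_sup (range u) by split=> //; exists (u p0), p0.
have pick k : exists q, (0 < k)%N ->
    [/\ sup (range u) - 2 * k%:R^-1 < u q, tnorm X q (grad X u q) < k%:R^-1 &
        drift_L X N r.-1 u q < k%:R^-1].
  have [->|k0] := posnP k; first by exists p0.
  have e0 : 0 < k%:R^-1 :> R by rewrite invr_gt0 ltr0n.
  have [_ [p _ <-] pP] := sup_adherent e0 supu.
  have [q [q1 q2 q3]] :=
    almost_max hM_connected hX hN hcomplete hA hP hu hu_bounded p e0.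
  by exists q => _; split => //; move: pP q1; lra.
have [x xP] := choice pick; exists x; split; last first.
  by move=> k /xP[].
apply/cvgrPdist_lt => e e0.
exists (Num.truncn (2 / e)).+1 => // k /= kk.
have k0 : (0 < k)%N by exact: leq_ltn_trans kk.
have [H _ _] := xP k k0.
have usup : u (x k) <= sup (range u) by apply: ub_le_sup => //; exists (x k).
rewrite ger0_norm ?subr_ge0// ltrBlDl -ltrBlDr.
apply: le_lt_trans H; rewrite lerD2l lerN2.
rewrite ler_pdivrMr ?ltr0n//.
rewrite mulrC -ler_pdivrMr//; apply: ltW; apply: lt_le_trans (truncnS_gt _) _.
by rewrite ler_nat.
Qed.
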